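(* Let $p$ be a prime and $m \ge 1$ an integer. Let $\lambda_0, \lambda_1, \ldots, \lambda_m \in \mathbb{Z}$ with $\lambda_i \neq 0$ for some $i$, and let $\alpha_1, \ldots, \alpha_m \in \mathbb{Q}$ be pairwise distinct and non-zero. Let $Q>0$ be an integer such that $Q\alpha_i\in\mathbb{Z}$ for all $i=1,\ldots,m$. Assume that $M>1$, $\alpha<1$, $H>1$, $$f(m,M,Q,\alpha)>1$$ and $$-\frac{1}{e^{R_1(m,M,Q,\alpha)}H} = \frac{-\log f(m,M,Q,\alpha)}{2^{m-1} e^{1.03883m} Q^m H \cdot \frac{M^{m+1}}{M-1} \cdot (m+1)(m+2) \alpha} \ge -\frac{1}{e}.$$ Then $$|\Lambda_p|_p > c_1(m,M,Q,\alpha)\,H^{-\omega_1(m,M,Q,\alpha,H)}.$$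
   Context: $|\cdot|_p$ is the $p$-adic absolute value (with $|p|_p=1/p$), $|\cdot|$ the usual absolute value. $\boldsymbol{\log}$ denotes the $p$-adic logarithm, $\boldsymbol{\log}(1+t)=\sum_{n=0}^\infty \frac{(-1)^n}{n+1}t^{n+1}$, which converges $p$-adically for $|t|_p<1$; non-bold $\log$ is the real natural logarithm. $\Lambda_p := \lambda_0+\lambda_1\boldsymbol{\log}(1+\alpha_1)+\ldots+\lambda_m\boldsymbol{\log}(1+\alpha_m)$, $M:=\max_{1\le i\le m}|\alpha_i|$, $\alpha:=\max_{1\le i\le m}|\alpha_i|_p$, $H:=\max_{0\le i\le m}|\lambda_i|$. $$f(m,M,Q,\alpha):=2^{-1}\cdot 3^{-m}e^{-1.03883m}Q^{-m}M^{-m}\alpha^{-m-1}.$$ \begin{multline*}R_1(m,M,Q,\alpha):=1.03883m+m\log Q+\log(m+1)+(m-1)\log 2+(m+1)\log M\\-\log(M-1)+\log(m+2)+\log\alpha-\log\log f(m,M,Q,\alpha),\end{multline*} $$c_1(m,M,Q,\alpha):=\frac{M-1}{6^m(m+1)e^{2.07766m}Q^{2m}M^{2m+1}}\cdot e^{\left(\frac{(m+1)\log\alpha}{\log f(m,M,Q,\alpha)}+1\right)\left(R_1(m,M,Q,\alpha)+1\right)},$$ $$\omega_1(m,M,Q,\alpha,H):=\left(-\frac{(m+1)\log\alpha}{\log f(m,M,Q,\alpha)}-1\right)\left(1+\frac{\log\left(\log H+R_1(m,M,Q,\alpha)\right)}{\log H}\right)+1.$$ *)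

(* Defs.v *)
From HB Require Import structures.
From mathcomp Require Import all_boot all_order all_algebra.
From mathcomp Require Import generic_quotient ring_quotient.
From mathcomp Require Import zify ring lra.
From mathcomp Require Import all_classical all_reals all_analysis.

Set Implicit Arguments.
Unset Strict Implicit.
Unset Printing Implicit Defensive.

Import Order.TTheory GRing.Theory Num.Theory.
Import numFieldNormedType.Exports.

Local Open Scope classical_set_scope.
Local Open Scope ring_scope.

Section PadicAbs.
Variable p : nat.

Definition padic_val (q : rat) : int :=
  (logn p `|numq q|)%:Z - (logn p `|denq q|)%:Z.

Definition padic_abs (q : rat) : rat :=
  if q == 0 then 0 else p%:R ^ (- padic_val q).

Definition padic_cauchy (u : nat -> rat) : Prop :=
  forall e, 0 < e -> exists N, forall m n,
    (N <= m)%N -> (N <= n)%N -> padic_abs (u m - u n) < e.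

Definition padic_null (u : nat -> rat) : Prop :=
  forall e, 0 < e -> exists N, forall n, (N <= n)%N -> padic_abs (u n) < e.

End PadicAbs.

Section PadicAbsTheory.
Variables (p : nat) (p_pr : prime p).
Local Notation abs := (padic_abs p).

Let p_gt1 : 1 < p%:R :> rat.
Proof. by rewrite ltr1n prime_gt1. Qed.

Let p_gt0 : 0 < p%:R :> rat.
Proof. exact: lt_trans p_gt1. Qed.

Lemma padic_abs0 : abs 0 = 0.
Proof. by rewrite /padic_abs eqxx. Qed.

Lemma padic_abs_ge0 x : 0 <= abs x.
Proof. by rewrite /padic_abs; case: ifP => // _; exact/exprz_ge0/ltW. Qed.

Lemma padic_abs_eq0 x : (abs x == 0) = (x == 0).
Proof.
rewrite /padic_abs; case: ifP => [|_]; first by rewrite eqxx.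
by apply/negbTE/lt0r_neq0/exprz_gt0.
Qed.

Lemma padic_val_frac (a b : int) : a != 0 -> b != 0 ->
  padic_val p (a%:~R / b%:~R) = (logn p `|a|)%:Z - (logn p `|b|)%:Z.
Proof.
move=> a0 b0; rewrite /padic_val; case: divqP a0 b0 => // k x k0 + +.
rewrite !mulf_eq0 !negb_or => /andP[_ nx0] /andP[_ dx0].
rewrite !abszM !lognM ?absz_gt0 //; lia.
Qed.

Lemma padic_valM x y : x != 0 -> y != 0 ->
  padic_val p (x * y) = padic_val p x + padic_val p y.
Proof.
move=> x0 y0; have -> : x * y = (numq x * numq y)%:~R / (denq x * denq y)%:~R.
  by rewrite -{1}(divq_num_den x) -{1}(divq_num_den y) !intrM mulf_div.
rewrite padic_val_frac ?mulf_neq0 ?numq_eq0 ?denq_eq0 //.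
by rewrite !abszM !lognM ?absz_gt0 ?numq_eq0 ?denq_eq0 // /padic_val; lia.
Qed.

Lemma padic_absM x y : abs (x * y) = abs x * abs y.
Proof.
have [->|x0] := eqVneq x 0; first by rewrite mul0r padic_abs0 mul0r.
have [->|y0] := eqVneq y 0; first by rewrite mulr0 padic_abs0 mulr0.
rewrite /padic_abs mulf_eq0 (negbTE x0) (negbTE y0) /= padic_valM // opprD.
by rewrite expfzDr // lt0r_neq0.
Qed.

Lemma padic_abs1 : abs 1 = 1.
Proof. by rewrite /padic_abs oner_eq0 /padic_val !(logn1, subrr, oppr0). Qed.

Lemma padic_absN x : abs (- x) = abs x.
Proof. by rewrite /padic_abs oppr_eq0 /padic_val numqN denqN abszN. Qed.

Lemma padic_valD x y : x != 0 -> y != 0 -> x + y != 0 ->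
  Num.min (padic_val p x) (padic_val p y) <= padic_val p (x + y).
Proof.
move=> x0 y0.
have dx := denq_neq0 x; have dy := denq_neq0 y.
have -> : x + y = (numq x * denq y + numq y * denq x)%:~R
                  / (denq x * denq y)%:~R.
  rewrite -{1}(divq_num_den x) -{1}(divq_num_den y) intrD !intrM.
  by field; rewrite !intr_eq0 dx dy.
set n := (_ + _ : int); move=> xy0.
have n0 : n != 0 by apply: contra xy0 => /eqP->; rewrite mul0r.
rewrite padic_val_frac ?mulf_neq0 //.
have nx : numq x != 0 by rewrite numq_eq0.
have ny : numq y != 0 by rewrite numq_eq0.
pose k := minn (logn p `|numq x * denq y|) (logn p `|numq y * denq x|).
have : (p ^ k %| `|n|)%N.
  suff : ((p ^ k)%N%:Z %| n)%Z by rewrite dvdzE.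
  by rewrite rpredD // dvdzE /= pfactor_dvdn ?geq_minl ?geq_minr //
    absz_gt0 mulf_neq0.
rewrite pfactor_dvdn ?absz_gt0 // /k !abszM !lognM ?absz_gt0 //.
rewrite /padic_val; lia.
Qed.

Lemma padic_absD x y : abs (x + y) <= Num.max (abs x) (abs y).
Proof.
have [->|x0] := eqVneq x 0.
  by rewrite add0r le_max lexx orbT.
have [->|y0] := eqVneq y 0.
  by rewrite addr0 le_max lexx.
have [->|xy0] := eqVneq (x + y) 0.
  by rewrite padic_abs0 le_max padic_abs_ge0.
have := padic_valD x0 y0 xy0.
rewrite /padic_abs (negbTE x0) (negbTE y0) (negbTE xy0).
by rewrite le_max !ler_eXz2l // !lerN2 ge_min.
Qed.

Lemma padic_absD_lt x y e : abs x < e -> abs y < e -> abs (x + y) < e.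
Proof. by move=> xe ye; rewrite (le_lt_trans (padic_absD x y)) // gt_max xe. Qed.

Lemma padic_absB_lt x y e : abs x < e -> abs y < e -> abs (x - y) < e.
Proof. by move=> xe ye; apply: padic_absD_lt; rewrite ?padic_absN. Qed.

Lemma padic_abs_isosceles x y : abs (x - y) < abs y -> abs x = abs y.
Proof.
move=> h; apply/eqP; rewrite eq_le; apply/andP; split.
  have := padic_absD (x - y) y; rewrite subrK => /le_trans; apply.
  by rewrite ge_max lexx ltW.
rewrite leNgt; apply/negP => h2.
have := padic_absB_lt h2 h; rewrite opprB addrC subrK.
by rewrite ltxx.
Qed.

Lemma padic_cauchy_bounded u : padic_cauchy p u ->
  exists2 B, 0 < B & forall n, abs (u n) < B.
Proof.
case/(_ _ ltr01) => N hN.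
exists (1 + \sum_(i < N.+1) abs (u i)).
  by rewrite ltr_pwDl // sumr_ge0 // => i _; exact: padic_abs_ge0.
move=> n; have h i : (i <= N)%N -> abs (u i) < 1 + \sum_(i < N.+1) abs (u i).
  move=> iN; rewrite (bigD1 (inord i)) //= inordK // addrCA.
  by rewrite ltrDl ltr_pwDl // sumr_ge0 // => *; exact: padic_abs_ge0.
have [/h//|/ltnW nN] := leqP n N.
rewrite -[u n](subrK (u N)); apply: padic_absD_lt; last exact: h.
rewrite (lt_le_trans (hN _ _ _ _)) // lerDl sumr_ge0 // => *.
exact: padic_abs_ge0.
Qed.

Lemma padic_cauchyB u v :
  padic_cauchy p u -> padic_cauchy p v -> padic_cauchy p (u - v).
Proof.
move=> cu cv e e0; have [N hN] := cu _ e0; have [N' hN'] := cv _ e0.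
exists (maxn N N') => m n; rewrite !geq_max => /andP[? ?] /andP[? ?].
have -> : (u - v) m - (u - v) n = (u m - u n) - (v m - v n).
  by rewrite -[(u - v) m]/(u m - v m) -[(u - v) n]/(u n - v n); ring.
by apply: padic_absB_lt; [apply: hN|apply: hN'].
Qed.

Lemma padic_nullM u v :
  padic_cauchy p u -> padic_null p v -> padic_null p (u * v).
Proof.
move=> /padic_cauchy_bounded[B B0 hB] nv e e0.
have [|N hN] := nv (e / B); first by rewrite divr_gt0.
exists N => n /hN; rewrite ltr_pdivlMr // => h.
rewrite padic_absM mulrC; apply: le_lt_trans h.
by rewrite ler_wpM2l ?padic_abs_ge0 // ltW.
Qed.

Lemma padic_cauchyM u v :
  padic_cauchy p u -> padic_cauchy p v -> padic_cauchy p (u * v).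
Proof.
move=> cu cv e e0.
have [B B0 hB] := padic_cauchy_bounded cu.
have [C C0 hC] := padic_cauchy_bounded cv.
have [|N hN] := cu (e / C); first by rewrite divr_gt0.
have [|N' hN'] := cv (e / B); first by rewrite divr_gt0.
exists (maxn N N') => m n; rewrite !geq_max => /andP[? ?] /andP[? ?].
have -> : (u * v) m - (u * v) n = (u m - u n) * v m + (v m - v n) * u n.
  by rewrite -[(u * v) m]/(u m * v m) -[(u * v) n]/(u n * v n); ring.
apply: padic_absD_lt; rewrite padic_absM.
  have := hN m n; rewrite ltr_pdivlMr // => /(_ _ _)/(le_lt_trans _)-> //.
  by rewrite ler_wpM2l ?padic_abs_ge0 // ltW.
have := hN' m n; rewrite ltr_pdivlMr // => /(_ _ _)/(le_lt_trans _)-> //.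
by rewrite ler_wpM2l ?padic_abs_ge0 // ltW.
Qed.

Lemma padic_cauchy_cst q : padic_cauchy p (fun=> q).
Proof. by move=> e e0; exists 0%N => m n _ _; rewrite subrr padic_abs0. Qed.

(* A Cauchy sequence that is not null is eventually bounded away from 0. *)
Lemma padic_cauchy_apart u : padic_cauchy p u -> ~ padic_null p u ->
  exists2 d, 0 < d & exists N, forall n, (N <= n)%N -> d <= abs (u n).
Proof.
move=> cu /existsNP[e /not_implyP[e0 /forallNP he]].
have [N hN] := cu _ e0; exists e => //; exists N => n Nn.
rewrite leNgt; apply/negP => une; apply: (he N) => m Nm.
by rewrite -[u m](subrK (u n)); apply: padic_absD_lt => //; apply: hN.
Qed.

Lemma padic_cauchyV u : padic_cauchy p u -> ~ padic_null p u ->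
  padic_cauchy p (fun n => (u n)^-1).
Proof.
move=> cu nu e e0; have [d d0 [N hd]] := padic_cauchy_apart cu nu.
have [|N' hN'] := cu (e * (d * d)); first by rewrite !mulr_gt0.
exists (maxn N N') => m n; rewrite !geq_max => /andP[mN mN'] /andP[nN nN'].
have dm := hd _ mN; have dn := hd _ nN.
have um : u m != 0 by rewrite -padic_abs_eq0 lt0r_neq0 // (lt_le_trans d0).
have un : u n != 0 by rewrite -padic_abs_eq0 lt0r_neq0 // (lt_le_trans d0).
have dd : d * d <= abs (u m * u n) by rewrite padic_absM ler_pM // ltW.
have h := hN' _ _ nN' mN'.
rewrite -(@ltr_pM2r _ (abs (u m * u n))); last exact: lt_le_trans (mulr_gt0 _ _) dd.
rewrite -padic_absM.
have -> : ((u m)^-1 - (u n)^-1) * (u m * u n) = u n - u m.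
  by field; rewrite um un.
by apply: lt_le_trans h _; rewrite ler_pM2l.
Qed.

End PadicAbsTheory.

Section PadicField.
Variables (p : nat) (p_pr : prime p).

(* The proof of primality is a phantom argument that makes the ring structure *)
(* on the Cauchy sequences canonical.                                         *)
Definition padic_cauchy_pred of prime p : {pred nat -> rat} :=
  [pred u | `[< padic_cauchy p u >]].

Fact padic_cauchy_subring : subring_closed (padic_cauchy_pred p_pr).
Proof.
split; first by apply/asboolP/padic_cauchy_cst.
- by move=> u v /asboolP cu /asboolP cv; apply/asboolP/padic_cauchyB.
- by move=> u v /asboolP cu /asboolP cv; apply/asboolP/padic_cauchyM.
Qed.

HB.instance Definition _ :=
  GRing.isSubringClosed.Build (nat -> rat) (padic_cauchy_pred p_pr)
    padic_cauchy_subring.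

Record padic_seq := PadicSeq {
  padic_seq_val :> nat -> rat ;
  _ : padic_seq_val \in padic_cauchy_pred p_pr }.

HB.instance Definition _ := [isSub for padic_seq_val].
HB.instance Definition _ := [Choice of padic_seq by <:].
HB.instance Definition _ := [SubChoice_isSubComNzRing of padic_seq by <:].

Lemma padic_seqP (u : padic_seq) : padic_cauchy p u.
Proof. by case: u => u /= hu; exact/asboolP. Qed.

Definition padic_null_pred : {pred padic_seq} :=
  [pred u : padic_seq | `[< padic_null p u >]].

Fact padic_null_ideal : idealr_closed padic_null_pred.
Proof.
split.
- by apply/asboolP => e e0; exists 0%N => n _ /=; rewrite padic_abs0.
- apply/asboolP => /(_ _ ltr01)[N /(_ _ (leqnn N))] /=.
  by rewrite padic_abs1 ltxx.
- move=> a u v /asboolP nu /asboolP nv; apply/asboolP => e e0.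
  have [N hN] := padic_nullM p_pr (padic_seqP a) nu e0.
  have [N' hN'] := nv _ e0.
  exists (maxn N N') => n; rewrite geq_max => /andP[/hN ? /hN' ?].
  exact: padic_absD_lt.
Qed.

HB.instance Definition _ :=
  isIdealr.Build padic_seq padic_null_pred padic_null_ideal.

Local Notation padicQ := {ideal_quot padic_null_pred}.

Local Open Scope quotient_scope.

Lemma padic_pi_eq0 (u : padic_seq) :
  (\pi_padicQ u == 0) = `[< padic_null p u >].
Proof.
have -> : 0 = \pi_padicQ 0 by rewrite rmorph0.
by rewrite piE Quotient.equivE subr0.
Qed.

Definition padic := padicQ.

HB.instance Definition _ := GRing.ComNzRing.on padic.

Definition padic_of_seq (u : padic_seq) : padic := \pi_padicQ u.

Definition padic_repr (x : padic) : padic_seq := repr (x : padicQ).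

Lemma padic_reprK : cancel padic_repr padic_of_seq.
Proof. exact: reprK. Qed.

Fact padic_of_seq_zmod : zmod_morphism padic_of_seq.
Proof. exact: (rmorphB (\pi_padicQ)). Qed.

Fact padic_of_seq_monoid : monoid_morphism padic_of_seq.
Proof.
by split; [exact: (rmorph1 (\pi_padicQ)) | exact: (rmorphM (\pi_padicQ))].
Qed.

HB.instance Definition _ :=
  GRing.isZmodMorphism.Build padic_seq padic padic_of_seq padic_of_seq_zmod.
HB.instance Definition _ :=
  GRing.isMonoidMorphism.Build padic_seq padic padic_of_seq padic_of_seq_monoid.

Lemma padic_of_seq_eq0 (u : padic_seq) :
  (padic_of_seq u == 0) = `[< padic_null p u >].
Proof. exact: padic_pi_eq0. Qed.

Definition padic_seq_inv (u : padic_seq) : padic_seq :=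
  insubd 0 (fun n => (u n)^-1).

Definition padic_inv (x : padic) : padic :=
  if x == 0 then 0 else padic_of_seq (padic_seq_inv (padic_repr x)).

Fact padic_mulVf (x : padic) : x != 0 -> padic_inv x * x = 1.
Proof.
move=> x0; rewrite /padic_inv (negbTE x0) -{2}(padic_reprK x).
move: x0; rewrite -{1}(padic_reprK x) padic_of_seq_eq0.
set u := padic_repr x => /asboolPn nu.
apply/eqP; rewrite -rmorphM -subr_eq0 -(rmorph1 padic_of_seq) -rmorphB.
rewrite padic_of_seq_eq0; apply/asboolP => e e0.
have [d d0 [N hN]] := padic_cauchy_apart p_pr (padic_seqP u) nu.
exists N => n /hN du.
have un : u n != 0 by rewrite -(padic_abs_eq0 p_pr) lt0r_neq0 // (lt_le_trans d0).
suff -> : (padic_seq_inv u * u - 1) n = 0 by rewrite padic_abs0.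
have -> : (padic_seq_inv u * u - 1) n = (padic_seq_inv u) n * u n - 1 by [].
rewrite /padic_seq_inv [X in X n * _](insubdK 0) ?mulVf ?subrr //.
by apply/asboolP/padic_cauchyV => //; exact: padic_seqP.
Qed.

Fact padic_invr0 : padic_inv 0 = 0.
Proof. by rewrite /padic_inv eqxx. Qed.

HB.instance Definition _ :=
  GRing.ComNzRing_isField.Build padic padic_mulVf padic_invr0.

End PadicField.

Section PadicNorm.
Variables (R : realType) (p : nat) (p_pr : prime p).
Implicit Types x y : padic p_pr.

Definition padic_norm x : R :=
  limn (fun n => ratr (padic_abs p (padic_repr x n)) : R).

Definition padic_lim (u : nat -> padic p_pr) : padic p_pr :=
  xget 0 [set l | (fun n => padic_norm (u n - l)) @ \oo --> (0 : R)].

Definition padic_log x : padic p_pr :=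
  padic_lim (fun n => \sum_(k < n) (-1) ^+ k / k.+1%:R * (x - 1) ^+ k.+1).

Lemma padic_null_cvg (u : nat -> rat) :
  padic_null p u -> (fun n => ratr (padic_abs p (u n)) : R) @ \oo --> (0 : R).
Proof.
move=> nu; apply/cvgrPdist_lt => e e0.
have [q] := @rat_in_itvoo R 0 e e0; rewrite in_itv/= ltr0q => /andP[q0 qe].
have [N hN] := nu q q0; exists N => // n /= /hN h.
by rewrite sub0r normrN ger0_norm ?ler0q ?padic_abs_ge0 // (lt_trans _ qe) //
  ltr_rat.
Qed.

Lemma padic_norm_of_seq (u : padic_seq p_pr) :
  (fun n => ratr (padic_abs p (u n)) : R) @ \oo
    --> padic_norm (padic_of_seq u).
Proof.
rewrite /padic_norm; set v := padic_repr _.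
have nvu : padic_null p (v - u).
  apply/asboolP; rewrite -padic_of_seq_eq0 rmorphB /= padic_reprK.
  by rewrite subrr.
have [nu|nu] := pselect (padic_null p u).
  rewrite [X in _ --> X](_ : _ = 0); first exact: padic_null_cvg.
  apply/cvg_lim => //; apply: padic_null_cvg => e e0.
  have [N hN] := nu _ e0; have [N' hN'] := nvu _ e0.
  exists (maxn N N') => n; rewrite geq_max => /andP[/hN h /hN' h'].
  by rewrite -[v n](subrK (u n)); exact: padic_absD_lt.
have [d d0 [N hN]] := padic_cauchy_apart p_pr (padic_seqP u) nu.
have [N' hN'] := nvu _ d0.
have [N'' hN''] := padic_seqP u d0.
pose K := maxn N (maxn N' N'').
have uc n : (K <= n)%N -> padic_abs p (u n) = padic_abs p (u K).
  move=> Kn; apply: padic_abs_isosceles => //.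
  by apply: lt_le_trans (hN'' _ _ _ _) (hN _ _); rewrite /K in Kn *; lia.
have vc n : (K <= n)%N -> padic_abs p (v n) = padic_abs p (u K).
  move=> Kn; rewrite -(uc n Kn); apply: padic_abs_isosceles => //.
  by apply: lt_le_trans (hN' _ _) (hN _ _); rewrite /K in Kn *; lia.
have cst (w : nat -> rat) :
    (forall n, (K <= n)%N -> padic_abs p (w n) = padic_abs p (u K)) ->
    (fun n => ratr (padic_abs p (w n)) : R) @ \oo
      --> (ratr (padic_abs p (u K)) : R).
  move=> wc; apply: cvg_near_cst; exists K => // n /= Kn.
  by rewrite wc.
by rewrite (cvg_lim (@Rhausdorff R) (cst _ vc)); exact: cst.
Qed.

Definition padic_cst (q : rat) : padic_seq p_pr :=
  @PadicSeq p p_pr (fun=> q) (asboolT (padic_cauchy_cst p q)).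

Definition padic_of_rat (q : rat) : padic p_pr := padic_of_seq (padic_cst q).

Fact padic_of_rat_zmod : zmod_morphism padic_of_rat.
Proof. by move=> x y; rewrite -rmorphB; congr padic_of_seq; exact: val_inj. Qed.

Fact padic_of_rat_monoid : monoid_morphism padic_of_rat.
Proof.
split=> [|x y].
  rewrite -[RHS](rmorph1 (@padic_of_seq p p_pr)); congr padic_of_seq.
  exact: val_inj.
by rewrite -rmorphM; congr padic_of_seq; exact: val_inj.
Qed.

HB.instance Definition _ :=
  GRing.isZmodMorphism.Build rat (padic p_pr) padic_of_rat padic_of_rat_zmod.
HB.instance Definition _ :=
  GRing.isMonoidMorphism.Build rat (padic p_pr) padic_of_rat
    padic_of_rat_monoid.

Lemma ratr_padic (q : rat) : ratr q = padic_of_rat q.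
Proof. by rewrite -(fmorph_eq_rat padic_of_rat q). Qed.

Lemma padic_norm_ratr (q : rat) :
  padic_norm (ratr q : padic p_pr) = ratr (padic_abs p q).
Proof.
rewrite ratr_padic; have /cvg_lim <- // := @padic_norm_of_seq (padic_cst q).
by apply: cvg_lim => //; apply: cvg_near_cst; exact: nearW.
Qed.

Lemma padic_seq_cvg (u : padic_seq p_pr) :
  (fun n => padic_norm (ratr (u n) - padic_of_seq u)) @ \oo --> (0 : R).
Proof.
apply/cvgrPdist_le => e e0.
have [q] := @rat_in_itvoo R 0 e e0; rewrite in_itv/= ltr0q => /andP[q0 qe].
have [N hN] := padic_seqP u q0; exists N => // n /= Nn.
have h := @padic_norm_of_seq (padic_cst (u n) - u).
rewrite ratr_padic /padic_of_rat -rmorphB /= sub0r normrN ger0_norm.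
  apply: (cvgr_to_le h); exists N => // k /= Nk.
  by rewrite (le_trans _ (ltW qe)) // ler_rat ltW // hN.
by apply: (cvgr_to_ge h); apply: nearW => k; rewrite ler0q padic_abs_ge0.
Qed.

Let term (q : rat) k : rat := (-1) ^+ k / k.+1%:R * q ^+ k.+1.

Lemma padic_log_term_null q : padic_abs p q < 1 -> padic_null p (term q).
Proof.
move=> q1 e e0.
have p0 : (0 : rat) < p%:R by rewrite ltr0n prime_gt0.
have p2 : (2 : rat) <= p%:R by rewrite ler_nat prime_gt1.
have qh : padic_abs p q <= 2^-1.
  move: q1; rewrite /padic_abs; case: ifP => // _.
  rewrite -[X in _ < X](expr0z p%:R) ltr_eXz2l ?ltr1n ?prime_gt1 // => v.
  apply: (@le_trans _ _ (p%:R ^ (-1))); last by rewrite exprN1 lef_pV2 ?posrE.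
  by rewrite ler_eXz2l ?ltr1n ?prime_gt1 //; lia.
have absX (x : rat) k : padic_abs p (x ^+ k) = padic_abs p x ^+ k.
  elim: k => [|k IH]; first by rewrite !expr0 padic_abs1.
  by rewrite !exprS padic_absM // IH.
have hn (k : nat) : padic_abs p (k.+1%:R)^-1 <= k.+1%:R.
  have k0 : (k.+1%:R : rat) != 0 by rewrite pnatr_eq0.
  rewrite /padic_abs invr_eq0 (negbTE k0).
  have -> : (k.+1%:R : rat)^-1 = (1%:Z)%:~R / (k.+1%:Z)%:~R.
    by rewrite mul1r.
  rewrite padic_val_frac // !absz_nat logn1 sub0r opprK -exprnP -natrX ler_nat.
  by rewrite dvdn_leq // pfactor_dvdnn.
have e2 k : (4 <= k)%N -> (k * k <= 2 ^ k)%N.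
  elim: k => // k IH; rewrite leq_eqVlt => /orP[/eqP<- //|k4].
  by have := IH k4; rewrite expnS; nia.
exists (maxn 4 (Num.truncn e^-1).+1) => n.
rewrite geq_max => /andP[n4 ne].
have ne' : e^-1 < n.+1%:R.
  by apply: lt_le_trans (truncnS_gt _) _; rewrite ler_nat leqW.
rewrite /term !padic_absM // !absX padic_absN padic_abs1 expr1n mul1r.
apply: (@le_lt_trans _ _ (n.+1%:R * 2^-1 ^+ n.+1)).
  apply: ler_pM => //; rewrite ?exprn_ge0 ?padic_abs_ge0 //.
  by rewrite lerXn2r ?nnegrE ?padic_abs_ge0.
have n0 : (0 : rat) < n.+1%:R by rewrite ltr0n.
apply: (@le_lt_trans _ _ (n.+1%:R^-1)); last first.
  by rewrite -[ltRHS]invrK ltf_pV2 ?posrE ?invr_gt0.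
rewrite exprVn ler_pdivrMr ?exprn_gt0 // mulrC ler_pdivlMr //.
by rewrite -natrM -natrX ler_nat e2 // ltnW.
Qed.

Lemma padic_log_cvg q : padic_abs p q < 1 ->
  (fun n => padic_norm (\sum_(k < n) (-1) ^+ k / k.+1%:R * (ratr q) ^+ k.+1
                        - padic_log (1 + ratr q))) @ \oo --> (0 : R).
Proof.
move=> q1; pose s n := \sum_(k < n) term q k.
have cs : padic_cauchy p s.
  move=> e e0; have [N hN] := padic_log_term_null q1 e0.
  have hs d m : (N <= m)%N -> padic_abs p (s (m + d)%N - s m) < e.
    move=> Nm; elim: d => [|d IH]; first by rewrite addn0 subrr padic_abs0.
    rewrite addnS {1}/s big_ord_recr /= -/(s _) addrAC.
    by apply: padic_absD_lt => //; apply: hN; rewrite (leq_trans Nm) ?leq_addr.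
  exists N => m n Nm Nn; have [mn|/ltnW nm] := leqP m n.
    by rewrite -opprB padic_absN -(subnKC mn) hs.
  by rewrite -(subnKC nm) hs.
pose u := @PadicSeq p p_pr s (asboolT cs).
have sE n : \sum_(k < n) (-1) ^+ k / k.+1%:R * (ratr q) ^+ k.+1
            = ratr (s n) :> padic p_pr.
  rewrite !ratr_padic rmorph_sum /=; apply: eq_bigr => k _.
  by rewrite !(rmorphM, rmorphXn, fmorphV, rmorphN, rmorph1, rmorph_nat).
rewrite /padic_log [1 + _ - 1]addrAC subrr add0r /padic_lim.
case: xgetP => [l _ //|/(_ (padic_of_seq u))[]] /=.
by under eq_fun do rewrite sE; exact: (@padic_seq_cvg u).
Qed.

End PadicNorm.

Section Bounds.
Variables (R : realType) (m : nat) (M Q a H : R).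

(* 1.03883, split because decimal literals are stored in unary; 2.07766 is    *)
(* accordingly written [2 * rs_const].                                        *)
Definition rs_const : R := 1 + 3883 / 10 ^+ 5.

Definition bound_f : R :=
  2^-1 * 3 ^- m * expR (- (rs_const * m%:R)) * Q ^- m * M ^- m
  * a ^- m.+1.

Definition bound_R1 : R :=
  rs_const * m%:R + m%:R * ln Q + ln (m%:R + 1) + (m%:R - 1) * ln 2
  + (m%:R + 1) * ln M - ln (M - 1) + ln (m%:R + 2) + ln a - ln (ln bound_f).

Definition bound_c1 : R :=
  (M - 1) / (6 ^+ m * (m%:R + 1) * expR (2 * rs_const * m%:R)
             * Q ^+ (2 * m) * M ^+ (2 * m).+1)
  * expR (((m%:R + 1) * ln a / ln bound_f + 1) * (bound_R1 + 1)).

Definition bound_omega1 : R :=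
  (- ((m%:R + 1) * ln a / ln bound_f) - 1)
  * (1 + ln (ln H + bound_R1) / ln H) + 1.

(* The closed form of the quantity that the main theorem bounds below; it     *)
(* holds by definition of [bound_R1].                                         *)
Lemma bound_R1E : (1 <= m)%N -> 1 < M -> 0 < Q -> 0 < a -> 1 < bound_f ->
  - (1 / (expR bound_R1 * H)) =
  - ln bound_f / (2 ^+ m.-1 * expR (rs_const * m%:R) * Q ^+ m * H
                  * (M ^+ m.+1 / (M - 1)) * (m%:R + 1) * (m%:R + 2) * a).
Proof.
move=> m1 M1 Q0 a0 f1.
have M10 : 0 < M - 1 by rewrite subr_gt0.
have M0 : 0 < M by exact: lt_trans M1.
have lf0 : 0 < ln bound_f by rewrite ln_gt0.
have m0 : (0 : R) <= m%:R by [].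
have h1 : 0 < m%:R + 1 :> R by lra.
have h2 : 0 < m%:R + 2 :> R by lra.
have mE : m%:R - 1 = m.-1%:R :> R by rewrite -{1}(prednK m1) -addn1 natrD addrK.
have mE' : m%:R + 1 = m.+1%:R :> R by rewrite -natr1.
have eXn (x : R) k : 0 < x -> expR (k%:R * ln x) = x ^+ k.
  by move=> x0; rewrite mulrC expRM_natr lnK.
have -> : expR bound_R1 = expR (rs_const * m%:R) * Q ^+ m * (m%:R + 1)
    * 2 ^+ m.-1 * M ^+ m.+1 / (M - 1) * (m%:R + 2) * a / ln bound_f.
  rewrite /bound_R1 !expRD !expRN mE {2}mE' !eXn // !lnK //.
have [->|H0] := eqVneq H 0; first by rewrite !(mulr0, mul0r, invr0) oppr0.
have e0 : expR (rs_const * m%:R) != 0 by rewrite gt_eqF ?expR_gt0.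
have Qm0 : Q ^+ m != 0 by rewrite expf_neq0 ?gt_eqF.
have Mm0 : M ^+ m.+1 != 0 by rewrite expf_neq0 ?gt_eqF.
have tm0 : 2 ^+ m.-1 != 0 :> R by rewrite expf_neq0.
move/lt0r_neq0: M10 => M10; move/lt0r_neq0: lf0 => lf0.
move/lt0r_neq0: h1 => h1; move/lt0r_neq0: h2 => h2; move/lt0r_neq0: a0 => a0.
move: (expR _) (Q ^+ m) (M ^+ m.+1) (2 ^+ m.-1) (ln _) (M - 1)
  (m%:R + 1) (m%:R + 2) e0 Qm0 Mm0 tm0 M10 lf0 h1 h2 => {f1} //.
move=> x1 x2 x3 x4 x5 x6 x7 x8 *; field.
by do ?[apply/andP; split].
Qed.

End Bounds.

Section LinearForm.
Variables (R : realType) (m : nat).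
Implicit Types (lambda : 'I_m.+1 -> int) (alpha : 'I_m -> rat).

Definition max_abs alpha : R := \big[Num.max/0]_(i < m) `|ratr (alpha i)|.

Definition max_padic_abs p alpha : R :=
  \big[Num.max/0]_(i < m) ratr (padic_abs p (alpha i)).

Definition height lambda : R := \big[Num.max/0]_(i < m.+1) `|(lambda i)%:~R|.

(* [lambda ord0] is the constant term; [lambda (lift ord0 i)] is the          *)
(* coefficient attached to the [i]-th logarithm.                              *)
Definition padic_log_form p (p_pr : prime p) lambda alpha : padic p_pr :=
  (lambda ord0)%:~R
  + \sum_(i < m) (lambda (lift ord0 i))%:~R * padic_log R (1 + ratr (alpha i)).

End LinearForm.

(* Main.v *)
(* Let w = prod_i (X - alpha_i) and P_mu = (X^(l+mu) w^l)^(l) / l! for          *)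
(* mu = 0..m. Writing J_i for integration from 0 to alpha_i, the expansion of    *)
(* 1/(1+x) gives                                                                 *)
(*   P_mu(-1) log(1+alpha_i) + J_i((P_mu - P_mu(-1)) / (X+1))                    *)
(*     = sum_k (-1)^k J_i(P_mu X^k),                                             *)
(* where l integrations by parts kill the terms k < l and make the others        *)
(* p-adically as small as l alpha^((m+1)l+1). A degree count shows that, for     *)
(* some mu, the left-hand sides without the logarithms combine to a nonzero      *)
(* number; the factor lcm(1..m(l+1)) Q^(m(l+1)) turns it into an integer N, for  *)
(* which |N|_p >= 1/|N|. Once l makes the remainder smaller than 1/|N|, the      *)
(* bound |Lambda_p|_p >= 1/|N| follows. With T = log H + R_1, the least l with   *)
(* l log f >= T + log T + 1 works, and T >= 1 is the last hypothesis.            *)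
(*                                                                               *)
(* The constant 1.03883 is that of Rosser and Schoenfeld: psi(n) <= 1.03883 n    *)
(* for psi(n) = log lcm(1..n). Above 2^14 it follows by strong induction from    *)
(* Chebyshev's method, with a combination of log floor(n/d)! found by linear     *)
(* programming; below, it is a computation in which a sieve bounds the           *)
(* increments of psi.                                                            *)

Require Import Defs.
From HB Require Import structures.
From Stdlib Require Import ZArith NArith.
From mathcomp Require Import all_boot all_order all_algebra.
From mathcomp Require Import polyorder.
From mathcomp Require Import all_classical all_reals all_analysis.
From mathcomp Require Import zify ring lra ssrZ.

Set Implicit Arguments.
Unset Strict Implicit.
Unset Printing Implicit Defensive.

Import Order.TTheory GRing.Theory Num.Theory.
Import numFieldNormedType.Exports.

Local Open Scope classical_set_scope.
Local Open Scope ring_scope.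
Local Delimit Scope Z_scope with bigZ.

(** * Moments of polynomials *)

(** The proof plays the archimedean size of a nonzero integer against its p-adic size. For a
    polynomial [P] let [T = (P - P(-1)) / (X + 1)]. Multiplying a truncated series of log(1 + x) by
    [P(-1)] gives minus the integral of [T] from 0 to x, up to the integrals of the [P X^k] and a
    null tail ([log1p_sum_poly]). When [P] is the divided derivative of order [l] of [X^(l+mu) w^l],
    where [w] vanishes at every [alpha_i], these integrals are p-adically tiny
    ([padic_abs_pade_integral]). So [P(-1)] times the linear form is p-adically close to the
    rational number [pade_form].

    For some [mu] this number is nonzero: otherwise a combination of the [m + 1] polynomials would
    have too many vanishing moments for its degree ([pade_form_neq0]). Multiplied by [pade_denom] it
    is an integer ([pade_form_int]) of absolute value at most some [B] ([pade_form_le]), hence of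
    p-adic absolute value at least [1 / B]. If the remainder is below [1 / B], the truncated linear
    forms are eventually at least [1 / B] ([padic_log_form_sum_ge]), and so is their limit
    ([padic_log_form_ge]).

    The denominator contains lcm(1..m(l+1)), which brings in [psi(n) <= 1.03883 n] ([psi_le]). That
    bound is computed with a sieve up to 2^14 ([psi_le_small]). Beyond, a combination of the log
    floor(n/d)! whose weights [v_d] satisfy [sum v_d / d = 0] bounds [psi n] in terms of [psi] at
    smaller arguments ([psi_le_chebyshev], [psi_le_step]).

    Finally [B] grows like [base^l], and [B] times the remainder like [l f^-l]. As [f > 1], large
    orders work; [exists_pade_order] takes the least [l] beyond an explicit threshold, and
    [bound_rhsE] rewrites [c_1 H^(-omega_1)] in terms of that threshold. *)

Section Primitive.
Variable F : realFieldType.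
Implicit Types (P Q : {poly F}) (a : F).

Definition primitive P : {poly F} :=
  \poly_(i < (size P).+1) (P`_i.-1 / i%:R).

(* The coefficient of index 0 vanishes because [0^-1 = 0]. *)
Lemma coef_primitive P i : (primitive P)`_i = P`_i.-1 / i%:R.
Proof.
rewrite coef_poly; case: ltnP => // h.
by rewrite nth_default ?mul0r //; case: i h => //= i; rewrite ltnS.
Qed.

Fact primitive_is_linear : linear primitive.
Proof.
move=> c P Q; apply/polyP => i.
by rewrite !(coefD, coefZ, coef_primitive) mulrDl mulrA.
Qed.
HB.instance Definition _ :=
  GRing.isLinear.Build F {poly F} {poly F} _ primitive primitive_is_linear.

Lemma size_primitive P : (size (primitive P) <= (size P).+1)%N.
Proof. exact: size_poly. Qed.

Lemma primitiveK P : (primitive P)^`() = P.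
Proof.
apply/polyP => i; rewrite coef_deriv coef_primitive /= -[LHS]mulr_natr divfK //.
Qed.

Lemma derivK P : primitive P^`() = P - (P.[0])%:P.
Proof.
apply/polyP => -[|i]; rewrite coef_primitive coefB coefC /=.
  by rewrite invr0 mulr0 horner_coef0 subrr.
by rewrite coef_deriv subr0 -[X in X / _]mulr_natr mulfK // pnatr_eq0.
Qed.

Definition poly_integral a P := (primitive P).[a].

Fact poly_integral_is_linear a : linear_for *%R (poly_integral a).
Proof. by move=> c P Q; rewrite /poly_integral linearP hornerD hornerZ. Qed.
HB.instance Definition _ a :=
  GRing.isLinear.Build F {poly F} F _ (poly_integral a) (poly_integral_is_linear a).

Lemma poly_integral_0 P : poly_integral 0 P = 0.
Proof. by rewrite /poly_integral horner_coef0 coef_primitive invr0 mulr0. Qed.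

Lemma poly_integral_deriv a P : poly_integral a P^`() = P.[a] - P.[0].
Proof. by rewrite /poly_integral derivK !hornerE. Qed.

Lemma poly_integralE a P n : (size P <= n)%N ->
  poly_integral a P = \sum_(i < n) P`_i * a ^+ i.+1 / i.+1%:R.
Proof.
move=> Pn; rewrite /poly_integral.
rewrite (@horner_coef_wide _ n.+1) ?(leq_trans (size_primitive P)) //.
rewrite big_ord_recl coef_primitive invr0 mulr0 mul0r add0r.
by apply: eq_bigr => i _; rewrite coef_primitive /= mulrAC.
Qed.

Lemma poly_integral_Xn a n : poly_integral a 'X^n = a ^+ n.+1 / n.+1%:R.
Proof.
rewrite (@poly_integralE _ _ n.+1) ?size_polyXn // big_ord_recr /= big1 ?add0r.
  by rewrite coefXn eqxx mul1r.
by move=> i _; rewrite coefXn ltn_eqF ?mul0r.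
Qed.

Lemma poly_integral_parts a P Q :
  poly_integral a (P^`() * Q) = (P * Q).[a] - (P * Q).[0] - poly_integral a (P * Q^`()).
Proof. by rewrite -poly_integral_deriv derivM linearD addrK. Qed.

Lemma dvdp_exp_deriv a n P : ('X - a%:P) ^+ n.+1 %| P ->
  ('X - a%:P) ^+ n %| P^`().
Proof.
move=> /dvdpP[Q ->]; rewrite derivM deriv_exp derivXsubC mul1r /=.
apply: dvdp_add; apply: dvdp_mull; first by rewrite exprS dvdp_mull.
by rewrite -mulr_natr dvdp_mulr.
Qed.

(** In characteristic 0, differentiation lowers the multiplicity of a root by exactly one. *)
Lemma dvdp_exp_of_deriv a n P : root P a -> ('X - a%:P) ^+ n %| P^`() ->
  ('X - a%:P) ^+ n.+1 %| P.
Proof.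
have [->|P0] := eqVneq P 0; first by rewrite dvdp0.
move=> Pa; have mu0 : (0 < \mu_a P)%N by rewrite mu_gt0.
have [P'0|P'0] := eqVneq P^`() 0.
  have /esym/eqP := derivK P; rewrite P'0 linear0 subr_eq0 => /eqP PC.
  by move: Pa P0; rewrite PC rootC => /eqP->; rewrite eqxx.
by rewrite !root_le_mu // mu_deriv // leq_subRL // add1n.
Qed.

Lemma poly_integral_derivn a l P Q : 'X^l %| P -> ('X - a%:P) ^+ l %| P ->
  poly_integral a (P^`(l) * Q) = (-1) ^+ l * poly_integral a (P * Q^`(l)).
Proof.
elim: l P => [|l IH] P; first by rewrite !derivn0 mul1r.
move=> P0 Pa; rewrite derivSn IH; last exact: dvdp_exp_deriv; last first.
  by rewrite -['X]subr0; apply: dvdp_exp_deriv; rewrite subr0.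
rewrite poly_integral_parts !hornerM -derivnS.
have /eqP -> : P.[a] == 0.
  by rewrite -/(root _ _) root_factor_theorem (dvdp_trans _ Pa) // exprS dvdp_mulr.
have /eqP -> : P.[0] == 0.
  rewrite -/(root _ _) root_factor_theorem (dvdp_trans _ P0) //.
  by rewrite subr0 exprS dvdp_mulr.
by rewrite !mul0r subrr sub0r mulrN exprS mulN1r mulNr.
Qed.

(** Integration by parts, [l] times; the boundary terms vanish since [P] has zeros of order [l] at
    both ends. For [k < l] the binomial is 0, so the truncated [k - l] does no harm. *)
Lemma poly_integral_nderivn a l P k : 'X^l %| P -> ('X - a%:P) ^+ l %| P ->
  poly_integral a (P^`N(l) * 'X^k) =
  (-1) ^+ l * 'C(k, l)%:R * poly_integral a (P * 'X^(k - l)).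
Proof.
move=> P0 Pa; apply: (@mulIf _ l`!%:R); first by rewrite pnatr_eq0 -lt0n fact_gt0.
have -> : poly_integral a (P^`N(l) * 'X^k) * l`!%:R = poly_integral a (P^`(l) * 'X^k).
  by rewrite nderivn_def mulrnAl raddfMn /= mulr_natr.
rewrite poly_integral_derivn // derivnXn mulrnAr raddfMn /= -[X in _ * X]mulr_natr -bin_ffact.
by rewrite natrM; ring.
Qed.

(** Moment 0 says that the first primitive vanishes at [a]; integration by parts turns the moments
    of that primitive into higher moments of [P]. Each vanishing moment thus raises the multiplicity
    of [a] by one. *)
Lemma iter_primitive_dvdp a n P :
  (forall k, (k < n)%N -> poly_integral a (P * 'X^k) = 0) ->
  ('X - a%:P) ^+ n %| iter n primitive P.
Proof.
elim: n P => [|n IH] P h; first by rewrite dvd1p.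
apply: dvdp_exp_of_deriv; last first.
  by rewrite iterS primitiveK IH // => k kn; rewrite h // ltnS ltnW.
have h0 : (primitive P).[a] = 0 by have := h 0%N isT; rewrite mulr1.
case: n IH h => [|n] IH h; first by rewrite /= rootE h0.
rewrite iterSr root_factor_theorem.
apply: dvdp_trans (IH (primitive P) _); first by rewrite exprS dvdp_mulr.
move=> k kn; have := h k.+1 kn.
rewrite -{1}(primitiveK P) poly_integral_parts !hornerM h0 !hornerXn expr0n /=.
rewrite mul0r mulr0 subrr sub0r derivXn /= => /eqP.
rewrite oppr_eq0 mulrnAr raddfMn mulrn_eq0 /= => /eqP //.
Qed.

Lemma prod_XsubC_exp_dvdp (s : seq F) n P : uniq s ->
  (forall a, a \in s -> ('X - a%:P) ^+ n %| P) ->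
  \prod_(a <- s) ('X - a%:P) ^+ n %| P.
Proof.
elim: s => [|a s IH] /=; first by rewrite big_nil dvd1p.
move=> /andP[as_ us] h; rewrite big_cons Gauss_dvdp; last first.
  rewrite big_seq; elim/big_ind: _ => [|x y|b bs].
  - exact: coprimep1.
  - by rewrite coprimepMr => -> ->.
  - rewrite coprimep_expl // coprimep_expr // coprimep_XsubC root_XsubC.
    by apply: contraNneq as_ => <-.
by rewrite h ?mem_head // IH // => b bs; rewrite h // in_cons bs orbT.
Qed.

Lemma iter_primitive_eq0 n P : iter n primitive P = 0 -> P = 0.
Proof.
elim: n => //= n IH h; apply: IH.
by rewrite -[LHS]primitiveK h deriv0.
Qed.

(** The [(l+1)]-fold primitive vanishes to order [l + 1] at 0 and at every point of [s], which is
    more zeros than its degree allows. *)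
Lemma poly_integral_determined (s : seq F) l P : uniq s -> 0 \notin s ->
  (forall a k, a \in s -> (k <= l)%N -> poly_integral a (P * 'X^k) = 0) ->
  (size P <= size s * l.+1)%N -> P = 0.
Proof.
move=> us s0 h sP; apply: (@iter_primitive_eq0 l.+1); apply/eqP.
set H := iter _ _ _.
have hd : \prod_(a <- 0 :: s) ('X - a%:P) ^+ l.+1 %| H.
  apply: prod_XsubC_exp_dvdp => [|a]; first by rewrite /= s0.
  rewrite in_cons => /predU1P[->|ain]; apply: iter_primitive_dvdp => k kl.
    exact: poly_integral_0.
  exact: h.
have szH : (size H <= size P + l.+1)%N.
  rewrite /H; elim: (l.+1) => [|n IH]; first by rewrite addn0.
  by rewrite iterS (leq_trans (size_primitive _)) // addnS ltnS.
apply: contraLR hd => H0; apply/negP => /(dvdp_leq H0).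
rewrite leqNgt => /negP; apply; rewrite prodrXl.
set w := \prod_(a <- _) _.
have w_monic : w \is monic by exact: monic_prod_XsubC.
have := size_exp w l.+1; rewrite size_prod_XsubC /= => sw.
have : (0 < size (w ^+ l.+1))%N by rewrite size_poly_gt0 expf_neq0 ?monic_neq0.
move: sw szH sP; rewrite mulSn; case: (size (w ^+ _)) => // k /= -> hH hP _.
by rewrite ltnS (leq_trans hH) // addnC leq_add2l.
Qed.
End Primitive.

(** * The Pade approximations *)

Section Pade.
Variable F : realFieldType.
Implicit Types (P G : {poly F}) (a : F).

Definition quotient_at_m1 P : {poly F} := (P - (P.[-1])%:P) %/ ('X + 1).

Local Lemma XD1E : 'X + 1 = 'X - (-1)%:P :> {poly F}.
Proof. by rewrite polyCN opprK. Qed.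

Lemma quotient_at_m1K P : quotient_at_m1 P * ('X + 1) = P - (P.[-1])%:P.
Proof.
rewrite /quotient_at_m1 XD1E divpK //.
by rewrite -root_factor_theorem rootE !hornerE subrr.
Qed.

Fact quotient_at_m1_is_linear : linear quotient_at_m1.
Proof.
move=> c P G; have X1 : 'X + 1 != 0 :> {poly F}.
  by rewrite XD1E monic_neq0 ?monicXsubC.
apply: (mulIf X1); rewrite mulrDl -scalerAl !quotient_at_m1K !hornerE.
by rewrite -!mul_polyC rmorphD rmorphM /=; ring.
Qed.
HB.instance Definition _ :=
  GRing.isLinear.Build F {poly F} {poly F} _ quotient_at_m1
    quotient_at_m1_is_linear.

Lemma quotient_at_m1_Xn n :
  quotient_at_m1 'X^n = \sum_(i < n) (-1) ^+ i *: 'X^(n.-1 - i).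
Proof.
have X1 : 'X + 1 != 0 :> {poly F} by rewrite XD1E monic_neq0 ?monicXsubC.
apply: (mulIf X1); rewrite quotient_at_m1K hornerXn rmorphXn /= subrXX XD1E.
rewrite mulrC; congr (_ * _); apply: eq_bigr => i _.
by rewrite -rmorphXn /= mulrC mul_polyC.
Qed.

Lemma size_quotient_at_m1 P : (size (quotient_at_m1 P) <= (size P).-1)%N.
Proof.
have [->|P0] := eqVneq P 0; first by rewrite linear0 size_poly0.
rewrite /quotient_at_m1 XD1E size_divp ?polyXsubC_eq0 // size_XsubC subn1.
rewrite -!subn1 leq_sub2r // (leq_trans (size_polyD _ _)) // geq_max leqnn.
by rewrite size_polyN (leq_trans (size_polyC_leq1 _)) // size_poly_gt0.
Qed.

(** A Rodrigues formula. On coefficients it multiplies by binomials, so it is injective, does not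
    raise the degree and creates no denominators. *)
Definition legendre l G : {poly F} := ('X^l * G)^`N(l).

Lemma coef_legendre l G i : (legendre l G)`_i = G`_i *+ 'C(l + i, l).
Proof. by rewrite coef_nderivn coefXnM ltnNge leq_addr /= addKn. Qed.

Lemma size_legendre l G : (size (legendre l G) <= size G)%N.
Proof.
apply/leq_sizeP => i Gi; rewrite coef_legendre nth_default ?mul0rn //.
Qed.

Fact legendre_is_linear l : linear (legendre l).
Proof. by move=> c P G; rewrite /legendre mulrDr -scalerAr linearP. Qed.
HB.instance Definition _ l :=
  GRing.isLinear.Build F {poly F} {poly F} _ (legendre l) (legendre_is_linear l).

Lemma legendre_eq0 l G : (legendre l G == 0) = (G == 0).
Proof.
apply/eqP/eqP => [h|->]; last by rewrite linear0.
apply/polyP => i; have := coef_legendre l G i.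
rewrite h coef0 => /esym/eqP; rewrite mulrn_eq0 => /orP[|/eqP->//].
by rewrite -leqn0 leqNgt bin_gt0 leq_addr.
Qed.

Lemma poly_integral_legendre a l k G : ('X - a%:P) ^+ l %| G ->
  poly_integral a (legendre l G * 'X^k) =
  (-1) ^+ l * 'C(k, l)%:R * poly_integral a (G * 'X^k).
Proof.
move=> Ga; rewrite poly_integral_nderivn; [|exact: dvdp_mulIl|exact: dvdp_mull].
have [kl|kl] := ltnP k l; first by rewrite bin_small // !mulr0 !mul0r.
by rewrite (_ : 'X^l * G * _ = G * 'X^k) // mulrAC -exprD subnKC // mulrC.
Qed.

Variables (m : nat) (alpha : 'I_m -> F).
Hypothesis alpha_inj : injective alpha.
Hypothesis alpha_neq0 : forall i, alpha i != 0.

Definition node_poly : {poly F} := \prod_(i < m) ('X - (alpha i)%:P).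

Lemma node_poly_monic : node_poly \is monic.
Proof. exact: monic_prod_XsubC. Qed.

Lemma size_node_poly_exp l : size (node_poly ^+ l) = (m * l).+1.
Proof.
have := size_exp node_poly l.
rewrite size_prod_XsubC /= /index_enum -enumT size_enum_ord => <-.
by rewrite prednK // size_poly_gt0 expf_neq0 ?monic_neq0 ?node_poly_monic.
Qed.

Lemma dvdp_node_poly l i G : ('X - (alpha i)%:P) ^+ l %| G * node_poly ^+ l.
Proof.
by rewrite dvdp_mull // dvdp_exp2r // /node_poly (bigD1 i) //= dvdp_mulr.
Qed.

Definition pade l mu : {poly F} := legendre l ('X^mu * node_poly ^+ l).

(** What [P(-1)] times the linear form becomes when each [P(-1) log(1 + alpha_i)] is replaced by
    minus the integral of the quotient. *)
Definition pade_form (lambda : 'I_m.+1 -> F) P : F :=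
  lambda ord0 * P.[-1]
  - \sum_(i < m) lambda (lift ord0 i) * poly_integral (alpha i) (quotient_at_m1 P).

(** The matrix of the values at -1 and the negated integrals is invertible: a relation between its
    rows yields [P] divisible by [X + 1] whose quotient has vanishing moments 0..l at all [alpha_i]
    and degree below [m (l + 1)], so [poly_integral_determined] makes it 0. Such a matrix cannot
    send [lambda] to 0. *)
Lemma pade_form_neq0 lambda l : (exists i, lambda i != 0) ->
  exists mu : 'I_m.+1, pade_form lambda (pade l mu) != 0.
Proof.
move=> [i0 li0].
pose A : 'M[F]_m.+1 := \matrix_(mu, j)
  (if unlift ord0 j is Some i
   then - poly_integral (alpha i) (quotient_at_m1 (pade l mu))
   else (pade l mu).[-1]).
pose L : 'cV[F]_m.+1 := \col_j lambda j.
have AL (mu : 'I_m.+1) : pade_form lambda (pade l mu) = (A *m L) mu 0.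
  rewrite !mxE big_ord_recl !mxE unlift_none mulrC /pade_form; congr (_ + _).
  rewrite -sumrN; apply: eq_bigr => i _.
  by rewrite !mxE liftK mulrC mulNr.
have Aunit : A \in unitmx.
  rewrite -row_free_unit; apply: inj_row_free => v vA.
  pose q := \sum_(mu < m.+1) v 0 mu *: 'X^mu : {poly F}.
  pose P := legendre l (q * node_poly ^+ l).
  have PE : P = \sum_(mu < m.+1) v 0 mu *: pade l mu.
    rewrite /P /q mulr_suml linear_sum; apply: eq_bigr => mu _.
    by rewrite -scalerAl linearZ.
  have P1 : P.[-1] = 0.
    have /rowP/(_ 0) := vA; rewrite !mxE => <-.
    rewrite PE horner_sum; apply: eq_bigr => mu _.
    by rewrite !mxE unlift_none hornerZ.
  have PJ i : poly_integral (alpha i) (quotient_at_m1 P) = 0.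
    have /rowP/(_ (lift ord0 i)) := vA; rewrite !mxE => /eqP.
    under eq_bigr do rewrite !mxE liftK mulrN.
    rewrite sumrN oppr_eq0 => /eqP <-; rewrite PE !linear_sum /=.
    by apply: eq_bigr => mu _; rewrite !linearZ.
  have P0 : P = 0.
    have := quotient_at_m1K P; rewrite P1 subr0 => <-.
    set S := quotient_at_m1 P in PJ *.
    suff -> : S = 0 by rewrite mul0r.
    apply: (@poly_integral_determined _ (codom alpha) l) => //.
    - by apply/injectiveP.
    - by apply/negP => /codomP[i /esym/eqP]; rewrite (negbTE (alpha_neq0 i)).
    - move=> _ k /codomP[i ->]; elim: k => [|k IH] kl; first by rewrite mulr1.
      (* Since [P = S (X + 1)] and the moments of [P] below [l] vanish, the vanishing of a moment of
         [S] propagates from [k] to [k + 1]. *)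
      have -> : S * 'X^(k.+1) = P * 'X^k - S * 'X^k.
        have := quotient_at_m1K P; rewrite P1 subr0 -/S => <-.
        by rewrite exprS; ring.
      rewrite linearB /= IH ?(ltnW kl) // poly_integral_legendre ?dvdp_node_poly //.
      by rewrite bin_small // mulr0 mul0r subr0.
    - rewrite size_codom card_ord (leq_trans (size_quotient_at_m1 _)) //.
      have := size_legendre l (q * node_poly ^+ l); rewrite -/P.
      have := size_polyMleq q (node_poly ^+ l).
      rewrite size_node_poly_exp.
      have : (size q <= m.+1)%N.
        rewrite (leq_trans (size_sum _ _ _)) //; apply/bigmax_leqP => i _.
        by rewrite (leq_trans (size_scale_leq _ _)) // size_polyXn.
      rewrite mulnS; move: (m * l)%N (size P) (size q) (size (q * node_poly ^+ l)); lia.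
  have q0 : q = 0.
    move/eqP: P0; rewrite legendre_eq0 mulf_eq0 expf_eq0.
    by rewrite (negbTE (monic_neq0 node_poly_monic)) andbF orbF => /eqP.
  apply/rowP => i; rewrite mxE; have := congr1 (fun r : {poly F} => r`_i) q0.
  rewrite /= coef0 coef_sum (bigD1 i) //= coefZ coefXn eqxx mulr1 big1 ?addr0 //.
  move=> j ji; rewrite coefZ coefXn; case: eqVneq => [/val_inj e|_].
    by rewrite e eqxx in ji.
  by rewrite mulr0.
apply/existsP; apply: contraT; rewrite negb_exists => /forallP h.
have AL0 : A *m L = 0.
  apply/colP => mu; rewrite -AL mxE; apply/eqP; exact/negPn/h.
have /colP/(_ i0) : L = 0 by rewrite -(mulKmx Aunit L) AL0 mulmx0.
by rewrite !mxE => /eqP; rewrite (negbTE li0).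
Qed.
End Pade.

(** * Bounds on the logarithm *)

Section LnBounds.
Variable R : realType.

Let artanh2 (z : R) : R := ln (1 + z) - ln (1 - z).

Let is_derive_artanh2 (z : R) : -1 < z < 1 ->
  is_derive z 1 artanh2 ((1 + z)^-1 + (1 - z)^-1).
Proof.
move=> /andP[z0 z1].
have d1 : is_derive z 1 (cst 1 + id : R -> R) 1.
  by apply: is_derive_eq; rewrite add0r.
have d2 : is_derive z 1 (cst 1 - id : R -> R) (-1).
  by apply: is_derive_eq; rewrite sub0r.
have l1 : is_derive (1 + z) 1 (@ln R) (1 + z)^-1 by apply: is_derive1_ln; lra.
have l2 : is_derive (1 - z) 1 (@ln R) (1 - z)^-1 by apply: is_derive1_ln; lra.
have e1 := @is_derive1_comp R (@ln R) (cst 1 + id) z _ _ l1 d1.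
have e2 := @is_derive1_comp R (@ln R) (cst 1 - id) z _ _ l2 d2.
apply: is_derive_eq (is_deriveB e1 e2) _.
by rewrite /= mulrN1 opprK mulr1.
Qed.

Let homo0 (f df : R -> R) (b z : R) :
  (forall x, - b < x < b -> is_derive x 1 f (df x)) ->
  (forall x, - b < x < b -> 0 <= df x) -> 0 <= z < b -> f 0 <= f z.
Proof.
move=> fd df0 /andP[z0 zb].
apply: (@ger0_derive1_le_oo R f (-b) b); rewrite ?in_itv /=.
- by move=> x; rewrite in_itv /= => /fd [].
- move=> x; rewrite in_itv /= => xb.
  by rewrite derive1E; have [_ ->] := fd _ xb; exact: df0.
- move=> x; rewrite inE /= in_itv /= => /fd [d _].
  exact/differentiable_continuous/derivable1_diffP.
- by lra.
- by lra.
- exact: z0.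
Qed.

Lemma ln_artanh_ge (z : R) : 0 <= z < 1 ->
  2 * z + 2 / 3 * z ^+ 3 <= ln (1 + z) - ln (1 - z).
Proof.
move=> z01; rewrite -subr_ge0.
pose f : R -> R := artanh2 - (2 *: (id : R -> R) + (2 / 3) *: (id : R -> R) ^+ 3).
have fE x : f x = artanh2 x - (2 * x + 2 / 3 * x ^+ 3) by [].
rewrite -fE.
have -> : 0 = f 0 by rewrite fE /artanh2 addr0 subr0 subrr; ring.
apply: (homo0 (df := fun x => 2 * x ^+ 4 / ((1 + x) * (1 - x)))) z01.
  move=> x x1; have dx := is_derive_artanh2 x1.
  have d1 := is_derive_id x (1 : R).
  apply: is_derive_eq
    (is_deriveB dx (is_deriveD (is_deriveZ 2 d1) (is_deriveZ (2 / 3) (is_deriveX 3 d1)))) _.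
  by rewrite /GRing.scale /=; field; lra.
move=> x x1; rewrite divr_ge0 //; first by rewrite mulr_ge0 // exprn_even_ge0.
by rewrite mulr_ge0 //; lra.
Qed.

(** The coefficient 8/15 exceeds the Taylor coefficient 2/5 by enough to absorb the higher terms:
    the difference has a nonnegative derivative as long as [x^2 <= 1/4]. *)
Lemma ln_artanh_le (z : R) : 0 <= z < 1 / 2 ->
  ln (1 + z) - ln (1 - z) <= 2 * z + 2 / 3 * z ^+ 3 + 8 / 15 * z ^+ 5.
Proof.
move=> z01; rewrite -subr_ge0.
pose f : R -> R := 2 *: (id : R -> R) + (2 / 3) *: (id : R -> R) ^+ 3
  + (8 / 15) *: (id : R -> R) ^+ 5 - artanh2.
have fE x : f x = 2 * x + 2 / 3 * x ^+ 3 + 8 / 15 * x ^+ 5 - artanh2 x by [].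
rewrite -fE.
have -> : 0 = f 0 by rewrite fE /artanh2 addr0 subr0 subrr; ring.
apply: (homo0 (df := fun x => x ^+ 4 * (2 / 3 - 8 / 3 * x ^+ 2)
                               / ((1 + x) * (1 - x)))) z01.
  move=> x x1; have dx : is_derive x 1 artanh2 ((1 + x)^-1 + (1 - x)^-1).
    by apply: is_derive_artanh2; lra.
  have d1 := is_derive_id x (1 : R).
  apply: is_derive_eq
    (is_deriveB (is_deriveD (is_deriveD (is_deriveZ 2 d1)
       (is_deriveZ (2 / 3) (is_deriveX 3 d1))) (is_deriveZ (8 / 15) (is_deriveX 5 d1))) dx) _.
  by rewrite /GRing.scale /=; field; lra.
move=> x x1; rewrite divr_ge0 //; last by rewrite mulr_ge0 //; lra.
by rewrite mulr_ge0 ?exprn_even_ge0 //; nra.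
Qed.

End LnBounds.

(** * Least common multiples and the function psi *)

Fixpoint lcm_upto (n : nat) : nat :=
  if n is n'.+1 then lcmn (lcm_upto n') n else 1%N.

Section LcmUpto.
Local Open Scope nat_scope.

Lemma lcm_upto_gt0 n : 0 < lcm_upto n.
Proof. by elim: n => //= n IH; rewrite lcmn_gt0 IH. Qed.

Lemma dvdn_lcm_upto k n : 0 < k <= n -> k %| lcm_upto n.
Proof.
elim: n => [|n IH] /andP[k0 kn]; first by lia.
move: kn; rewrite leq_eqVlt => /predU1P[->|kn]; first exact: dvdn_lcmr.
by rewrite (dvdn_trans (IH _)) ?k0 //= dvdn_lcml.
Qed.

Lemma dvdn_lcm_uptoS n : lcm_upto n %| lcm_upto n.+1.
Proof. exact: dvdn_lcml. Qed.

Lemma lcm_upto_le n k : n <= k -> lcm_upto n <= lcm_upto k.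
Proof.
elim: k => [|k IH]; first by rewrite leqn0 => /eqP->.
rewrite leq_eqVlt => /predU1P[->//|/IH h]; apply: leq_trans h _.
by rewrite dvdn_leq ?lcm_upto_gt0 ?dvdn_lcm_uptoS.
Qed.

Lemma lcm_uptoS_coprime n a b : n.+1 = a * b -> 1 < a -> 1 < b -> coprime a b ->
  lcm_upto n.+1 = lcm_upto n.
Proof.
move=> nE a1 b1 ab; apply/eqP; rewrite eqn_dvd dvdn_lcm_uptoS andbT /=.
rewrite dvdn_lcm dvdnn /= nE Gauss_dvd //.
by rewrite !dvdn_lcm_upto //; nia.
Qed.

Lemma lcm_uptoS_pfactor n p k : 1 < p -> n.+1 = p ^ k.+1 ->
  lcm_upto n.+1 %| p * lcm_upto n.
Proof.
move=> p1 nE; rewrite dvdn_lcm dvdn_mull //= nE expnS.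
rewrite dvdn_mul // dvdn_lcm_upto // expn_gt0 (ltnW p1) /=.
have := ltn_Pmull p1 (_ : 0 < p ^ k); rewrite expn_gt0 (ltnW p1) -expnS -nE.
by move=> /(_ isT); lia.
Qed.

Lemma logn_lcm_upto p n : prime p -> logn p (lcm_upto n) = trunc_log p n.
Proof.
move=> p_pr; have p1 := prime_gt1 p_pr.
elim: n => [|n IH]; first by rewrite logn1 trunc_log0.
rewrite /= logn_lcm ?lcm_upto_gt0 // IH.
have nS : p ^ logn p n.+1 <= n.+1 by rewrite dvdn_leq ?pfactor_dvdnn.
have lnS : logn p n.+1 <= trunc_log p n.+1 by apply: trunc_log_max.
apply/eqP; rewrite eqn_leq geq_max leq_trunc_log // lnS /=.
rewrite leq_max; have := trunc_logP p1 (ltn0Sn n).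
rewrite leq_eqVlt => /predU1P[e|h].
  by rewrite -{3}e pfactorK // leqnn orbT.
by rewrite trunc_log_max.
Qed.

(** For each prime [p], both exponents count the pairs of positive integers [(j, k)] with
    [k p^j <= n]; on the left this is Legendre's formula. *)
Lemma fact_lcm_upto n : n`! = \prod_(1 <= k < n.+1) lcm_upto (n %/ k).
Proof.
have prod0 : 0 < \prod_(1 <= k < n.+1) lcm_upto (n %/ k).
  by apply: prodn_gt0 => i; exact: lcm_upto_gt0.
apply: eqn_from_log; rewrite ?fact_gt0 // => p.
have [p_pr|/negbTE pN] := boolP (prime p); last by rewrite /logn pN.
have p1 := prime_gt1 p_pr.
have logE (r : seq nat) : logn p (\prod_(k <- r) lcm_upto (n %/ k)) =
    \sum_(k <- r) trunc_log p (n %/ k).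
  elim: r => [|k r IH]; first by rewrite !big_nil logn1.
  rewrite !big_cons lognM ?lcm_upto_gt0 //; last first.
    by apply: prodn_gt0 => i; exact: lcm_upto_gt0.
  by rewrite IH logn_lcm_upto.
have divE (j : nat) : 0 < j -> n %/ j = \sum_(1 <= k < n.+1) (k * j <= n).
  move=> j0; rewrite (@big_cat_nat _ _ _ (n %/ j).+1) //=; last first.
    by rewrite ltnS leq_div.
  rewrite [X in _ = X + _](eq_big_nat _ _ (F2 := fun=> 1)); last first.
    by move=> k /andP[_]; rewrite ltnS leq_divRL // => ->.
  rewrite sum_nat_const_nat subn1 muln1 [X in _ = _ + X]big1_seq ?addn0 //.
  move=> k /andP[_]; rewrite mem_index_iota => /andP[+ _].
  by rewrite ltnNge leq_divRL // => /negbTE->.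
have truncE (x : nat) : x <= n -> trunc_log p x = \sum_(1 <= j < n.+1) (p ^ j <= x).
  move=> xn; have [->|x0] := posnP x.
    rewrite trunc_log0 big1_seq // => j _.
    by rewrite leqn0 expn_eq0; case: p p1 {p_pr logE}.
  have tx := trunc_logP p1 x0.
  have tn : trunc_log p x <= n.
    by rewrite (leq_trans _ xn) // (leq_trans _ tx) // ltnW // ltn_expl.
  rewrite (@big_cat_nat _ _ _ (trunc_log p x).+1) //=.
  rewrite [X in _ = X + _](eq_big_nat _ _ (F2 := fun=> 1)); last first.
    move=> k /andP[_]; rewrite ltnS => kt.
    by rewrite (leq_trans _ tx) // leq_exp2l.
  rewrite sum_nat_const_nat subn1 muln1 [X in _ = _ + X]big1_seq ?addn0 //.
  move=> k /andP[_]; rewrite mem_index_iota => /andP[kt _].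
  apply/eqP; rewrite eqb0; apply: contraTN kt => /(trunc_log_max p1).
  by rewrite -leqNgt.
rewrite logn_fact // logE.
under eq_big_nat => j /andP[j0 _] do rewrite divE ?expn_gt0 ?prime_gt0 //.
rewrite exchange_big /=; apply: eq_big_nat => k /andP[k0 _].
rewrite truncE ?leq_div //; apply: eq_bigr => j _.
by rewrite leq_divRL // mulnC.
Qed.
End LcmUpto.

(** * Chebyshev's function psi, factorials and Stirling bounds *)

Section Psi.
Variable R : realType.

Definition psi (n : nat) : R := ln (lcm_upto n)%:R.

Lemma psi0 : psi 0 = 0.
Proof. by rewrite /psi ln1. Qed.

Lemma le_psi n k : (n <= k)%N -> psi n <= psi k.
Proof.
move=> nk; rewrite ler_ln ?posrE ?ltr0n ?lcm_upto_gt0 // ler_nat.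
exact: lcm_upto_le.
Qed.

Lemma psi_ge0 n : 0 <= psi n.
Proof. by rewrite -psi0 le_psi. Qed.

Lemma ln_fact n : ln n`!%:R = \sum_(1 <= k < n.+1) psi (n %/ k).
Proof.
rewrite fact_lcm_upto natr_prod; elim: (index_iota _ _) => [|k r IH].
  by rewrite !big_nil ln1.
rewrite !big_cons lnM ?posrE ?ltr0n ?lcm_upto_gt0 ?IH //.
by apply: prodr_gt0 => i _; rewrite ltr0n lcm_upto_gt0.
Qed.

Lemma sum_multiples d (G : nat -> R) n : (0 < d)%N ->
  \sum_(1 <= k < (n %/ d).+1) G (d * k)%N =
  \sum_(1 <= j < n.+1) (d %| j)%N%:R * G j.
Proof.
move=> d0; elim: n => [|n IH]; first by rewrite div0n !big_geq.
rewrite [RHS]big_nat_recr //= -IH divnS //.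
case: (boolP (d %| n.+1)%N) => [dn|_]; last by rewrite mul0r addr0.
rewrite add1n big_nat_recr //=; congr (_ + _); rewrite mul1r.
have -> : (n %/ d).+1 = (n.+1 %/ d)%N by rewrite divnS // dn.
by rewrite mulnC divnK.
Qed.

(** Abel summation. Monotonicity starts at index 1 because [g j] will be [psi (n %/ j)], whose value
    at 0 comes from the default [n %/ 0 = 0]. *)
Lemma abel_ge0 (b g : nat -> R) n :
  (forall j, (j <= n)%N -> 0 <= \sum_(1 <= i < j.+1) b i) ->
  (forall j, 0 <= g j) -> (forall j, (0 < j)%N -> g j.+1 <= g j) ->
  0 <= \sum_(1 <= j < n.+1) b j * g j.
Proof.
move=> hb g0 gd.
suff h k : (k <= n)%N -> (\sum_(1 <= j < k.+1) b j) * g k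
    <= \sum_(1 <= j < k.+1) b j * g j.
  by apply: le_trans (h n (leqnn n)); rewrite mulr_ge0 // hb.
have step (h : nat -> R) i :
  \sum_(1 <= j < i.+2) h j = \sum_(1 <= j < i.+1) h j + h i.+1.
  by rewrite big_nat_recr.
elim: k => [|k IH] kn; first by rewrite !big_geq // mul0r.
rewrite !step mulrDl lerD2r; apply: le_trans (IH (ltnW kn)).
case: k {IH} kn => [|k] kn; first by rewrite !big_geq // !mul0r.
by rewrite ler_wpM2l ?gd // hb // ltnW.
Qed.

Variables (s t : seq (nat * R)).

Definition floor_sum (y : nat) : R := \sum_(u <- s) u.2 * (y %/ u.1)%:R.
Definition step_sum (y : nat) : R := \sum_(u <- t) u.2 * (u.1 <= y)%:R.

(* [b = s * 1 + t - delta_1] (Dirichlet convolution) has nonnegative partial sums, and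
   [psi (n / j)] decreases with [j]. *)
Lemma psi_le_chebyshev n : (0 < n)%N ->
  (forall u, u \in s -> (0 < u.1)%N) -> (forall u, u \in t -> (0 < u.1)%N) ->
  (forall y, (0 < y)%N -> 1 <= floor_sum y + step_sum y) ->
  psi n <= \sum_(u <- s) u.2 * ln (n %/ u.1)`!%:R
           + \sum_(u <- t) u.2 * psi (n %/ u.1).
Proof.
move=> n0 s0 t0 hE.
pose b j : R := \sum_(u <- s) u.2 * (u.1 %| j)%N%:R
  + \sum_(u <- t) u.2 * (u.1 == j)%:R - (j == 1%N)%:R.
have sum_eq k y (G : nat -> R) : (0 < k)%N ->
    \sum_(1 <= j < y.+1) (k == j)%:R * G j = (k <= y)%:R * G k.
  move=> k0; elim: y => [|y IH].
    by rewrite big_geq // leqNgt k0 mul0r.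
  rewrite big_nat_recr //= IH (leq_eqVlt k y.+1) ltnS.
  by have [->|_] := eqVneq k y.+1; rewrite /= ?ltnn ?mul0r ?addr0 ?add0r.
have sumb y (G : nat -> R) : \sum_(1 <= j < y.+1) b j * G j =
    \sum_(u <- s) u.2 * \sum_(1 <= k < (y %/ u.1).+1) G (u.1 * k)%N
    + \sum_(u <- t) u.2 * ((u.1 <= y)%:R * G u.1) - (1 <= y)%:R * G 1%N.
  rewrite -(sum_eq 1%N) //.
  under eq_bigr do rewrite mulrBl mulrDl !mulr_suml.
  rewrite sumrB big_split /=; congr (_ + _ - _); last first.
  - by apply: eq_bigr => j _; rewrite eq_sym.
  - rewrite exchange_big; apply: eq_big_seq => u us /=.
    by rewrite -sum_eq ?t0 // mulr_sumr; apply: eq_bigr => j _; rewrite mulrA.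
  - rewrite exchange_big; apply: eq_big_seq => u us /=.
    rewrite sum_multiples ?s0 // mulr_sumr.
    by apply: eq_bigr => j _; rewrite mulrA.
rewrite -subr_ge0.
have := sumb n (fun j => psi (n %/ j)); rewrite n0 mul1r divn1 => sumn.
suff : 0 <= \sum_(1 <= j < n.+1) b j * psi (n %/ j).
  rewrite sumn; congr (0 <= _ - _); congr (_ + _).
    apply: eq_big_seq => u us; rewrite ln_fact; congr (_ * _).
    by apply: eq_bigr => k _; rewrite divnMA.
  apply: eq_bigr => u _; case: leqP => [_|nu]; first by rewrite mul1r.
  by rewrite divn_small // psi0 mul0r.
apply: abel_ge0 => [j _|j|j j0]; last 2 first.
- exact: psi_ge0.
- by rewrite le_psi // leq_div2l.
have [->|j0] := posnP j; first by rewrite big_geq.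
have := sumb j (fun=> 1); under eq_bigr do rewrite mulr1; move=> ->.
rewrite j0 mulr1 subr_ge0; apply: le_trans (hE j j0) _; apply: lerD.
  rewrite le_eqVlt; apply/orP; left; apply/eqP/eq_bigr => u _.
  by rewrite sumr_const_nat subn1.
by rewrite le_eqVlt; apply/orP; left; apply/eqP/eq_bigr => u _; rewrite mulr1.
Qed.

(* [ln n! - (n ln n - n + 1/2 ln n)] decreases from 1, by at most
   [1 / (4 n (n + 1))] at step [n]. *)
Let stirling_defect (n : nat) : R :=
  ln n`!%:R - (n%:R * ln n%:R - n%:R + 1 / 2 * ln n%:R).

Let stirling_step n : (0 < n)%N ->
  0 <= stirling_defect n - stirling_defect n.+1 <= 1 / 4 * (n%:R^-1 - n.+1%:R^-1).
Proof.
move=> n0; have n1 : (1 : R) <= n%:R by rewrite ler1n.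
have nR : 0 < n%:R :> R by rewrite ltr0n.
have nS : n.+1%:R = n%:R + 1 :> R by rewrite -natr1.
have -> : stirling_defect n - stirling_defect n.+1 =
    (n%:R + 1 / 2) * (ln (n%:R + 1) - ln n%:R) - 1.
  rewrite /stirling_defect factS natrM lnM ?posrE ?ltr0n ?fact_gt0 // nS; ring.
(* With this [z], [(1 + z) / (1 - z) = (n + 1) / n]. *)
pose z : R := (2 * n%:R + 1)^-1.
have z0 : 0 < z by rewrite invr_gt0; lra.
have zE : z * (2 * n%:R + 1) = 1 by rewrite mulVf //; lra.
have z3 : z <= 1 / 3 by nra.
have -> : ln (n%:R + 1) - ln n%:R = ln (1 + z) - ln (1 - z) :> R.
  rewrite -!ln_div ?posrE //; try lra.
  congr ln; rewrite /z; field; lra.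
have nz : n%:R + 1 / 2 = (2 * z)^-1 :> R by rewrite /z; field; lra.
have -> : n%:R^-1 - n.+1%:R^-1 = 4 * z ^+ 2 / (1 - z ^+ 2) :> R.
  rewrite nS /z; field.
  by do ?[apply/andP; split]; rewrite ?lt0r_neq0 //; nra.
have Lge : 2 * z + 2 / 3 * z ^+ 3 <= ln (1 + z) - ln (1 - z).
  by apply: ln_artanh_ge; lra.
have Lle : ln (1 + z) - ln (1 - z) <= 2 * z + 2 / 3 * z ^+ 3 + 8 / 15 * z ^+ 5.
  by apply: ln_artanh_le; lra.
have z2 : 0 < z ^+ 2 <= 1 / 9 by rewrite exprn_gt0 //=; nra.
have z3' : 0 < z ^+ 3 by rewrite exprn_gt0.
rewrite nz; apply/andP; split.
  rewrite subr_ge0 mulrC ler_pdivlMr; lra.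
rewrite lerBlDr mulrC ler_pdivrMr; last by lra.
apply: le_trans Lle _.
have -> : (1 / 4 * (4 * z ^+ 2 / (1 - z ^+ 2)) + 1) * (2 * z) =
  2 * z + 2 * z ^+ 3 / (1 - z ^+ 2) by field; lra.
rewrite -addrA lerD2l ler_pdivlMr; last by lra.
have -> : z ^+ 5 = z ^+ 3 * z ^+ 2 by rewrite -exprD.
move: (z ^+ 2) (z ^+ 3) z2 z3' => q w q01 w0.
have h : (2 / 3 + 8 / 15 * q) * (1 - q) <= 2 by nra.
have := ler_wpM2l (ltW w0) h; lra.
Qed.

Let stirling_bounds n : (0 < n)%N -> 3 / 4 <= stirling_defect n <= 1.
Proof.
case: n => // n _.
(* The losses telescope, to a total of at most 1/4. *)
have h : 1 - 1 / 4 * (1 - n.+1%:R^-1) <= stirling_defect n.+1 <= 1.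
  elim: n => [|n IH].
    by rewrite /stirling_defect (_ : 1`! = 1%N) // ln1 invr1; lra.
  have /andP[] := @stirling_step n.+1 isT; case/andP: IH.
  move: (stirling_defect n.+1) (stirling_defect n.+2) => x y.
  move: (n.+1%:R^-1) (n.+2%:R^-1) => u v *; apply/andP; split; lra.
have : 0 <= n.+1%:R^-1 :> R by rewrite invr_ge0.
move: (n.+1%:R^-1) (stirling_defect n.+1) h => u x /andP[h1 h2] u0.
by apply/andP; split; lra.
Qed.

Let phi (y : R) : R := y * ln y - y.

Let le_phi (x y : R) : 1 <= x -> x <= y -> phi x <= phi y.
Proof.
move=> x1 xy; have x0 : 0 < x by lra.
have y0 : 0 < y by lra.
have : ln (x / y) <= x / y - 1.
  have := @le_ln1Dx R (x / y - 1); rewrite (_ : 1 + (x / y - 1) = x / y); last by ring.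
  apply; have : 0 < x / y by rewrite divr_gt0.
  lra.
rewrite ln_div ?posrE // => h.
have {}h : y * (ln x - ln y) <= x - y.
  apply: le_trans (_ : y * (x / y - 1) <= _); first by rewrite ler_pM2l.
  by rewrite le_eqVlt; apply/orP; left; apply/eqP; field; lra.
have := ln_ge0 x1; rewrite /phi; nra.
Qed.

(** As [t ln t - t] increases, Stirling at [q = floor y] gives the upper bound and Stirling at
    [q + 1] the lower one. Returning from [(q + 1)!] to [q!] costs [ln (q + 1) <= ln y + 1], which
    changes the sign of the half-logarithm. *)
Lemma ln_fact_divn n d (y : R) : (0 < d <= n)%N -> y = n%:R / d%:R ->
  y * ln y - y - 1 / 2 * ln y <= ln (n %/ d)`!%:R
    <= y * ln y - y + 1 / 2 * ln y + 1.
Proof.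
move=> /andP[d0 dn] yE; set q := (n %/ d)%N.
have q0 : (0 < q)%N by rewrite divn_gt0.
have dR : 0 < d%:R :> R by rewrite ltr0n.
have qy : q%:R <= y by rewrite yE ler_pdivlMr // -natrM ler_nat leq_trunc_div.
have yq : y <= q%:R + 1.
  by rewrite yE natr1 ler_pdivrMr // -natrM ler_nat ltnW // ltn_ceil.
have q1 : 1 <= q%:R :> R by rewrite ler1n.
have /andP[sl su] := stirling_bounds q0.
have /andP[sl' _] := @stirling_bounds q.+1 isT.
have qS : ln q.+1`!%:R = ln (q%:R + 1) + ln q`!%:R :> R.
  by rewrite factS natrM lnM ?posrE ?ltr0n ?fact_gt0 // -natr1.
have p1 := le_phi q1 qy.
have p2 : phi y <= phi (q%:R + 1) by apply: le_phi => //; lra.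
have l1 : ln q%:R <= ln y by rewrite ler_ln ?posrE; lra.
have l2 : ln (q%:R + 1) <= ln y + 1.
  rewrite -[X in _ <= _ + X]expRK.
  have e2 : 2 <= expR 1 :> R by have := @expR_ge1Dx R 1; lra.
  rewrite -lnM ?posrE ?expR_gt0 //; last by lra.
  rewrite ler_ln ?posrE ?mulr_gt0 ?expR_gt0 //; try lra.
  by apply: (@le_trans _ _ (y * 2)); [lra|rewrite ler_pM2l; lra].
have nS : q.+1%:R = q%:R + 1 :> R by rewrite natr1.
rewrite /stirling_defect qS nS in sl'; rewrite /stirling_defect in sl su.
rewrite /phi in p1 p2.
by apply/andP; split; lra.
Qed.
End Psi.

(** * Integer tables of logarithms *)

Section RealOfZ.
Variable R : realType.

(** The numerical checks run on binary integers; this map carries their results to [R]. *)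
Definition realZ (z : Z) : R := (int_of_Z z)%:~R.

Lemma realZD x y : realZ (Z.add x y) = realZ x + realZ y.
Proof. by rewrite /realZ -intrD; congr intmul; lia. Qed.

Lemma realZN x : realZ (Z.opp x) = - realZ x.
Proof. by rewrite /realZ -mulrNz; congr intmul; lia. Qed.

Lemma realZB x y : realZ (Z.sub x y) = realZ x - realZ y.
Proof. by rewrite /realZ -intrB; congr intmul; lia. Qed.

Lemma realZM x y : realZ (Z.mul x y) = realZ x * realZ y.
Proof. by rewrite /realZ -intrM; congr intmul; lia. Qed.

Lemma realZ_nat n : realZ (Z.of_nat n) = n%:R.
Proof. by rewrite /realZ pmulrn; congr intmul; lia. Qed.

Lemma le_realZ x y : (realZ x <= realZ y) = Z.leb x y.
Proof. by rewrite /realZ ler_int; lia. Qed.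

Lemma realZ_gt0 x : (0 < realZ x) = Z.ltb 0 x.
Proof. by rewrite /realZ ltr0z; lia. Qed.

Lemma realZ_div_le a b : Z.ltb 0 b -> realZ (Z.div a b) <= realZ a / realZ b.
Proof.
move=> b0; rewrite ler_pdivlMr; last by rewrite realZ_gt0.
by rewrite -realZM le_realZ; have := Z.mul_div_le a b; lia.
Qed.

Lemma realZ_div_ge a b : Z.ltb 0 b ->
  realZ a / realZ b <= realZ (Z.add (Z.div a b) 1).
Proof.
move=> b0; rewrite ler_pdivrMr; last by rewrite realZ_gt0.
by rewrite -realZM le_realZ; have := Z.mul_succ_div_gt a b; lia.
Qed.

Lemma realZ0 : realZ 0 = 0. Proof. by []. Qed.
Lemma realZ1 : realZ 1 = 1. Proof. by []. Qed.
Lemma realZ2 : realZ 2 = 2. Proof. by []. Qed.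
Lemma realZ3 : realZ 3 = 3. Proof. by []. Qed.
Lemma realZ5 : realZ 5 = 5. Proof. by []. Qed.
Lemma realZ8 : realZ 8 = 8. Proof. by []. Qed.

End RealOfZ.

Opaque realZ.

(* Real numbers are represented by integers after scaling by [ln_scale]. *)
Definition ln_scale : Z := 100000000.

Definition pairZ_add (x y : Z * Z) : Z * Z := (Z.add x.1 y.1, Z.add x.2 y.2).

(* For odd [n], with [w = 2 n^2 - 1],
   [2 ln n = ln (n - 1) + ln (n + 1) + ln ((1 + 1/w) / (1 - 1/w))],
   and the last term is [2/w + 2/(3w^3)] up to [8/(15w^5)]. *)
Definition ln_entry (t : seq (Z * Z)) (n : nat) : Z * Z :=
  let get := nth (Z0, Z0) t in
  if (n <= 1)%N then (Z0, Z0)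
  else if n == 2%N then (69314707 : Z, 69314722 : Z)
  else if ~~ odd n then pairZ_add (get 2%N) (get n./2)
  else
    let w := Z.sub (Z.mul 2 (Z.mul (Z.of_nat n) (Z.of_nat n))) 1 in
    let w3 := Z.mul 3 (Z.mul w (Z.mul w w)) in
    let w5 := Z.mul 5 (Z.mul w3 (Z.mul w w)) in
    let e := pairZ_add (get n.-1) (pairZ_add (get 2%N) (get n.+1./2)) in
    let zl := Z.add (Z.div (Z.mul 2 ln_scale) w) (Z.div (Z.mul 2 ln_scale) w3) in
    (Z.div (Z.add e.1 zl) 2,
     Z.add (Z.div (Z.add e.2 (Z.add zl (Z.add 3 (Z.div (Z.mul 8 ln_scale) w5)))) 2) 1).

Definition ln_table (n : nat) : seq (Z * Z) :=
  foldl (fun t i => rcons t (ln_entry t i)) [::] (iota 0 n).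

Section LnTable.
Variable R : realType.

Definition ln_approx (n : nat) (b : Z * Z) : Prop :=
  realZ R b.1 <= realZ R ln_scale * ln n%:R <= realZ R b.2.

(* Obtained from the logarithms of [16/15], [25/24] and [81/80]. *)
Lemma ln_approx2 : ln_approx 2 (69314707 : Z, 69314722 : Z).
Proof.
have lnq (b c : nat) : (0 < b)%N -> c = (2 * b + 1)%N ->
    let z : R := c%:R^-1 in
    2 * z + 2 / 3 * z ^+ 3 <= ln b.+1%:R - ln b%:R
      /\ ln b.+1%:R - ln b%:R <= 2 * z + 2 / 3 * z ^+ 3 + 8 / 15 * z ^+ 5.
  move=> b0 -> z.
  have bR : 1 <= b%:R :> R by rewrite ler1n.
  have zE : z = (2 * b%:R + 1)^-1 by rewrite /z natrD natrM.
  have z0 : 0 <= z by rewrite zE invr_ge0; lra.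
  have z1 : z < 1 / 2 by rewrite zE -div1r ltr_pdivrMr; lra.
  have -> : ln b.+1%:R - ln b%:R = ln (1 + z) - ln (1 - z) :> R.
    rewrite -natr1 -!ln_div ?posrE; try lra.
    by congr ln; rewrite zE; field; rewrite !lt0r_neq0 //; lra.
  by split; [apply: ln_artanh_ge|apply: ln_artanh_le]; lra.
(* The combination [7 ln(16/15) + 5 ln(25/24) + 3 ln(81/80) = ln 2] eliminates [ln 3] and [ln 5]. *)
have [h1 h1'] := lnq 15%N 31%N isT erefl.
have [h2 h2'] := lnq 24%N 49%N isT erefl.
have [h3 h3'] := lnq 80%N 161%N isT erefl.
have lnM' (a b : nat) : (0 < a)%N -> (0 < b)%N ->
    ln (a * b)%N%:R = ln a%:R + ln b%:R :> R.
  by move=> a0 b0; rewrite natrM lnM ?posrE ?ltr0n.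
have e16 : ln 16%:R = 4 * ln 2%:R :> R.
  by rewrite (lnM' 4 4)%N // (lnM' 2 2)%N //; ring.
have e15 : ln 15%:R = ln 3%:R + ln 5%:R :> R by rewrite (lnM' 3 5)%N.
have e25 : ln 25%:R = 2 * ln 5%:R :> R by rewrite (lnM' 5 5)%N //; ring.
have e24 : ln 24%:R = 3 * ln 2%:R + ln 3%:R :> R.
  by rewrite (lnM' 8 3)%N // (lnM' 4 2)%N // (lnM' 2 2)%N //; ring.
have e81 : ln 81%:R = 4 * ln 3%:R :> R.
  by rewrite (lnM' 9 9)%N // (lnM' 3 3)%N //; ring.
have e80 : ln 80%:R = 4 * ln 2%:R + ln 5%:R :> R.
  by rewrite (lnM' 16 5)%N // e16.
rewrite e16 e15 e25 e24 e81 e80 in h1 h1' h2 h2' h3 h3'.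
have small n : realZ R (Z.of_nat n) = n%:R by exact: realZ_nat.
rewrite /ln_approx /=.
(* The numerals are split into products of small naturals, so that [realZ] can be pushed through
   them without large unary numbers. *)
have -> : 69314707%bigZ = Z.add (Z.add (Z.mul (Z.mul (Z.of_nat 69) (Z.of_nat 1000))
    (Z.of_nat 1000)) (Z.mul (Z.of_nat 314) (Z.of_nat 1000))) (Z.of_nat 707) by [].
have -> : 69314722%bigZ = Z.add (Z.add (Z.mul (Z.mul (Z.of_nat 69) (Z.of_nat 1000))
    (Z.of_nat 1000)) (Z.mul (Z.of_nat 314) (Z.of_nat 1000))) (Z.of_nat 722) by [].
have -> : ln_scale = Z.mul (Z.mul (Z.of_nat 100) (Z.of_nat 1000)) (Z.of_nat 1000) by [].
rewrite !(realZD, realZM, small).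
apply/andP; split; lra.
Qed.

Lemma ln_approxM a b x y : (0 < a)%N -> (0 < b)%N ->
  ln_approx a x -> ln_approx b y -> ln_approx (a * b) (pairZ_add x y).
Proof.
move=> a0 b0; rewrite /ln_approx /= !realZD natrM lnM ?posrE ?ltr0n // mulrDr.
by move=> /andP[? ?] /andP[? ?]; rewrite !lerD.
Qed.

Lemma ln_entry_approx t n :
  (forall i, (0 < i < n)%N -> ln_approx i (nth (Z0, Z0) t i)) -> (0 < n)%N ->
  ln_approx n (ln_entry t n).
Proof.
move=> ht n0; rewrite /ln_entry; case: leqP => [n1|n1].
  have -> : n = 1%N by lia.
  by rewrite /ln_approx ln1 mulr0 lexx.
case: eqVneq => [->|n2]; first exact: ln_approx2.
have t2 : ln_approx 2 (nth (Z0, Z0) t 2) by apply: ht; lia.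
case: ifPn => [n_even|]; last rewrite negbK => n_odd.
  have nE : n = (2 * n./2)%N by lia.
  by rewrite [X in ln_approx X _]nE; apply: ln_approxM => //; [lia|apply: ht; lia].
set w := Z.sub _ 1; set w3 := Z.mul 3 _; set w5 := Z.mul 5 _.
set e := pairZ_add _ _; set zl := Z.add (Z.div _ w) _; set zh := Z.add zl _.
have n3 : (3 <= n)%N by case: n n_odd n1 {n2 ht n0 w w3 w5 e zl zh} => [|[|[|]]].
have nSE : n.+1 = (2 * n.+1./2)%N by lia.
have : ln_approx (n.-1 * n.+1) e.
  rewrite [X in ln_approx (_ * X) _]nSE.
  apply: ln_approxM; [lia|lia|apply: ht; lia|].
  by apply: ln_approxM => //; [lia|apply: ht; lia].
clearbody e; case: e => e1 e2.
rewrite /ln_approx natrM lnM ?posrE ?ltr0n //; last by lia.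
rewrite ![(_, _).1]/= ![(_, _).2]/=.
have nR : 3 <= n%:R :> R by rewrite (ler_nat _ 3).
have -> : n.-1%:R = n%:R - 1 :> R by rewrite -subn1 natrB // ltnW.
have -> : n.+1%:R = n%:R + 1 :> R by rewrite natr1.
have wE : realZ R w = 2 * n%:R ^+ 2 - 1.
  by rewrite /w realZB !realZM realZ_nat expr2 realZ1 realZ2.
have wR : 17 <= realZ R w by rewrite wE; nra.
have w3E : realZ R w3 = 3 * realZ R w ^+ 3.
  by rewrite /w3 realZM realZM realZM realZ3 !exprS expr0 mulr1.
have w5E : realZ R w5 = 15 * realZ R w ^+ 5.
  by rewrite /w5 realZM realZM w3E realZM realZ5; ring.
have zlE : realZ R zl = realZ R (Z.div (Z.mul 2 ln_scale) w)
  + realZ R (Z.div (Z.mul 2 ln_scale) w3) by rewrite /zl realZD.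
have zhE : realZ R zh = realZ R zl + (3 + realZ R (Z.div (Z.mul 8 ln_scale) w5)).
  by rewrite /zh realZD realZD realZ3.
clearbody zl zh w5 w3 w.
have w_gt0 : 0 < realZ R w by lra.
pose z := (realZ R w)^-1.
have z0 : 0 < z by rewrite invr_gt0; lra.
have z1 : z < 1 / 2 by rewrite /z -div1r ltr_pdivrMr; lra.
have lnE : 2 * ln n%:R - (ln (n%:R - 1) + ln (n%:R + 1))
    = ln (1 + z) - ln (1 - z) :> R.
  rewrite mulr2n mulrDl !mul1r -!lnM -?ln_div ?posrE; try nra.
  congr ln; rewrite /z wE; field.
  by rewrite !lt0r_neq0 //; nra.
have : 2 * z + 2 / 3 * z ^+ 3 <= ln (1 + z) - ln (1 - z).
  by apply: ln_artanh_ge; lra.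
have : ln (1 + z) - ln (1 - z) <= 2 * z + 2 / 3 * z ^+ 3 + 8 / 15 * z ^+ 5.
  by apply: ln_artanh_le; lra.
rewrite -lnE; set L := ln (n%:R - 1) + ln (n%:R + 1); set l := ln n%:R.
set c := realZ R ln_scale; have c0 : 0 < c by rewrite /c realZ_gt0.
have w0 : Z.ltb 0 w by rewrite -(realZ_gt0 R).
have w30 : Z.ltb 0 w3.
  by rewrite -(realZ_gt0 R) w3E; apply: mulr_gt0 => //; apply: exprn_gt0.
have w50 : Z.ltb 0 w5.
  by rewrite -(realZ_gt0 R) w5E; apply: mulr_gt0 => //; apply: exprn_gt0.
(* Each truncated division loses less than one unit: the three in the series account for the 3 in
   [zh], and the halving for the final 1. *)
have q1 := realZ_div_le R (Z.mul 2 ln_scale) w0.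
have q1' := realZ_div_ge R (Z.mul 2 ln_scale) w0.
have q3 := realZ_div_le R (Z.mul 2 ln_scale) w30.
have q3' := realZ_div_ge R (Z.mul 2 ln_scale) w30.
have q5' := realZ_div_ge R (Z.mul 8 ln_scale) w50.
have d1 := realZ_div_le R (Z.add e1 zl) (isT : Z.ltb 0 2).
have d2 := realZ_div_ge R (Z.add e2 zh) (isT : Z.ltb 0 2).
rewrite realZD realZ1 realZM realZ8 -/c w5E in q5'.
rewrite realZD realZ1 realZM realZ2 -/c w3E in q3'.
rewrite realZM realZ2 -/c w3E in q3.
rewrite realZD realZ1 realZM realZ2 -/c in q1'.
rewrite realZM realZ2 -/c in q1.
rewrite realZD realZ2 in d1; rewrite [X in X / _]realZD realZ2 in d2.
move=> hu hl h12.
have := ler_wpM2l (ltW c0) hu; have := ler_wpM2l (ltW c0) hl.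
rewrite zlE in d1 zhE; rewrite zhE in d2.
move: (realZ R (Z.div (Z.mul 2 ln_scale) w)) (realZ R (Z.div (Z.mul 2 ln_scale) w3))
  (realZ R (Z.div (Z.mul 8 ln_scale) w5)) q1 q1' q3 q3' q5' d1 d2 => x1 x3 x5.
move: (realZ R (Z.div _ 2)) (realZ R (Z.add (Z.div _ 2) 1)) h12 => y1 y2.
move: (realZ R e1) (realZ R e2) => f1 f2.
rewrite /z; move: (realZ R w) (c) w_gt0 => v k v0.
have -> : 2 * k / v = k * (2 * v^-1) by ring.
have -> : 2 * k / (3 * v ^+ 3) = k * (2 / 3 * v^-1 ^+ 3) by field; rewrite gt_eqF.
have -> : 8 * k / (15 * v ^+ 5) = k * (8 / 15 * v^-1 ^+ 5) by field; rewrite gt_eqF.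
move: (L) (l) => L' l'; clear.
by move=> *; lra.
Qed.

Lemma size_ln_table n : size (ln_table n) = n.
Proof.
suff h r t : size (foldl (fun t i => rcons t (ln_entry t i)) t r) = (size t + size r)%N.
  by rewrite /ln_table h size_iota.
elim: r t => [|i r IH] t /=; first by rewrite addn0.
by rewrite IH size_rcons addSnnS.
Qed.

Lemma ln_table_approx n i : (0 < i < n)%N ->
  ln_approx i (nth (Z0, Z0) (ln_table n) i).
Proof.
elim: n i => [|n IH] i; first by rewrite ltn0 andbF.
have -> : ln_table n.+1 = rcons (ln_table n) (ln_entry (ln_table n) n).
  by rewrite /ln_table -addn1 iotaD foldl_cat.
rewrite ltnS nth_rcons size_ln_table => /andP[i0].
rewrite leq_eqVlt => /predU1P[iE|iltn]; last by rewrite iltn; apply: IH; rewrite i0.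
rewrite {}iE in i0 *; rewrite ltnn eqxx; exact: ln_entry_approx.
Qed.

End LnTable.

(** * The bound on psi up to 2^14 *)

Definition ln_upper (t : seq (Z * Z)) (n : nat) : Z := (nth (Z0, Z0) t n).2.

Definition ln_octave (t : seq (Z * Z)) (k : nat) : seq Z :=
  flatten [seq nseq (2 ^ k)
             (Z.add (ln_upper t a) (Z.mul (Z.of_nat k) (ln_upper t 2)))
          | a <- iota 65 64].

(* Entry [i] is an upper bound for [ln (i + 1)]; beyond 128, [ln n] is bounded by
   [ln (a 2^k)] where [64 < a <= 128] is the least integer with [n <= a 2^k]. *)
Definition ln_upper_list (t : seq (Z * Z)) (r : nat) : seq Z :=
  [seq ln_upper t n | n <- iota 1 128] ++
  flatten [seq ln_octave t k | k <- iota 1 r].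

(** The counter [k] is the distance to the next entry to strike, so no division is performed. *)
Fixpoint strike (q k : nat) (l : seq Z) : seq Z :=
  if l is x :: l' then
    if k is k'.+1 then x :: strike q k' l' else Z0 :: strike q q.-1 l'
  else [::].

(* [q] itself is not struck. *)
Definition sieve (qs : seq nat) (l : seq Z) : seq Z :=
  foldl (fun l q => strike q (q.*2).-1 l) l qs.

(* [psi] increases by [ln q] at [q ^ k]. *)
Definition put_powers (t : seq (Z * Z)) (qks : seq (nat * nat)) (l : seq Z) :=
  foldl (fun l qk => set_nth Z0 l (qk.1 ^ qk.2).-1 (ln_upper t qk.1)) l qks.

(* Partial sums are compared with [c n] only where they increase. *)
Fixpoint scan_le (c n acc : Z) (l : seq Z) : bool :=
  if l is x :: l' then
    let n' := Z.add n 1 in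
    if x is Z0 then scan_le c n' acc l'
    else let acc' := Z.add acc x in
      if Z.leb acc' (Z.mul c n') then scan_le c n' acc' l' else false
  else true.

Section Scan.
Variable R : realType.
Notation psi := (psi R).
Notation realZ := (realZ R).

Lemma psiS_ln n : psi n.+1 <= psi n + ln n.+1%:R.
Proof.
rewrite /psi -lnM ?posrE ?ltr0n ?lcm_upto_gt0 //.
rewrite ler_ln ?posrE ?ltr0n ?mulr_gt0 ?ltr0n ?lcm_upto_gt0 // -natrM ler_nat.
rewrite dvdn_leq ?muln_gt0 ?lcm_upto_gt0 //= dvdn_lcm.
by rewrite dvdn_mulr // dvdn_mull.
Qed.

Lemma psiS_pfactor n p k : (1 < p)%N -> n.+1 = (p ^ k.+1)%N ->
  psi n.+1 <= psi n + ln p%:R.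
Proof.
move=> p1 nE; have p0 := ltnW p1.
rewrite /psi -lnM ?posrE ?ltr0n ?lcm_upto_gt0 // ler_ln ?posrE ?mulr_gt0 ?ltr0n ?lcm_upto_gt0 //.
by rewrite -natrM ler_nat mulnC dvdn_leq ?muln_gt0 ?lcm_upto_gt0 ?p0 ?(lcm_uptoS_pfactor p1 nE).
Qed.

Lemma psiS_coprime n a b : n.+1 = (a * b)%N -> (1 < a)%N -> (1 < b)%N ->
  coprime a b -> psi n.+1 = psi n.
Proof. by move=> nE a1 b1 ab; rewrite /psi (lcm_uptoS_coprime nE). Qed.

(** Entry [i] stands for the integer [i + 1]. *)
Definition increment_le (l : seq Z) (i : nat) : Prop :=
  realZ ln_scale * (psi i.+1 - psi i) <= realZ (nth Z0 l i).

Let scale_gt0 : 0 < realZ ln_scale.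
Proof. by rewrite realZ_gt0. Qed.

Lemma scan_leP c l : Z.leb 0 c -> scan_le c Z0 Z0 l ->
  (forall i, (i < size l)%N -> increment_le l i) ->
  forall n, (n <= size l)%N -> realZ ln_scale * psi n <= realZ c * n%:R.
Proof.
move=> c0 hs hl.
have c0R : 0 <= realZ c by rewrite -(realZ0 R) le_realZ.
suff h l' i acc : scan_le c (Z.of_nat i) acc l' ->
    (forall j, (j < size l')%N ->
       realZ ln_scale * (psi (i + j).+1 - psi (i + j)) <= realZ (nth Z0 l' j)) ->
    realZ ln_scale * psi i <= realZ acc ->
    realZ ln_scale * psi i <= realZ c * i%:R ->
    forall j, (j <= size l')%N ->
      realZ ln_scale * psi (i + j) <= realZ c * (i + j)%:R.
  move=> n nl; apply: (h l 0%N Z0) => //; first by rewrite psi0 mulr0 realZ0.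
  by rewrite psi0 !mulr0.
elim: l' i acc => [|x l' IH] i acc /=.
  by move=> _ _ _ h j; rewrite leqn0 => /eqP ->; rewrite addn0.
move=> hsc hinc hacc hi [|j] jl; first by rewrite addn0.
have inc0 := hinc 0%N isT; rewrite addn0 /= in inc0.
have -> : (i + j.+1 = i.+1 + j)%N by rewrite addnS.
have iS : Z.add (Z.of_nat i) 1 = Z.of_nat i.+1 by lia.
rewrite iS in hsc.
have hacc' : realZ ln_scale * psi i.+1 <= realZ (Z.add acc x).
  rewrite realZD; apply: le_trans (lerD hacc inc0).
  by rewrite mulrBr addrC subrK.
have hinc' k : (k < size l')%N ->
    realZ ln_scale * (psi (i.+1 + k).+1 - psi (i.+1 + k)) <= realZ (nth Z0 l' k).
  by move=> kl; have := hinc k.+1 kl; rewrite addnS.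
have iSR : i%:R <= i.+1%:R :> R by rewrite ler_nat.
case: x => [|x|x] in hsc inc0 hacc' hinc *.
- apply: (IH i.+1 acc) => //; first by rewrite -[acc]Z.add_0_r.
  have : realZ ln_scale * psi i.+1 <= realZ ln_scale * psi i.
    by rewrite -subr_le0 -mulrBr -(realZ0 R).
  by move=> h; apply: le_trans h (le_trans hi _); rewrite ler_wpM2l.
- case: ifP hsc => // hle hsc; apply: (IH i.+1 _ hsc) => //.
  by apply: le_trans hacc' _; rewrite -realZ_nat -realZM le_realZ.
- case: ifP hsc => // hle hsc; apply: (IH i.+1 _ hsc) => //.
  by apply: le_trans hacc' _; rewrite -realZ_nat -realZM le_realZ.
Qed.

Lemma nth_strike q k l i : (0 < q)%N ->
  nth Z0 (strike q k l) i =
  if (k <= i)%N && (q %| i - k)%N then Z0 else nth Z0 l i.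
Proof.
move=> q0; elim: l k i => [|x l IH] k i; first by rewrite nth_nil if_same.
case: k i => [|k] [|i] //=; first by rewrite subn0 dvdn0.
  rewrite IH subn0; have -> : (q %| i.+1 = (q.-1 <= i) && (q %| i - q.-1))%N.
    case: (leqP q.-1 i) => qi /=.
      have -> : i.+1 = (i - q.-1 + q)%N by lia.
      by rewrite dvdn_addl.
    by apply/negbTE/negP => /dvdn_leq; lia.
  by [].
by rewrite IH.
Qed.

Lemma size_strike q k l : size (strike q k l) = size l.
Proof. by elim: l k => //= x l IH [|k] /=; rewrite IH. Qed.

Lemma size_sieve qs l : size (sieve qs l) = size l.
Proof. by elim: qs l => //= q qs IH l; rewrite IH size_strike. Qed.

(** A struck integer is a proper multiple of some [q]. Either it splits into two coprime factors
    above 1, and [psi] does not move, or it is a power of [q] of exponent at least 2, an exception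
    left to [put_powers]. *)
Lemma sieve_increment qs l : all prime qs ->
  (forall i, (i < size l)%N -> increment_le l i) ->
  forall i, (i < size l)%N -> increment_le (sieve qs l) i \/
    exists q k, [/\ q \in qs, (1 < k)%N & i.+1 = (q ^ k)%N].
Proof.
move=> pqs hl.
suff h qs' l' : all prime qs' ->
    (forall i, (i < size l')%N -> increment_le l' i \/
      exists q k, [/\ q \in qs, (1 < k)%N & i.+1 = (q ^ k)%N]) ->
    {subset qs' <= qs} ->
    forall i, (i < size l')%N -> increment_le (sieve qs' l') i \/
      exists q k, [/\ q \in qs, (1 < k)%N & i.+1 = (q ^ k)%N].
  by move=> i il; apply: h => // j jl; left; exact: hl.
elim: qs' l' => [|q qs' IH] l' //= /andP[q_pr pqs'] hl' sub i il.
apply: IH => //; last by rewrite size_strike.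
  move=> j; rewrite size_strike => jl; rewrite /increment_le nth_strike ?prime_gt0 //.
  case: ifP => [/andP[qj dj]|_]; last exact: hl'.
  have q1 := prime_gt1 q_pr.
  have djS : (q %| j.+1)%N.
    have -> : j.+1 = (j - q.*2.-1 + q.*2)%N by lia.
    by rewrite dvdn_addl // -muln2 dvdn_mulr.
  have [a ca jE] := pfactor_coprime q_pr (ltn0Sn j).
  have lq : (0 < logn q j.+1)%N by rewrite logn_gt0 mem_primes q_pr.
  have [a1|a1] := leqP a 1.
    have a_1 : a = 1%N by case: a a1 {ca} jE => [|[]] //; rewrite mul0n.
    right; exists q, (logn q j.+1); rewrite sub ?mem_head //; split => //.
      rewrite ltn_neqAle lq andbT; apply/negP => /eqP e.
      by move: jE; rewrite -e a_1 mul1n expn1; lia.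
    by rewrite {1}jE a_1 mul1n.
  left; rewrite (@psiS_coprime j a (q ^ logn q j.+1)) //.
  - by rewrite subrr mulr0 realZ0.
  - by rewrite -(expn0 q) ltn_exp2l.
  - by rewrite coprime_sym coprimeXl.
by move=> x xq; apply: sub; rewrite in_cons xq orbT.
Qed.

Variable t : seq (Z * Z).
Hypothesis t_approx : forall n, (0 < n <= 128)%N -> ln_approx R n (nth (Z0, Z0) t n).

Let ln_upperP n : (0 < n <= 128)%N -> realZ ln_scale * ln n%:R <= realZ (ln_upper t n).
Proof. by move=> /t_approx /andP[]. Qed.

Lemma put_powers_increment qks l :
  all (fun qk => (1 < qk.1 <= 128) && (0 < qk.2))%N qks ->
  all (fun qk => (qk.1 ^ qk.2 <= size l))%N qks ->
  (forall i, (i < size l)%N -> increment_le l i \/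
    exists q k, (q, k) \in qks /\ i.+1 = (q ^ k)%N) ->
  size (put_powers t qks l) = size l /\
  forall i, (i < size l)%N -> increment_le (put_powers t qks l) i.
Proof.
elim: qks l => [|[q k] qks IH] l /=.
  by move=> _ _ h; split => // i /h[//|[q [k []]]].
move=> /andP[/andP[/andP[q1 q128] k0] hq] /andP[ql hs] h.
have qk0 : (0 < q ^ k)%N by rewrite expn_gt0 (ltnW q1).
set l1 := set_nth _ _ _ _.
have s1 : size l1 = size l.
  by rewrite size_set_nth; apply/maxn_idPr; rewrite prednK.
rewrite -s1; apply: IH => //; first by rewrite s1.
move=> i; rewrite s1 => il; rewrite /increment_le nth_set_nth /=.
case: eqVneq => [iE|iN].
  left; have iS : i.+1 = (q ^ k.-1.+1)%N by rewrite !prednK // iE prednK.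
  have := psiS_pfactor q1 iS; rewrite -lerBlDl => hpsi.
  have q01 : (0 < q <= 128)%N by rewrite q128 ltnW.
  by apply: le_trans (ln_upperP q01); rewrite ler_pM2l.
have [hi|[q' [k' [qk e]]]] := h i il; first by left.
move: qk; rewrite in_cons => /predU1P[[qE kE]|inq].
  by move: iN; rewrite -qE -kE -e eqxx.
by right; exists q', k'.
Qed.

Lemma ln_upper_list_increment r :
  size (ln_upper_list t r) = (128 * 2 ^ r)%N /\
  forall i, (i < size (ln_upper_list t r))%N -> increment_le (ln_upper_list t r) i.
Proof.
pose covers n l := forall i, (i < size l)%N ->
  realZ ln_scale * ln (n + i).+1%:R <= realZ (nth Z0 l i).
have covers_cat n l1 l2 : covers n l1 -> covers (n + size l1)%N l2 ->
    covers n (l1 ++ l2).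
  move=> h1 h2 i; rewrite size_cat => il; rewrite nth_cat.
  case: ltnP => li; first exact: h1.
  by have := h2 (i - size l1)%N; rewrite -addnA subnKC //; apply; lia.
(* Block by block: the integers in [(b 2^k, (b + 1) 2^k]] all receive the bound for
   [ln ((b + 1) 2^k)]. *)
have oct k b s : (64 <= b)%N -> (b + s <= 128)%N ->
    let l := flatten [seq nseq (2 ^ k) (Z.add (ln_upper t a)
               (Z.mul (Z.of_nat k) (ln_upper t 2))) | a <- iota b.+1 s] in
    size l = (s * 2 ^ k)%N /\ covers (b * 2 ^ k)%N l.
  elim: s b => [|s IH] b b64 bs /=; first by split => // i.
  have [] := IH b.+1; rewrite ?(leq_trans b64) //; first by lia.
  move=> sz cv; split; first by rewrite size_cat sz size_nseq mulSn.
  apply: covers_cat; last by rewrite size_nseq -mulSnr.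
  move=> i; rewrite size_nseq => ik; rewrite nth_nseq ik realZD realZM realZ_nat.
  have b128 : (0 < b.+1 <= 128)%N by lia.
  have h2 := ln_upperP (isT : 0 < 2 <= 128)%N; have hb := ln_upperP b128.
  apply: (@le_trans _ _ (realZ ln_scale * (ln b.+1%:R + k%:R * ln 2))); last first.
    rewrite mulrDr lerD // mulrCA ler_wpM2l //.
  rewrite ler_pM2l //.
  have -> : ln b.+1%:R + k%:R * ln 2 = ln (b.+1 * 2 ^ k)%N%:R :> R.
    by rewrite natrM natrX lnM ?posrE ?exprn_gt0 // lnXn // mulr_natl.
  by rewrite ler_ln ?posrE ?ltr0n ?muln_gt0 ?expn_gt0 // ler_nat mulSn; lia.
have all_oct : size (ln_upper_list t r) = (128 * 2 ^ r)%N /\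
    covers 0%N (ln_upper_list t r).
  elim: r => [|r [sz cv]].
    have -> : ln_upper_list t 0 = [seq ln_upper t n | n <- iota 1 128].
      exact: cats0.
    rewrite /covers size_map size_iota; split => // i i128.
    by rewrite (nth_map 0%N) ?size_iota // nth_iota // add0n add1n; apply: ln_upperP; lia.
  have -> : ln_upper_list t r.+1 = ln_upper_list t r ++ ln_octave t r.+1.
    rewrite /ln_upper_list -catA; congr (_ ++ _).
    by rewrite -[r.+1]addn1 iotaD map_cat flatten_cat /= cats0 add1n addn1.
  have [] := oct r.+1 64%N 64%N isT isT; rewrite -/(ln_octave t r.+1) => so co.
  have e : (64 * 2 ^ r.+1 = 128 * 2 ^ r)%N by rewrite expnS mulnA.
  split; first by rewrite size_cat sz so e expnS mulnCA mul2n addnn.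
  by apply: covers_cat; [exact: cv|rewrite add0n sz -e; exact: co].
have [sz cv] := all_oct; split => // i il.
apply: le_trans (cv i il); rewrite add0n ler_pM2l // lerBlDl; exact: psiS_ln.
Qed.
End Scan.

Definition sieve_primes : seq nat := [:: 2; 3; 5; 7; 11; 13; 17; 19; 23; 29; 31; 37;
  41; 43; 47; 53; 59; 61; 67; 71; 73; 79; 83; 89; 97; 101; 103; 107; 109; 113; 127]%N.

(** The proper powers up to [2^14 = 16384] of the sieving primes; the lists stop at [23^3], [11^4],
    [5^5], [5^6], [3^8] and [2^14]. *)
Definition sieve_powers : seq (nat * nat) :=
  [seq (q, 2%N) | q <- sieve_primes] ++ [seq (q, 3%N) | q <- take 9 sieve_primes] ++
  [seq (q, 4%N) | q <- take 5 sieve_primes] ++ [seq (q, 5%N) | q <- take 3 sieve_primes] ++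
  [seq (q, 6%N) | q <- take 3 sieve_primes] ++ [:: (3, 7); (3, 8)]%N ++
  [seq (2%N, k) | k <- iota 7 8].

Definition ln_table_129 := Eval vm_compute in ln_table 129.

Definition psi_increments : seq Z :=
  put_powers ln_table_129 sieve_powers
    (sieve sieve_primes (ln_upper_list ln_table_129 7)).

(** The integer 103883000 is 1.03883 times [ln_scale]. *)
Lemma scan_psi_increments : scan_le 103883000 Z0 Z0 psi_increments.
Proof. by vm_cast_no_check (erefl true). Qed.

Section PsiSmall.
Variable R : realType.
Notation psi := (psi R).
Notation realZ := (realZ R).

(** Binary powers, so that the checks on exponents never build large unary numbers. *)
Definition powN (q k : nat) : N := iter k (N.mul (N.of_nat q)) 1%num.

Lemma powNE q k : N.to_nat (powN q k) = (q ^ k)%N.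
Proof. by elim: k => //= k IH; rewrite N2Nat.inj_mul Nat2N.id IH expnS. Qed.

Lemma sieve_powers_complete : all (fun q => all (fun k =>
    N.leb (powN q k) 16384 ==> ((q, k) \in sieve_powers)) (iota 2 13)) sieve_primes.
Proof. by vm_cast_no_check (erefl true). Qed.

Lemma mem_sieve_powers q k : q \in sieve_primes -> (1 < k)%N ->
  (q ^ k <= 128 * 2 ^ 7)%N -> (q, k) \in sieve_powers.
Proof.
move=> qs k1 qk; have q1 : (1 < q)%N.
  by apply: prime_gt1; apply: (allP (_ : all prime sieve_primes)) qs.
have k0 : (0 < k)%N := ltnW k1.
have k14 : (k <= 14)%N.
  have h : (2 ^ k <= 2 ^ 14)%N.
    by apply: leq_trans (leq_trans _ qk) _; rewrite ?leq_exp2r // -(expnD 2 7 7).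
  by move: h; rewrite leq_exp2l.
have /allP/(_ q qs)/allP/(_ k) := sieve_powers_complete.
rewrite mem_iota => /(_ _)/implyP; apply; first by move: k1 k14; clear; lia.
apply/N.leb_le; have := powNE q k; move: qk; move: (powN q k) (q ^ k)%N => x y.
by clear; lia.
Qed.

Lemma psi_le_small n : (n <= 128 * 2 ^ 7)%N -> psi n <= rs_const R * n%:R.
Proof.
move=> nX.
have tE : ln_table_129 = ln_table 129 by vm_cast_no_check (erefl ln_table_129).
have t_approx i : (0 < i <= 128)%N -> ln_approx R i (nth (Z0, Z0) ln_table_129 i).
  by rewrite tE => i128; apply: ln_table_approx; lia.
have [sz inc] := ln_upper_list_increment t_approx 7.
have pr : all prime sieve_primes by [].
have sinc := sieve_increment pr inc.
have ssz := size_sieve sieve_primes (ln_upper_list ln_table_129 7).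
have [|||psz pinc] := @put_powers_increment R _ t_approx sieve_powers
  (sieve sieve_primes (ln_upper_list ln_table_129 7)).
- by vm_cast_no_check (erefl true).
- rewrite ssz sz; apply/allP => -[q k] qk.
  have /allP/(_ _ qk)/N.leb_le : all (fun qk => N.leb (powN qk.1 qk.2) 16384) sieve_powers.
    by vm_cast_no_check (erefl true).
  rewrite -[(q, k).1]/q -[(q, k).2]/k -powNE; move: (powN q k) => x.
  by clear; lia.
- move=> i; rewrite ssz => il; have [|[q [k [qs k1 iE]]]] := sinc i il; first by left.
  right; exists q, k; split; last exact: iE.
  apply: (mem_sieve_powers qs k1); rewrite -iE -sz; exact: il.
have szI : size psi_increments = (128 * 2 ^ 7)%N by rewrite psz ssz sz.
have incI i : (i < size psi_increments)%N -> increment_le R psi_increments i.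
  by rewrite szI => il; apply: pinc; rewrite ssz sz.
have nI : (n <= size psi_increments)%N by rewrite szI.
have := scan_leP (isT : Z.leb 0 103883000) scan_psi_increments incI nI.
have cE : realZ 103883000 = rs_const R * realZ ln_scale.
  have -> : (103883000 : Z) = Z.add ln_scale (Z.mul (Z.of_nat 3883) 1000) by [].
  have -> : ln_scale = Z.mul (Z.mul (Z.of_nat 10) (Z.mul (Z.of_nat 10) (Z.of_nat 10)))
    (Z.mul (Z.mul (Z.of_nat 10) (Z.of_nat 10)) 1000) by [].
  rewrite realZD !realZM !realZ_nat /rs_const; move: (realZ 1000) => k.
  by field.
have s0 : 0 < realZ ln_scale by rewrite realZ_gt0.
rewrite cE; move: (realZ ln_scale) s0 => s s0.
by rewrite mulrAC [_ * s]mulrC ler_pM2l.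
Qed.
End PsiSmall.

(** * Chebyshev's method beyond 2^14 *)

Definition cheb_end : nat := (2 ^ 13)%N.

(* [sum_d nu_d floor(y/d) + sum_(K <= y) c_K >= 1] for [0 < y < cheb_end], where [nu] and [c]
   are the weights and steps below divided by 1000. *)
Definition cheb_weights : seq (nat * Z) := zip [::
    1; 2; 3; 5; 6; 7; 10; 11; 13; 14; 15; 17; 19; 21; 22; 23; 26; 29; 30; 31;
    33; 34; 35; 37; 38; 39; 41; 42; 43; 46; 47; 51; 53; 55; 57; 58; 59; 61;
    65; 66; 67; 69; 70; 71; 73; 74; 78; 82; 85; 86; 87; 91; 93; 94; 95; 97]%N [::
    1000; -1000; -1000; -1000; 1000; -1000; 1000; -1000; -1000; 1000; 1000;
    -1000; -1000; 1000; 1000; -1000; 1000; -808; -1192; -370; 370; 358; 118;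
    -660; 276; 1000; -1000; -1000; -896; 896; -614; 614; -339; 339; 856; 767;
    -808; -150; 520; -370; -55; 697; -118; -171; -60; 615; -1000; 596; 91;
    556; 461; 106; 370; 614; 1000; -370]%bigZ.

Definition cheb_steps : seq (nat * Z) := zip [::
    34; 35; 38; 57; 58; 91; 92; 136; 146; 148; 161; 218; 485; 802; 1078; 3219;
    4589; 5320; 5480; cheb_end]%N [::
    642; 882; 384; 144; 41; 86; 104; 72; 60; 45; 11; 503; 155; 283; 443; 89;
    47; 265; 113; 16000]%bigZ.

(** Entry [i] stands for [y = i + 1], so starting from [k = d - 1] the partial sum up to [y] gains
    [a floor(y / d)]. *)
Fixpoint add_multiples (d k : nat) (a : Z) (l : seq Z) : seq Z :=
  if l is x :: l' then
    if k is k'.+1 then x :: add_multiples d k' a l'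
    else Z.add x a :: add_multiples d d.-1 a l'
  else [::].

Fixpoint partial_sums_ge (q acc : Z) (l : seq Z) : bool :=
  if l is x :: l' then
    let acc' := Z.add acc x in
    if Z.leb q acc' then partial_sums_ge q acc' l' else false
  else true.

(* A step at [K] is a progression of difference [cheb_end] starting at [K]. *)
Definition cheb_jumps : seq Z :=
  foldl (fun l u => add_multiples cheb_end u.1.-1 u.2 l)
    (foldl (fun l u => add_multiples u.1 u.1.-1 u.2 l) (nseq cheb_end.-1 Z0) cheb_weights)
    cheb_steps.

Lemma cheb_weights_range : all (fun u => 0 < u.1 <= 128)%N cheb_weights.
Proof. by vm_cast_no_check (erefl true). Qed.

Lemma cheb_steps_range :
  all (fun u => (0 < u.1 <= cheb_end)%N && Z.leb 0 u.2) cheb_steps.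
Proof. by vm_cast_no_check (erefl true). Qed.

Lemma size_cheb_weights : (size cheb_weights <= 100)%N.
Proof. by vm_cast_no_check (erefl true). Qed.

Lemma cheb_jumps_ge : partial_sums_ge 1000 Z0 cheb_jumps.
Proof. by vm_cast_no_check (erefl true). Qed.

Lemma cheb_end_gt0 : (0 < cheb_end)%N.
Proof. by rewrite expn_gt0. Qed.

Lemma cheb_endE : cheb_end = (2 ^ 13)%N.
Proof. by []. Qed.

Lemma cheb_jumpsE : cheb_jumps =
  foldl (fun l u => add_multiples cheb_end u.1.-1 u.2 l)
    (foldl (fun l u => add_multiples u.1 u.1.-1 u.2 l) (nseq cheb_end.-1 Z0) cheb_weights)
    cheb_steps.
Proof. by []. Qed.

Opaque cheb_end cheb_weights cheb_steps cheb_jumps ln_scale ln_table_129.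

Section PartialSums.
Variable R : realType.
Notation realZ := (realZ R).

Definition partial_sum (l : seq Z) (y : nat) : R := \sum_(i < y) realZ (nth Z0 l i).

Lemma partial_sumS x l y : partial_sum (x :: l) y.+1 = realZ x + partial_sum l y.
Proof. by rewrite /partial_sum big_ord_recl. Qed.

Lemma partial_sum_nseq0 k y : partial_sum (nseq k Z0) y = 0.
Proof. by apply: big1 => i _; rewrite nth_nseq if_same realZ0. Qed.

Lemma partial_sums_geP q acc l : partial_sums_ge q acc l ->
  forall y, (0 < y <= size l)%N -> realZ q <= realZ acc + partial_sum l y.
Proof.
elim: l acc => [|x l IH] acc /=; first by move=> _ y; lia.
case: ifP => // h1 h2 [|[|y]] //= yl; rewrite partial_sumS addrA -realZD.
  by rewrite /partial_sum big_ord0 addr0 le_realZ.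
exact: IH.
Qed.

Lemma size_add_multiples d k a l : size (add_multiples d k a l) = size l.
Proof. by elim: l k => //= x l IH [|k] /=; rewrite IH. Qed.

(** The quotient counts the indices [k, k + d, ...] below [y]. *)
Lemma partial_sum_add_multiples d k a l y : (k < d)%N -> (y <= size l)%N ->
  partial_sum (add_multiples d k a l) y =
  partial_sum l y + realZ a * ((y + (d.-1 - k)) %/ d)%N%:R.
Proof.
move=> kd; have d0 : (0 < d)%N by lia.
elim: l k y kd => [|x l IH] k [|y] //= kd yl.
- by rewrite /partial_sum !big_ord0 divn_small ?mulr0 ?addr0 //; lia.
- by rewrite /partial_sum !big_ord0 divn_small ?mulr0 ?addr0 //; lia.
case: k kd => [|k] kd; rewrite !partial_sumS IH //; try lia.
  rewrite subnn addn0 realZD; have -> : (y.+1 + (d.-1 - 0) = d + y)%N by lia.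
  by rewrite divnDl ?dvdnn // divnn d0 add1n -natr1; ring.
by rewrite addrA; congr (_ + _ * (_ %/ _)%N%:R); lia.
Qed.

Lemma partial_sum_foldl (T : Type) (f : T -> nat * nat) (a : T -> Z) (r : seq T) l y :
  all (fun u => (f u).2 < (f u).1)%N r -> (y <= size l)%N ->
  partial_sum (foldl (fun l u => add_multiples (f u).1 (f u).2 (a u) l) l r) y =
  partial_sum l y
  + \sum_(u <- r) realZ (a u) * ((y + ((f u).1.-1 - (f u).2)) %/ (f u).1)%N%:R.
Proof.
elim: r l => [|u r IH] l /=; first by rewrite big_nil addr0.
move=> /andP[hu hr] yl.
by rewrite IH ?size_add_multiples // partial_sum_add_multiples // big_cons addrA.
Qed.

Lemma size_foldl_add_multiples (T : Type) (f : T -> nat * nat) (a : T -> Z)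
    (r : seq T) l :
  size (foldl (fun l u => add_multiples (f u).1 (f u).2 (a u) l) l r) = size l.
Proof. by elim: r l => //= u r IH l; rewrite IH size_add_multiples. Qed.

Lemma cheb_partial_sum_ge y : (0 < y)%N -> (y < cheb_end)%N ->
  realZ 1000 <= \sum_(u <- cheb_weights) realZ u.2 * (y %/ u.1)%N%:R
    + \sum_(u <- cheb_steps) realZ u.2 * ((y + (cheb_end.-1 - u.1.-1)) %/ cheb_end)%N%:R.
Proof.
move=> y0 y8; pose f1 (u : nat * Z) := (u.1, u.1.-1).
pose f2 (u : nat * Z) := (cheb_end, u.1.-1).
pose l0 := foldl (fun l u => add_multiples (f1 u).1 (f1 u).2 u.2 l)
  (nseq cheb_end.-1 Z0) cheb_weights.
have sz0 : size l0 = cheb_end.-1 by rewrite size_foldl_add_multiples size_nseq.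
have JE : cheb_jumps = foldl (fun l u => add_multiples (f2 u).1 (f2 u).2 u.2 l)
  l0 cheb_steps by exact: cheb_jumpsE.
have szJ : size cheb_jumps = cheb_end.-1 by rewrite JE size_foldl_add_multiples.
have yJ : (0 < y <= size cheb_jumps)%N by rewrite szJ y0 -ltnS prednK // cheb_end_gt0.
have := partial_sums_geP cheb_jumps_ge yJ; rewrite realZ0 add0r; rewrite JE partial_sum_foldl; last 2 first.
- by apply: sub_all cheb_steps_range => u /andP[/andP[u0 u8] _]; rewrite /f2 prednK.
- by rewrite sz0.
rewrite partial_sum_foldl; last 2 first.
- by apply: sub_all cheb_weights_range => u /andP[u0 _]; rewrite /f1 prednK.
- by rewrite size_nseq.
rewrite partial_sum_nseq0 add0r => h; apply: le_trans h _; rewrite lerD2r.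
rewrite le_eqVlt; apply/orP; left; apply/eqP; apply: eq_bigr => u _.
by rewrite /f1 subnn addn0.
Qed.

End PartialSums.

Definition sumZ (g : nat * Z -> Z) (r : seq (nat * Z)) : Z :=
  foldr (fun u => Z.add (g u)) Z0 r.

Definition lnlo (d : nat) : Z := (nth (Z0, Z0) ln_table_129 d).1.
Definition lnhi (d : nat) : Z := (nth (Z0, Z0) ln_table_129 d).2.

(** Rounds [- v ln d / d] upward; the sign of the weight decides which end of the table entry is
    used. *)
Definition cheb_main (u : nat * Z) : Z :=
  if Z.leb 0 u.2 then Z.opp (Z.div (Z.mul u.2 (lnlo u.1)) (Z.of_nat u.1))
  else Z.add (Z.div (Z.mul (Z.opp u.2) (lnhi u.1)) (Z.of_nat u.1)) 1.
Definition cheb_mean (u : nat * Z) : Z :=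
  Z.div (Z.mul u.2 ln_scale) (Z.of_nat u.1).
Definition cheb_abs (u : nat * Z) : Z := Z.abs u.2.
Definition cheb_abs_ln (u : nat * Z) : Z := Z.mul (Z.abs u.2) (lnlo u.1).
Definition cheb_pos (u : nat * Z) : Z := Z.max u.2 0.
Definition cheb_step (u : nat * Z) : Z :=
  Z.add (Z.div (Z.mul u.2 ln_scale) (Z.of_nat u.1)) 1.

(** Bounds from above [10^16] times the coefficient of [n] in the estimate of [psi n - 1.03883 n].
    The 130000 is [13 / 10^7] in units of [10^-11] and pays for [cheb_corrector], as does, in
    thousandths, the 1 added to each of the two totals that follow. *)
Definition cheb_slope : Z :=
  Z.sub (Z.add (Z.mul 100000 (Z.add (sumZ cheb_main cheb_weights) 130000))
               (Z.mul 103883 (sumZ cheb_step cheb_steps)))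
        (Z.mul 103883 (Z.mul 1000 ln_scale)).
Definition cheb_total_abs : Z := Z.add (sumZ cheb_abs cheb_weights) 1.
Definition cheb_total_pos : Z := Z.add (sumZ cheb_pos cheb_weights) 1.

(** The sum of [v / d] over the rounded weights is at most [5000 / 10^11] in absolute value, so that
    times [cheb_end = 8192] it stays below 1/1000. In the companion upper check, 100 pays for the
    rounding of at most 100 terms. *)
Lemma cheb_mean_ge : Z.leb (-5000) (sumZ cheb_mean cheb_weights).
Proof. by vm_cast_no_check (erefl true). Qed.

Lemma cheb_mean_le : Z.leb (Z.add (sumZ cheb_mean cheb_weights) 100) 5000.
Proof. by vm_cast_no_check (erefl true). Qed.

(** From [cheb_end] on all steps are active; their total must offset the worst fractional parts,
    namely the sum of the positive weights, and still leave 1. *)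
Lemma cheb_tail_check :
  Z.leb (Z.add 1000 cheb_total_pos) (sumZ snd cheb_steps).
Proof. by vm_cast_no_check (erefl true). Qed.

Lemma cheb_slope_check : Z.leb (Z.add (Z.mul 32768 cheb_slope)
  (Z.mul 100000 (Z.mul cheb_total_abs ln_scale))) 0.
Proof. by vm_cast_no_check (erefl true). Qed.

Lemma cheb_value_check : Z.leb (Z.add (Z.mul 32768 cheb_slope)
  (Z.mul 100000 (Z.add (Z.mul cheb_total_abs (Z.mul 14 (lnhi 2)))
     (Z.sub (Z.mul 2 (Z.mul cheb_total_pos ln_scale))
        (sumZ cheb_abs_ln cheb_weights))))) 0.
Proof. by vm_cast_no_check (erefl true). Qed.

Opaque sumZ.

(** * From integer checks to real inequalities *)

Section ChebyshevWeights.
Variable R : realType.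
Notation realZ := (realZ R).
Notation psi := (psi R).

Lemma realZ_ge0 x : (0 <= realZ x) = Z.leb 0 x.
Proof. by rewrite -[X in X <= _](realZ0 R) le_realZ. Qed.

Lemma realZ_sumZ g r : realZ (sumZ g r) = \sum_(u <- r) realZ (g u).
Proof.
elim: r => [|u r IH]; first by rewrite big_nil realZ0.
by rewrite big_cons /= realZD IH.
Qed.

Lemma le_sum_realZ (f : nat * Z -> R) g r k :
  (forall u, u \in r -> f u * k <= realZ (g u)) ->
  (\sum_(u <- r) f u) * k <= realZ (sumZ g r).
Proof.
move=> h; rewrite realZ_sumZ mulr_suml big_seq [X in _ <= X]big_seq.
exact: ler_sum.
Qed.

Lemma realZ_abs z : realZ (Z.abs z) = `|realZ z|.
Proof.
have [z0|z0] := leP 0 (realZ z).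
  rewrite ger0_norm //; congr (realZ _).
  by move: z0; rewrite -(realZ0 R) le_realZ; lia.
rewrite ltr0_norm // -realZN; congr (realZ _).
by move: (ltW z0); rewrite -(realZ0 R) le_realZ; lia.
Qed.

Lemma realZ_max0 z : realZ (Z.max z 0) = Num.max (realZ z) 0.
Proof.
case: leP => [z0|/ltW z0].
  by rewrite -(realZ0 R); congr (realZ _); move: z0; rewrite -(realZ0 R) le_realZ; lia.
by congr (realZ _); move: z0; rewrite -(realZ0 R) le_realZ; lia.
Qed.

(** The sign of [v] selects the upper or the lower bound of [ln_fact_divn]. The half-logarithm then
    always comes with [|v|], while the constant 1 occurs only in the upper bound, whence
    [Num.max v 0]. *)
Lemma weighted_ln_fact n d (v : R) : (0 < d <= n)%N ->
  v * ln (n %/ d)`!%:R <=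
    n%:R * (ln n%:R - 1) * (v / d%:R) - n%:R * (v * ln d%:R / d%:R)
    + `|v| * (ln n%:R - ln d%:R) / 2 + Num.max v 0.
Proof.
move=> dn; have [d0 dn'] := andP dn.
have dR : 0 < d%:R :> R by rewrite ltr0n.
have nR : 0 < n%:R :> R by rewrite ltr0n (leq_trans d0).
have /andP[lo hi] := ln_fact_divn dn (erefl (n%:R / d%:R : R)).
rewrite ln_div ?posrE // in lo hi.
set T := ln (n %/ d)`!%:R in lo hi *.
set x := ln (n%:R : R) in lo hi *; set y := ln (d%:R : R) in lo hi *.
have -> : n%:R * (x - 1) * (v / d%:R) - n%:R * (v * y / d%:R) =
    v * (n%:R / d%:R * (x - y) - n%:R / d%:R) by ring.
set p := n%:R / d%:R * (x - y) - n%:R / d%:R in lo hi *.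
have [v0|v0] := lerP 0 v.
  by rewrite ?ger0_norm //; have := ler_wpM2l v0 hi; lra.
by rewrite ?ltr0_norm //; have := ler_wnM2l (ltW v0) lo; lra.
Qed.

Definition cheb_weight (u : nat * Z) : R := realZ u.2 / 1000.
Definition cheb_mean_weight : R := \sum_(u <- cheb_weights) cheb_weight u / u.1%:R.
(* The rounded weights leave a tiny mean, cancelled by one more term. *)
Definition cheb_corrector : R := - (cheb_end%:R * cheb_mean_weight).
Definition cheb_all_weights : seq (nat * R) :=
  rcons [seq (u.1, cheb_weight u) | u <- cheb_weights] (cheb_end, cheb_corrector).
Definition cheb_all_steps : seq (nat * R) := [seq (u.1, cheb_weight u) | u <- cheb_steps].

Lemma table_approx i : (0 < i <= 128)%N ->
  realZ (lnlo i) <= realZ ln_scale * ln i%:R <= realZ (lnhi i).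
Proof.
move=> hi; have tE : ln_table_129 = ln_table 129.
  by vm_cast_no_check (erefl ln_table_129).
by rewrite /lnlo /lnhi tE; apply: ln_table_approx; lia.
Qed.

Lemma scale_gt0 : 0 < realZ ln_scale.
Proof. by rewrite realZ_gt0. Qed.

Lemma realZ1000 : realZ 1000 = 1000.
Proof. by rewrite -(realZ_nat R 1000). Qed.

Lemma realZ_ln_scale : realZ ln_scale = 10 ^+ 8.
Proof.
have -> : ln_scale = iter 8 (Z.mul (Z.of_nat 10)) 1 by [].
suff h k : realZ (iter k (Z.mul (Z.of_nat 10)) 1) = 10 ^+ k by exact: h.
elim: k => [|k IH]; first by rewrite realZ1.
by rewrite iterS realZM IH realZ_nat exprS.
Qed.

Lemma div_bounds a d : (0 < d)%N ->
  realZ (Z.div a (Z.of_nat d)) <= realZ a / d%:R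
    <= realZ (Z.div a (Z.of_nat d)) + 1.
Proof.
move=> d0; have dZ : Z.ltb 0 (Z.of_nat d) by lia.
rewrite -(realZ1 R) -realZD -(realZ_nat R d).
by rewrite (realZ_div_le _ _ dZ) (realZ_div_ge _ _ dZ).
Qed.

Lemma corrector_small : `|cheb_corrector| <= 1 / 1000.
Proof.
have lo : realZ (sumZ cheb_mean cheb_weights) <= cheb_mean_weight * (1000 * realZ ln_scale).
  rewrite realZ_sumZ /cheb_mean_weight mulr_suml big_seq [X in _ <= X]big_seq.
  apply: ler_sum => u /(allP cheb_weights_range)/andP[u0 _].
  have /andP[h _] := div_bounds (Z.mul u.2 ln_scale) u0.
  apply: le_trans h _; rewrite realZM /cheb_weight.
  move: (realZ u.2) (realZ ln_scale) => x y.
  by rewrite le_eqVlt; apply/orP; left; apply/eqP; field; rewrite pnatr_eq0 -lt0n.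
have hi : cheb_mean_weight * (1000 * realZ ln_scale)
    <= realZ (sumZ cheb_mean cheb_weights) + (size cheb_weights)%:R.
  rewrite realZ_sumZ /cheb_mean_weight mulr_suml.
  have -> : (size cheb_weights)%:R = \sum_(u <- cheb_weights) 1 :> R.
    by rewrite big_const_seq count_predT iter_addr_0.
  rewrite -big_split big_seq [X in _ <= X]big_seq.
  apply: ler_sum => u /(allP cheb_weights_range)/andP[u0 _].
  have /andP[_ h] := div_bounds (Z.mul u.2 ln_scale) u0.
  apply: le_trans h; rewrite realZM /cheb_weight.
  move: (realZ u.2) (realZ ln_scale) => x y.
  by rewrite le_eqVlt; apply/orP; left; apply/eqP; field; rewrite pnatr_eq0 -lt0n.
have c1 : - (5 * 1000) <= realZ (sumZ cheb_mean cheb_weights).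
  have := cheb_mean_ge; rewrite -(le_realZ R).
  have -> : (-5000)%bigZ = Z.opp (Z.mul (Z.of_nat 5) 1000) by [].
  by rewrite realZN realZM realZ1000 realZ_nat.
have c2 : realZ (sumZ cheb_mean cheb_weights) + 100 <= 5 * 1000.
  have := cheb_mean_le; rewrite -(le_realZ R).
  have -> : (5000)%bigZ = Z.mul (Z.of_nat 5) 1000 by [].
  have -> : (100)%bigZ = Z.of_nat 100 by [].
  by rewrite realZD realZM realZ1000 !realZ_nat.
have sz : (size cheb_weights)%:R <= 100 :> R.
  by rewrite ler_nat size_cheb_weights.
rewrite realZ_ln_scale in lo hi; move: (realZ (sumZ _ _)) ((size _)%:R) lo hi c1 c2 sz => p q.
rewrite /cheb_corrector normrN cheb_endE natrX => *.
by rewrite ler_norml; apply/andP; split; lra.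
Qed.

Lemma sum_weights (F : nat * R -> R) : \sum_(u <- cheb_all_weights) F u =
  \sum_(u <- cheb_weights) F (u.1, cheb_weight u) + F (cheb_end, cheb_corrector).
Proof. by rewrite /cheb_all_weights -cats1 big_cat big_map big_seq1. Qed.

Lemma sum_steps (F : nat * R -> R) : \sum_(u <- cheb_all_steps) F u =
  \sum_(u <- cheb_steps) F (u.1, cheb_weight u).
Proof. by rewrite /cheb_all_steps big_map. Qed.

Lemma mean_weights : \sum_(u <- cheb_all_weights) u.2 / u.1%:R = 0.
Proof.
have cancel (x d : R) : d != 0 -> x + - (d * x) / d = 0.
  by move=> d0; rewrite mulNr [d * x]mulrC mulfK // subrr.
rewrite sum_weights; apply: cancel.
by rewrite pnatr_eq0 -lt0n cheb_end_gt0.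
Qed.

Lemma step_range u : u \in cheb_steps -> [/\ (0 < u.1)%N, (u.1 <= cheb_end)%N & 0 <= cheb_weight u].
Proof.
move=> /(allP cheb_steps_range)/andP[/andP[u0 u1] u2]; split=> //.
by apply: divr_ge0; [rewrite realZ_ge0; exact: u2|exact: ler0n].
Qed.

(** Below [cheb_end] this is the enumeration. Beyond, [floor(y/d)] lies between [y/d - 1] and [y/d],
    and the terms [y/d] cancel as the weights have mean 0; the floor sum is then at least minus the
    sum of the positive weights, which [cheb_tail_check] covers. *)
Lemma weights_ge1 y : (0 < y)%N -> 1 <= floor_sum cheb_all_weights y + step_sum cheb_all_steps y.
Proof.
move=> y0; rewrite /floor_sum /step_sum sum_weights sum_steps /=.
have [y8|y8] := ltnP y cheb_end.
  rewrite divn_small // mulr0 addr0.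
  have := cheb_partial_sum_ge R y0 y8; rewrite realZ1000 => h.
  rewrite -(@ler_pM2r _ 1000) ?ltr0n // mul1r; apply: le_trans h _.
  rewrite mulrDl !mulr_suml le_eqVlt; apply/orP; left; apply/eqP.
  have unscale (x : R) z : x * 1000^-1 * z * 1000 = x * z.
    by rewrite mulrAC mulfVK ?pnatr_eq0.
  congr (_ + _); apply: eq_big_seq => u us; first by rewrite unscale.
  have [u0 u8 _] := step_range us; rewrite unscale; congr (_ * _%:R).
  case: leqP => uy.
    have -> : (y + (cheb_end.-1 - u.1.-1) = cheb_end + (y - u.1))%N.
      move: cheb_end_gt0 u8 uy u0; move: (cheb_end) (u.1) => c d.
      by move=> *; lia.
    by rewrite divnDl ?dvdnn // divnn cheb_end_gt0 divn_small ?(leq_ltn_trans (leq_subr _ _) y8).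
  rewrite divn_small //; move: cheb_end_gt0 u8 uy u0.
  by move: (cheb_end) (u.1) => c d *; lia.
have floor_ge (v : R) d : (0 < d)%N ->
    y%:R * (v / d%:R) - Num.max v 0 <= v * (y %/ d)%N%:R.
  move=> d0; have dR : 0 < d%:R :> R by rewrite ltr0n.
  have h1 : (y %/ d)%:R <= y%:R / d%:R :> R.
    by rewrite ler_pdivlMr // -natrM ler_nat leq_trunc_div.
  have h2 : y%:R / d%:R <= (y %/ d)%:R + 1 :> R.
    by rewrite natr1 ler_pdivrMr // -natrM ler_nat ltnW // ltn_ceil.
  have -> : y%:R * (v / d%:R) = v * (y%:R / d%:R) by ring.
  move: ((y %/ d)%:R) (y%:R / d%:R) h1 h2 => p q h1 h2.
  have [v0|/ltW v0] := lerP 0 v.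
    have := ler_wpM2l v0 h2; lra.
  have := ler_wnM2l v0 h1; lra.
have step1 : \sum_(u <- cheb_steps) cheb_weight u * (u.1 <= y)%N%:R =
    realZ (sumZ snd cheb_steps) / 1000.
  rewrite realZ_sumZ mulr_suml; apply: eq_big_seq => u /step_range[_ u8 _].
  by rewrite (leq_trans u8 y8) mulr1.
have sumP : \sum_(u <- cheb_weights) Num.max (cheb_weight u) 0 =
    realZ (sumZ cheb_pos cheb_weights) / 1000.
  have maxM (x k : R) : 0 <= k -> Num.max (x * k) 0 = Num.max x 0 * k.
    by move=> k0; rewrite maxr_pMl // mul0r.
  have c0 : 0 <= (1000^-1 : R) by rewrite invr_ge0 ler0n.
  rewrite realZ_sumZ mulr_suml; apply: eq_bigr => u _.
  by rewrite realZ_max0; exact: maxM.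
have hfloor : y%:R * 0 - (realZ (sumZ cheb_pos cheb_weights) / 1000
      + Num.max cheb_corrector 0) <=
    \sum_(u <- cheb_weights) cheb_weight u * (y %/ u.1)%N%:R
    + cheb_corrector * (y %/ cheb_end)%N%:R.
  rewrite -[X in _ * X - _]mean_weights sum_weights -sumP /= mulrDr opprD addrACA.
  apply: lerD; last exact: floor_ge cheb_end_gt0.
  rewrite mulr_sumr -sumrB big_seq [X in _ <= X]big_seq.
  by apply: ler_sum => u /(allP cheb_weights_range)/andP[u0 _]; exact: floor_ge.
have := cheb_tail_check; rewrite -(le_realZ R) realZD [realZ cheb_total_pos]realZD realZ1 realZ1000.
rewrite step1; have cmax : Num.max cheb_corrector 0 <= 1 / 1000.
  rewrite ge_max; apply/andP; split; last by rewrite divr_ge0 ?ler0n.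
  exact: le_trans (ler_norm _) corrector_small.
move: hfloor cmax; rewrite mulr0 sub0r.
move: (realZ (sumZ cheb_pos _)) (realZ (sumZ snd _)) (Num.max cheb_corrector 0) => p q c.
set S := (_ + cheb_corrector * _) => hS hc hq.
clearbody S; move: S hS hc hq; clear => S; lra.
Qed.

(** With [|cheb_corrector| <= 1/1000], [ln cheb_end <= 10] and [cheb_end >= 8000], the part in
    [ln cheb_end] costs at most [1.25 n / 10^6], which is below [13 n / 10^7]. *)
Lemma corrector_term n : (cheb_end <= n)%N ->
  cheb_corrector * ln (n %/ cheb_end)`!%:R <=
    n%:R * (ln n%:R - 1) * (cheb_corrector / cheb_end%:R)
    + n%:R * (13 / 10 ^+ 7) + ln n%:R / 2 / 1000 + 1 / 1000.
Proof.
move=> Wn; apply: le_trans (weighted_ln_fact _ (_ : 0 < cheb_end <= n)%N) _.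
  by rewrite cheb_end_gt0.
have W0 : 0 < cheb_end%:R :> R by rewrite ltr0n cheb_end_gt0.
have n0 : 0 < n%:R :> R by rewrite ltr0n (leq_trans cheb_end_gt0).
have WE : cheb_end%:R = 2 ^+ 13 :> R by rewrite cheb_endE natrX.
have ln2 : ln 2 <= 7 / 10 :> R.
  have /andP[_] := ln_approx2 R; rewrite [(_, _).2]/= realZ_ln_scale.
  have : realZ 69314722 <= realZ (Z.mul (Z.of_nat 70) (Z.mul 1000 1000)).
    by rewrite le_realZ.
  rewrite realZM realZM realZ1000 realZ_nat.
  by move: (realZ _) => z; clear; lra.
have lnW : 0 <= ln (cheb_end%:R : R) <= 10.
  apply/andP; split; first by apply: ln_ge0; rewrite ler1n cheb_end_gt0.
  rewrite WE lnXn // -[_ *+ 13]mulr_natr.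
  by move: ln2; clear; lra.
have x0 : 0 <= ln n%:R :> R by apply: ln_ge0; rewrite ler1n -(ltr0n R).
have cW : n%:R * (cheb_corrector * ln cheb_end%:R / cheb_end%:R) >= - (n%:R * (13 / 10 ^+ 7)).
  rewrite -mulrN ler_pM2l //.
  have w8 : 8000 <= cheb_end%:R :> R by rewrite WE; clear; lra.
  have := corrector_small; case/andP: lnW.
  move: (cheb_end%:R) (ln _) W0 w8 => w y w0 w8 y0 y10 c1.
  have /ler_normlP[h _] : `|cheb_corrector * y| <= 1 / 1000 * 10.
    by rewrite normrM (ger0_norm y0) ler_pM.
  rewrite lerNl -mulNr ler_pdivrMr //; apply: le_trans h _.
  by move: w8; clear; lra.
have cL : `|cheb_corrector| * (ln n%:R - ln cheb_end%:R) / 2 <= ln n%:R / 2 / 1000.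
  have := corrector_small; case/andP: lnW => + _; move: `|cheb_corrector| (normr_ge0 cheb_corrector).
  move: (ln n%:R) (ln cheb_end%:R) x0 => x y.
  clear => x0 c c0 y0 c1.
  have := ler_wpM2r x0 c1; have := mulr_ge0 c0 y0; lra.
have cM : Num.max cheb_corrector 0 <= 1 / 1000.
  rewrite ge_max; apply/andP; split; last by rewrite divr_ge0 ?ler0n.
  exact: le_trans (ler_norm _) corrector_small.
move: cW cL cM; move: (n%:R * (ln n%:R - 1) * (cheb_corrector / cheb_end%:R)) => A.
move: (n%:R * (cheb_corrector * _ / _)) (`|cheb_corrector| * _ / 2) (Num.max cheb_corrector 0).
move: (n%:R) (ln _) => x y B C D; clear; lra.
Qed.

Let cheb_unit : R := 1000 * realZ ln_scale.

Lemma le_cheb_main :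
  (\sum_(u <- cheb_weights) - (cheb_weight u * ln u.1%:R / u.1%:R)) * cheb_unit
  <= realZ (sumZ cheb_main cheb_weights).
Proof.
apply: le_sum_realZ => u /(allP cheb_weights_range) u128.
have /andP[u0 _] := u128; have /andP[lo hi] := table_approx u128.
have dR : 0 < u.1%:R :> R by rewrite ltr0n.
have -> : - (cheb_weight u * ln u.1%:R / u.1%:R) * cheb_unit =
    - realZ u.2 * (realZ ln_scale * ln u.1%:R) / u.1%:R.
  rewrite /cheb_weight /cheb_unit; move: (ln _) => c.
  move: (realZ u.2) (realZ ln_scale) (u.1%:R) dR => a b d.
  by clear; move=> d0; field; rewrite gt_eqF.
rewrite /cheb_main; case: ifP => [a0|/negbT a0].
  have a0R : 0 <= realZ u.2 by rewrite realZ_ge0.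
  have /andP[h _] := div_bounds (Z.mul u.2 (lnlo u.1)) u0.
  rewrite realZN mulNr mulNr lerN2; apply: le_trans h _.
  by rewrite realZM ler_pM2r ?invr_gt0 // ler_wpM2l.
have a0R : 0 <= - realZ u.2 by rewrite -realZN realZ_ge0; move: a0; lia.
have /andP[_ h] := div_bounds (Z.mul (Z.opp u.2) (lnhi u.1)) u0.
rewrite realZD realZ1; apply: le_trans h; rewrite realZM realZN.
by rewrite ler_pM2r ?invr_gt0 // ler_wpM2l.
Qed.

Lemma le_cheb_abs_ln : realZ (sumZ cheb_abs_ln cheb_weights) <=
  (\sum_(u <- cheb_weights) `|cheb_weight u| * ln u.1%:R) * cheb_unit.
Proof.
rewrite realZ_sumZ mulr_suml big_seq [X in _ <= X]big_seq.
apply: ler_sum => u /(allP cheb_weights_range) u128.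
have /andP[lo _] := table_approx u128.
rewrite /cheb_abs_ln realZM realZ_abs /cheb_weight normrM (ger0_norm (_ : 0 <= 1000^-1)); last first.
  by rewrite invr_ge0 ler0n.
have -> : `|realZ u.2| / 1000 * ln u.1%:R * cheb_unit =
    `|realZ u.2| * (realZ ln_scale * ln u.1%:R).
  rewrite /cheb_unit; move: `|realZ u.2| (realZ ln_scale) (ln _) => a b c.
  by clear; field.
by rewrite ler_wpM2l.
Qed.

Let unscale (x : R) : x / 1000 * 1000 = x.
Proof. by rewrite mulfVK ?pnatr_eq0. Qed.

Lemma cheb_absE :
  (\sum_(u <- cheb_weights) `|cheb_weight u|) * 1000 = realZ (sumZ cheb_abs cheb_weights).
Proof.
rewrite realZ_sumZ mulr_suml; apply: eq_bigr => u _.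
rewrite /cheb_abs realZ_abs /cheb_weight normrM (ger0_norm (_ : 0 <= 1000^-1)); last first.
  by rewrite invr_ge0 ler0n.
exact: unscale.
Qed.

Lemma cheb_posE :
  (\sum_(u <- cheb_weights) Num.max (cheb_weight u) 0) * 1000 =
  realZ (sumZ cheb_pos cheb_weights).
Proof.
have maxM (x k : R) : 0 <= k -> Num.max (x * k) 0 = Num.max x 0 * k.
  by move=> k0; rewrite maxr_pMl // mul0r.
rewrite realZ_sumZ mulr_suml; apply: eq_bigr => u _.
rewrite /cheb_pos realZ_max0 /cheb_weight maxM; last by rewrite invr_ge0 ler0n.
exact: unscale.
Qed.

Lemma le_cheb_step : (\sum_(u <- cheb_steps) cheb_weight u / u.1%:R) * cheb_unit <=
  realZ (sumZ cheb_step cheb_steps).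
Proof.
apply: le_sum_realZ => u /step_range[u0 _ _].
have /andP[_ h] := div_bounds (Z.mul u.2 ln_scale) u0.
rewrite /cheb_step realZD realZ1; apply: le_trans h; rewrite realZM /cheb_weight /cheb_unit.
have dR : 0 < u.1%:R :> R by rewrite ltr0n.
rewrite le_eqVlt; apply/orP; left; apply/eqP.
move: (realZ u.2) (realZ ln_scale) (u.1%:R) dR => a b d.
by clear; move=> d0; field; rewrite gt_eqF.
Qed.

End ChebyshevWeights.

Lemma cheb_steps_gt1 : all (fun u => 1 < u.1)%N cheb_steps.
Proof. by vm_cast_no_check (erefl true). Qed.

(** * The induction for psi(n) <= 1.03883 n *)

Section PsiLe.
Variable R : realType.
Notation realZ := (realZ R).
Notation psi := (psi R).

Lemma rs_const_ge0 : 0 <= rs_const R.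
Proof.
apply: addr_ge0; first exact: ler01.
by apply: divr_ge0; [exact: ler0n|apply: exprn_ge0; exact: ler0n].
Qed.

Definition weights_main : R := \sum_(u <- cheb_weights) - (cheb_weight R u * ln u.1%:R / u.1%:R).
Definition weights_total : R := \sum_(u <- cheb_weights) `|cheb_weight R u|.
Definition weights_total_ln : R := \sum_(u <- cheb_weights) `|cheb_weight R u| * ln u.1%:R.
Definition weights_positive : R := \sum_(u <- cheb_weights) Num.max (cheb_weight R u) 0.
Definition steps_mean : R := \sum_(u <- cheb_steps) cheb_weight R u / u.1%:R.

(** Mean 0 removes the [n ln n] terms of Stirling's formula; a linear and a logarithmic term
    remain. *)
Lemma weights_sum_le n : (cheb_end <= n)%N ->
  \sum_(u <- cheb_all_weights R) u.2 * ln (n %/ u.1)`!%:R <=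
  n%:R * (weights_main + 13 / 10 ^+ 7) + (weights_total + 1 / 1000) * ln n%:R / 2
  - weights_total_ln / 2 + (weights_positive + 1 / 1000).
Proof.
move=> Wn; have h128 : (128 <= n)%N by apply: leq_trans Wn; rewrite cheb_endE.
have hcheb : \sum_(u <- cheb_weights) cheb_weight R u * ln (n %/ u.1)`!%:R <=
    n%:R * (ln n%:R - 1) * (\sum_(u <- cheb_weights) cheb_weight R u / u.1%:R)
    + n%:R * weights_main + weights_total * (ln n%:R / 2) - weights_total_ln / 2 + weights_positive.
  rewrite /weights_main /weights_total /weights_total_ln /weights_positive !(mulr_sumr, mulr_suml) -sumrN -!big_split /=.
  rewrite big_seq [X in _ <= X]big_seq; apply: ler_sum => u.
  move=> /(allP cheb_weights_range)/andP[u0 u128].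
  apply: le_trans (weighted_ln_fact _ (_ : 0 < u.1 <= n)%N) _.
    by rewrite u0 (leq_trans u128).
  rewrite le_eqVlt; apply/orP; left; apply/eqP.
  move: (ln n%:R) (ln u.1%:R) => a b.
  move: `|cheb_weight R u| (Num.max (cheb_weight R u) 0) => e f.
  move: (n%:R) (u.1%:R^-1) (cheb_weight R u) => c d g.
  by clear; field.
have hcor := corrector_term R Wn.
have := mean_weights R; rewrite !sum_weights /= => mw.
apply: le_trans (lerD hcheb hcor) _.
have : n%:R * (ln n%:R - 1) * (\sum_(u <- cheb_weights) cheb_weight R u / u.1%:R
  + cheb_corrector R / cheb_end%:R) = 0 by rewrite mw mulr0.
rewrite mulrDr.
move: (n%:R * (ln n%:R - 1) * \sum_(u <- cheb_weights) cheb_weight R u / u.1%:R).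
move: (n%:R * (ln n%:R - 1) * (cheb_corrector R / cheb_end%:R)).
move=> z t; move: (ln n%:R) => x; move: weights_main weights_total weights_total_ln weights_positive => a b c d.
move: (n%:R) => y; clear; lra.
Qed.

Lemma steps_sum_le n (c : R) : (forall k, (k < n)%N -> psi k <= c * k%:R) ->
  0 <= c -> (0 < n)%N ->
  \sum_(u <- cheb_all_steps R) u.2 * psi (n %/ u.1) <= n%:R * (c * steps_mean).
Proof.
move=> IH c0 n0; rewrite sum_steps /steps_mean !mulr_sumr.
rewrite big_seq [X in _ <= X]big_seq; apply: ler_sum => u us /=.
have [u0 u8 w0] := step_range R us.
have u1 := allP cheb_steps_gt1 _ us.
have -> : n%:R * (c * (cheb_weight R u / u.1%:R)) = cheb_weight R u * (c * (n%:R / u.1%:R)).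
  move: (n%:R) (cheb_weight R u) (u.1%:R^-1) => x y z; clear; ring.
rewrite ler_wpM2l //; apply: le_trans (IH _ (ltn_Pdiv u1 n0)) _.
by rewrite ler_wpM2l // ler_pdivlMr ?ltr0n // -natrM ler_nat leq_trunc_div.
Qed.

(* By concavity [ln n <= ln X + n / X - 1], and what remains is affine in [n]. *)
Lemma line_ln_le0 (X n s l t b : R) : 0 < X -> X <= n ->
  2 * X * s + l <= 0 -> 2 * X * s + l * t + 2 * b <= 0 ->
  n * s + l * (t + n / X - 1) / 2 + b <= 0.
Proof.
move=> X0 Xn h1 h2.
have -> : n * s + l * (t + n / X - 1) / 2 + b =
    ((2 * X * s + l * t + 2 * b) + (n - X) / X * (2 * X * s + l)) / 2.
  by field; rewrite gt_eqF.
have : (n - X) / X * (2 * X * s + l) <= 0.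
  by rewrite mulr_ge0_le0 // divr_ge0 ?subr_ge0 // ltW.
by move=> h3; rewrite pmulr_lle0 ?invr_gt0 // (le_trans (lerD h2 h3)) ?addr0.
Qed.

Local Notation k := (10 ^+ 8 : R).

Lemma realZ_e3 : realZ 1000 = 10 ^+ 3.
Proof. by rewrite (realZ1000 R); ring. Qed.

Lemma realZ_e5 : realZ 100000 = 10 ^+ 5.
Proof.
have h := realZM R 1000 (Z.of_nat 100); rewrite realZ_e3 realZ_nat in h.
by apply: (etrans h); ring.
Qed.

Lemma realZ_130000 : realZ 130000 = 13 * 10 ^+ 4.
Proof.
have h := realZM R 1000 (Z.of_nat 130); rewrite realZ_e3 realZ_nat in h.
by apply: (etrans h); ring.
Qed.

Lemma realZ_32768 : realZ 32768 = 2 * 2 ^+ 14.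
Proof.
have h := realZM R (Z.of_nat 128) (Z.of_nat 256); rewrite !realZ_nat in h.
by apply: (etrans h); ring.
Qed.

Lemma realZ_103883 : realZ 103883 = 10 ^+ 5 * rs_const R.
Proof.
have h := realZD R 100000 (Z.of_nat 3883); rewrite realZ_e5 realZ_nat in h.
by apply: (etrans h); rewrite /rs_const; field.
Qed.

Lemma realZ_cheb_slope zm zs sc : realZ sc = k ->
  realZ (Z.sub (Z.add (Z.mul 100000 (Z.add zm 130000)) (Z.mul 103883 zs))
    (Z.mul 103883 (Z.mul 1000 sc))) =
  10 ^+ 5 * (realZ zm + 13 * 10 ^+ 4) + 10 ^+ 5 * rs_const R * realZ zs
  - 10 ^+ 5 * rs_const R * (10 ^+ 3 * k).
Proof. by move=> scE; rewrite realZB realZD !realZM realZD realZ_e5 realZ_130000 realZ_103883 realZ_e3 scE. Qed.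

Lemma slope_ge zm zs sc (a b : R) : realZ sc = k ->
  a * (1000 * k) <= realZ zm -> b * (1000 * k) <= realZ zs ->
  (a + 13 / 10 ^+ 7 + rs_const R * b - rs_const R) * (10 ^+ 5 * (1000 * k)) <=
  realZ (Z.sub (Z.add (Z.mul 100000 (Z.add zm 130000)) (Z.mul 103883 zs))
    (Z.mul 103883 (Z.mul 1000 sc))).
Proof.
move=> scE h1 h2; rewrite realZ_cheb_slope //.
have c0 := rs_const_ge0.
have := ler_wpM2l c0 h2; move: (realZ zm) (realZ zs) (rs_const R) h1 c0 => x y c.
by clear => h1 c0 h2'; lra.
Qed.

Lemma slope_le_of_check sl za sc (s l : R) : realZ sc = k ->
  s * (10 ^+ 5 * (1000 * k)) <= realZ sl -> l * 1000 = realZ za ->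
  Z.leb (Z.add (Z.mul 32768 sl) (Z.mul 100000 (Z.mul za sc))) 0 ->
  2 * 2 ^+ 14 * s + l <= 0.
Proof.
move=> scE h1 h2; rewrite -(le_realZ R) realZ0 realZD !realZM realZ_32768 realZ_e5 scE -h2.
by move: (realZ sl) h1 => x; clear => h1 h3; lra.
Qed.

Lemma value_le_of_check sl za zp zl h2 sc (s l b q : R) : realZ sc = k ->
  s * (10 ^+ 5 * (1000 * k)) <= realZ sl -> l * 1000 = realZ za -> 0 <= l ->
  b * 1000 = realZ zp -> realZ zl <= q * (1000 * k) -> k * ln 2 <= realZ h2 ->
  Z.leb (Z.add (Z.mul 32768 sl)
    (Z.mul 100000 (Z.add (Z.mul za (Z.mul 14 h2)) (Z.sub (Z.mul 2 (Z.mul zp sc)) zl)))) 0 ->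
  2 * 2 ^+ 14 * s + l * (14 * ln 2) + 2 * (b - q / 2) <= 0.
Proof.
move=> scE h1 hl l0 hb hq hln.
have e14 : realZ 14 = 14 by rewrite -(realZ_nat R 14).
rewrite -(le_realZ R) realZ0 realZD !realZM realZD realZB !realZM realZ2 realZ_32768 realZ_e5 e14 scE.
rewrite -hl -hb; have := ler_wpM2l l0 hln.
move: (realZ sl) (realZ zl) (realZ h2) (ln 2) h1 hq => x y z w.
by clear => h1 hq hln h; lra.
Qed.

Lemma cheb_total_absE : (weights_total + 1 / 1000) * 1000 = realZ cheb_total_abs.
Proof.
rewrite /cheb_total_abs realZD realZ1 -(cheb_absE R) -/weights_total.
by move: weights_total; clear => x; field.
Qed.

Lemma cheb_total_posE : (weights_positive + 1 / 1000) * 1000 = realZ cheb_total_pos.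
Proof.
rewrite /cheb_total_pos realZD realZ1 -(cheb_posE R) -/weights_positive.
by move: weights_positive; clear => x; field.
Qed.

Lemma weights_total_ge0 : 0 <= weights_total + 1 / 1000.
Proof.
apply: addr_ge0; first by apply: sumr_ge0 => u _; exact: normr_ge0.
by apply: divr_ge0; [exact: ler01|exact: ler0n].
Qed.

(** The first hypothesis of [line_ln_le0] at [X = 2^14]; [value_le] is the second, with
    [ln X = 14 ln 2]. *)
Lemma slope_le : 2 * 2 ^+ 14 * (weights_main + 13 / 10 ^+ 7 + rs_const R * steps_mean
    - rs_const R) + (weights_total + 1 / 1000) <= 0.
Proof.
apply: slope_le_of_check cheb_total_absE cheb_slope_check; first exact: realZ_ln_scale.
by apply: slope_ge; [exact: realZ_ln_scale|rewrite -realZ_ln_scale; exact: le_cheb_main|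
  rewrite -realZ_ln_scale; exact: le_cheb_step].
Qed.

Lemma value_le : 2 * 2 ^+ 14 * (weights_main + 13 / 10 ^+ 7 + rs_const R * steps_mean
    - rs_const R) + (weights_total + 1 / 1000) * (14 * ln 2)
  + 2 * (weights_positive + 1 / 1000 - weights_total_ln / 2) <= 0.
Proof.
apply: value_le_of_check cheb_total_absE _ cheb_total_posE _ _ cheb_value_check.
- exact: realZ_ln_scale.
- by apply: slope_ge; [exact: realZ_ln_scale|rewrite -realZ_ln_scale; exact: le_cheb_main|
    rewrite -realZ_ln_scale; exact: le_cheb_step].
- exact: weights_total_ge0.
- by rewrite -realZ_ln_scale; exact: le_cheb_abs_ln.
- by have /andP[_] := table_approx R (isT : 0 < 2 <= 128)%N; rewrite realZ_ln_scale.
Qed.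

(** In Chebyshev's bound the values of [psi] at smaller arguments are controlled by induction.
    Replacing [ln n] by its tangent at [2^14] makes the rest affine in [n], and [line_ln_le0]
    concludes. *)
Lemma psi_le_step n : (128 * 2 ^ 7 < n)%N ->
  (forall k, (k < n)%N -> psi k <= rs_const R * k%:R) ->
  psi n <= rs_const R * n%:R.
Proof.
move=> nX IH; have XE : (128 * 2 ^ 7 = 2 ^ 14)%N by [].
have n0 : (0 < n)%N by apply: leq_trans nX.
have Wn : (cheb_end <= n)%N.
  by rewrite cheb_endE (leq_trans _ (ltnW nX)) // XE leq_exp2l.
have c0 := rs_const_ge0.
have h := @psi_le_chebyshev R (cheb_all_weights R) (cheb_all_steps R) n n0.
apply: le_trans (h _ _ _) _; first 1 last.
- by move=> u /mapP[v /(step_range R)[v0 _ _] ->].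
- exact: weights_ge1.
- apply: le_trans (lerD (weights_sum_le Wn) (steps_sum_le IH c0 n0)) _.
  have lnX : ln n%:R <= 14 * ln 2 + n%:R / 2 ^+ 14 - 1 :> R.
    have X0 : 0 < 2 ^+ 14 :> R by rewrite exprn_gt0.
    have nR : 0 < n%:R :> R by rewrite ltr0n.
    have := @le_ln1Dx R (n%:R / 2 ^+ 14 - 1).
    rewrite (_ : 1 + (n%:R / 2 ^+ 14 - 1) = n%:R / 2 ^+ 14); last by ring.
    rewrite ln_div ?posrE // lnXn // -[_ *+ 14]mulr_natl.
    have : 0 < n%:R / 2 ^+ 14 :> R by rewrite divr_gt0.
    move: (n%:R / 2 ^+ 14) (ln n%:R) (ln 2) => x y z; clear => x0 hx.
    have := hx _; lra.
  have X0 : 0 < 2 ^+ 14 :> R by apply: exprn_gt0; exact: ltr0n.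
  have Xn : 2 ^+ 14 <= n%:R :> R by rewrite -natrX ler_nat -XE ltnW.
  have hl := line_ln_le0 X0 Xn slope_le value_le.
  have h2 := ler_wpM2l weights_total_ge0 lnX.
  move: (2 ^+ 14) (ln 2) (ln n%:R) hl h2 => X y z.
  move: weights_total weights_total_ln weights_positive weights_main steps_mean.
  move: (n%:R) (rs_const R) => x c t1 t2 p a b.
  clear => hl h2; lra.
by move=> u; rewrite /cheb_all_weights mem_rcons in_cons => /predU1P[->|/mapP[v vr ->]] /=;
  [exact: cheb_end_gt0|by case/andP: (allP cheb_weights_range _ vr)].
Qed.

Lemma psi_le n : psi n <= rs_const R * n%:R.
Proof.
have [k] := ubnP n; elim: k n => // k IH n; rewrite ltnS => nk.
case: (leqP n (128 * 2 ^ 7)) => [|nX]; first exact: psi_le_small.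
by apply: psi_le_step nX _ => j jn; apply: IH; apply: leq_trans jn nk.
Qed.

Lemma lcm_upto_le_expR n : (lcm_upto n)%:R <= expR (rs_const R * n%:R).
Proof.
have L0 : 0 < (lcm_upto n)%:R :> R by rewrite ltr0n lcm_upto_gt0.
rewrite -[X in X <= _](@lnK R); last by rewrite posrE.
by rewrite ler_expR; exact: psi_le.
Qed.
End PsiLe.

(** * Size and denominators of the approximations *)

(** By Pascal's rule, an inner entry of row [n] is the sum of two distinct entries of row [n - 1],
    which sums to [2^(n-1)]. The factor 2 saved here gives the [2^(m-1)] of the theorem. *)
Lemma bin_le_exp2 n k : (0 < n)%N -> ('C(n, k) <= 2 ^ n.-1)%N.
Proof.
case: n => // n _; case: k => [|k]; first by rewrite bin0 expn_gt0.
have bin_sum : (\sum_(i < n.+1) 'C(n, i) = 2 ^ n)%N.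
  by rewrite -[2%N]/((1 + 1)%N) expnDn; apply: eq_bigr => i _; rewrite !exp1n !muln1.
rewrite /= -bin_sum binS.
have [kn|nk] := ltnP k n; last first.
  rewrite (@bin_small _ k.+1) ?ltnS // add0n.
  have [->|kn] := eqVneq k n; last by rewrite bin_small // ltn_neqAle eq_sym kn.
  by rewrite (bigD1 ord_max) //= leq_addr.
rewrite (bigD1 (inord k.+1)) // (bigD1 (inord k)) /=.
  by rewrite !inordK ?ltnS ?(ltnW kn) // addnA leq_addr.
by rewrite -val_eqE /= !inordK ?ltnS ?(ltnW kn) // neq_ltn leqnn.
Qed.

Section Majorant.
Variable F : realFieldType.
Implicit Types p q : {poly F}.

Lemma coefM_majorant p q p' q' : (forall i, `|p`_i| <= q`_i) ->
  (forall i, `|p'`_i| <= q'`_i) -> forall i, `|(p * p')`_i| <= (q * q')`_i.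
Proof.
move=> pq pq' i; rewrite !coefM (le_trans (ler_norm_sum _ _ _)) //.
by apply: ler_sum => j _; rewrite normrM ler_pM.
Qed.

Lemma coef_node_poly_majorant m (alpha : 'I_m -> F) M l :
  (forall i, `|alpha i| <= M) ->
  forall i, `|(node_poly alpha ^+ l)`_i| <= (('X + M%:P) ^+ (m * l))`_i.
Proof.
have one i : `|(1 : {poly F})`_i| <= (1 : {poly F})`_i.
  by rewrite coef1 normr_nat.
move=> aM; have h i : `|(node_poly alpha)`_i| <= (('X + M%:P) ^+ m)`_i.
  rewrite /node_poly -[in leRHS](card_ord m) -prodr_const.
  elim/big_rec2: _ i => // j p q _ IH i; apply: coefM_majorant => // k.
  rewrite coefB coefD !coefX !coefC; case: k => [|[|k]] //=.
  - by rewrite !add0r normrN.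
  - by rewrite subr0 addr0 normr1.
  - by rewrite subr0 addr0 normr0.
elim: l => [|l IH] i; first by rewrite muln0 !expr0.
by rewrite mulnS exprD exprS; apply: coefM_majorant.
Qed.

End Majorant.

Section Functional.
Variables (F : realFieldType) (m : nat) (alpha : 'I_m -> F).
Variables (phi : {scalar {poly F}}).

Lemma padeE l mu : pade alpha l mu = \sum_(s < (m * l).+1)
  ((node_poly alpha ^+ l)`_s *+ 'C(l + (s + mu), l)) *: 'X^(s + mu).
Proof.
rewrite /pade; set W := node_poly alpha ^+ l.
rewrite [in LHS](_ : W = \sum_(s < (m * l).+1) W`_s *: 'X^s).
  rewrite mulr_sumr linear_sum /=; apply: eq_bigr => s _.
  rewrite -scalerAr linearZ /= -scalerMnl scalerMnr; congr (_ *: _).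
  rewrite -exprD addnC; apply/polyP => i; rewrite coef_legendre coefMn !coefXn.
  by case: eqVneq => [->|]//; rewrite !mul0rn.
by rewrite -[LHS]coefK poly_def size_node_poly_exp.
Qed.

(** Serves both evaluation at -1, with [t = 1], and integration of the quotient, with [t = M]. The
    binomials are at most [2^(l+m-1) 2^s]; the factor [2^s] turns [t] into [2 t], at which the
    majorant [(X + M)^(ml)] is evaluated. *)
Lemma pade_functional_le l mu M E t : (1 <= m)%N -> (1 <= l)%N -> (mu <= m)%N ->
  (forall i, `|alpha i| <= M) -> 0 <= t ->
  (forall s, (s <= m * l)%N -> `|phi 'X^(s + mu)| <= E * t ^+ s) ->
  `|phi (pade alpha l mu)| <= 2 ^+ (l + m).-1 * E * (2 * t + M) ^+ (m * l).
Proof.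
move=> m1 l1 mum aM t0 phiX.
have E0 : 0 <= E by have := phiX 0%N isT; rewrite mulr1; apply: le_trans.
rewrite padeE linear_sum (le_trans (ler_norm_sum _ _ _)) //.
have -> : (2 * t + M) ^+ (m * l) =
    \sum_(s < (m * l).+1) (('X + M%:P) ^+ (m * l))`_s * (2 * t) ^+ s.
  have -> : 2 * t + M = ('X + M%:P).[2 * t] by rewrite !hornerE.
  rewrite -horner_exp.
  rewrite horner_coef (_ : size _ = (m * l).+1) //.
  have := size_exp ('X + M%:P) (m * l); rewrite size_XaddC /= mul1n => e.
  by rewrite -[in RHS]e prednK // size_poly_gt0 expf_neq0 // monic_neq0 ?monicXaddC.
rewrite mulr_sumr; apply: ler_sum => s _.
rewrite linearZ /= normrM normrMn -[`|_| *+ _]mulr_natr.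
have sml : (s <= m * l)%N by rewrite -ltnS.
have /(ler_pM (normr_ge0 _) (normr_ge0 _) (coef_node_poly_majorant l aM s)) := phiX _ sml.
move=> h; rewrite mulrAC.
apply: (@le_trans _ _ ((('X + M%:P) ^+ (m * l))`_s * (E * t ^+ s)
    * 2 ^+ ((l + m).-1 + s))); last first.
  rewrite [(2 * t) ^+ s]exprMn exprD.
  by move: (_`_s) (2 ^+ s) (2 ^+ _) (t ^+ s) => *; rewrite le_eqVlt; apply/orP; left; apply/eqP; ring.
apply: ler_pM; rewrite ?mulr_ge0 // -natrX ler_nat.
rewrite (leq_trans (bin_le_exp2 _ _)) //; first by rewrite addn_gt0 l1.
by rewrite leq_exp2l //; lia.
Qed.

(* Applied with [c = Q] and integers, and with [c = alpha_i ^ -1] and [p]-adic integers. *)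
Lemma coef_node_poly_in (S : subringClosed F) l c s :
  c != 0 -> (forall i, c * alpha i \in S) -> (s <= m * l)%N ->
  c ^+ (m * l - s) * (node_poly alpha ^+ l)`_s \in S.
Proof.
move=> c0 ca sml; pose V := node_poly (fun i => c * alpha i) ^+ l.
have VS : V \is a polyOver S.
  by rewrite rpredX // rpred_prod // => i _; rewrite polyOverXsubC.
(* Homogeneity: multiplying the roots by [c] multiplies the coefficient of index [s] by
   [c^(ml - s)]. *)
have VE : V \Po (c *: 'X) = c ^+ (m * l) *: node_poly alpha ^+ l.
  rewrite /V rmorphXn /= exprM -exprZn; congr (_ ^+ l).
  rewrite /node_poly rmorph_prod /= (_ : c ^+ m = \prod_(i < m) c); last first.
    by rewrite prodr_const card_ord.
  rewrite -scaler_prod; apply: eq_bigr => i _.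
  by rewrite rmorphB /= comp_polyX comp_polyC scalerBr polyCM mul_polyC.
suff -> : c ^+ (m * l - s) * (node_poly alpha ^+ l)`_s = V`_s by exact/polyOverP.
have cs : c ^+ s != 0 by rewrite expf_neq0.
apply: (mulfI cs); rewrite mulrA -exprD subnKC // -coefZ -VE comp_polyE coef_sum.
under eq_bigr do rewrite exprZn scalerA coefZ coefXn.
rewrite /V size_node_poly_exp; have sml' : (s < (m * l).+1)%N by [].
rewrite (bigD1 (Ordinal sml')) //= eqxx mulr1 mulrC big1 ?addr0 //.
by move=> i; rewrite -val_eqE /= eq_sym => /negbTE ->; rewrite mulr0.
Qed.

Lemma pade_functional_in (S : subringClosed F) l mu c D :
  c != 0 -> (forall i, c * alpha i \in S) ->
  (forall s, (s <= m * l)%N -> D * c ^- (m * l - s) * phi 'X^(s + mu) \in S) ->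
  D * phi (pade alpha l mu) \in S.
Proof.
move=> c0 ca phiX; rewrite padeE linear_sum mulr_sumr rpred_sum // => s _.
have sml : (s <= m * l)%N by rewrite -ltnS.
rewrite linearZ /=; set W := _`_s; set X := phi _.
rewrite (_ : _ * _ =
    D * c ^- (m * l - s) * X * ((c ^+ (m * l - s) * W) *+ 'C(l + (s + mu), l))).
  by rewrite rpredM ?rpredMn ?phiX ?coef_node_poly_in.
have cs : c ^+ (m * l - s) != 0 by rewrite expf_neq0.
by field.
Qed.

End Functional.

Section Size.
Variables (F : realFieldType) (m : nat) (alpha : 'I_m -> F) (M : F).
Hypotheses (m_ge1 : (1 <= m)%N) (M_gt1 : 1 < M) (alphaM : forall i, `|alpha i| <= M).

Let M_gt0 : 0 < M. Proof. exact: lt_trans M_gt1. Qed.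

Lemma pade_m1_le l mu : (1 <= l)%N -> (mu <= m)%N ->
  `|(pade alpha l mu).[-1]| <=
  2 ^+ (l + m).-1 * (M ^+ m.+1 / (M - 1)) * (3 * M) ^+ (m * l).
Proof.
move=> l1 mum.
have phiX s : (s <= m * l)%N -> `|horner_eval (-1) ('X^(s + mu) : {poly F})| <= 1 * 1 ^+ s.
  by move=> _; rewrite /horner_eval hornerXn normrX normrN1 !expr1n mulr1.
apply: le_trans (pade_functional_le m_ge1 l1 mum alphaM ler01 phiX) _.
rewrite !mulr1; apply: ler_pM; rewrite ?mulr_ge0 ?exprn_ge0 ?addr_ge0 ?(ltW M_gt0) //.
  (* The factor [M^(m+1) / (M - 1) >= 1] is inserted to share one bound with the integrals. *)
  rewrite ler_peMr ?exprn_ge0 // ler_pdivlMr ?subr_gt0 // mul1r.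
  rewrite lerBlDr (le_trans (ler_eXnr (isT : (0 < m.+1)%N) (ltW M_gt1))) //.
  by rewrite lerDl.
by rewrite lerXn2r ?nnegrE //; move: M_gt1; lra.
Qed.

(** The integral is a signed sum of the [alpha_i^j / j] for [1 <= j <= n], dominated by a geometric
    sum of ratio [M]. *)
Lemma poly_integral_quotient_Xn_le i n :
  `|poly_integral (alpha i) (quotient_at_m1 'X^n)| <= M ^+ n.+1 / (M - 1).
Proof.
rewrite quotient_at_m1_Xn linear_sum (le_trans (ler_norm_sum _ _ _)) //.
apply: (@le_trans _ _ (\sum_(i < n) M ^+ (n.-1 - i).+1)).
  apply: ler_sum => k _; rewrite linearZ /= normrM normrX normrN1 expr1n mul1r.
  rewrite poly_integral_Xn normrM normfV normr_nat ler_pdivrMr ?ltr0n //.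
  rewrite normrX (le_trans (lerXn2r _ _ _ (alphaM i))) ?nnegrE ?(ltW M_gt0) //.
  by rewrite ler_peMr ?exprn_ge0 ?(ltW M_gt0) // ler1n.
rewrite (reindex_inj rev_ord_inj) /=.
rewrite (eq_bigr (fun i : 'I_n => M * M ^+ i)); last first.
  move=> k _; rewrite -exprS; congr (_ ^+ _.+1); move: (ltn_ord k); lia.
rewrite -mulr_sumr ler_pdivlMr ?subr_gt0 // mulrAC -mulrA -subrX1 exprS.
by rewrite ler_pM2l // lerBlDr lerDl.
Qed.

Lemma pade_integral_le l mu i : (1 <= l)%N -> (mu <= m)%N ->
  `|poly_integral (alpha i) (quotient_at_m1 (pade alpha l mu))| <=
  2 ^+ (l + m).-1 * (M ^+ m.+1 / (M - 1)) * (3 * M) ^+ (m * l).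
Proof.
move=> l1 mum.
have phiX s : (s <= m * l)%N -> `|(poly_integral (alpha i) \o @quotient_at_m1 F) 'X^(s + mu)|
    <= M ^+ mu.+1 / (M - 1) * M ^+ s.
  move=> _; rewrite /= (le_trans (poly_integral_quotient_Xn_le _ _)) //.
  by rewrite -addnS addnC exprD mulrAC.
apply: le_trans (pade_functional_le m_ge1 l1 mum alphaM (ltW M_gt0) phiX) _.
rewrite (_ : 2 * M + M = 3 * M); last by ring.
rewrite ler_wpM2r ?exprn_ge0 ?mulr_ge0 ?(ltW M_gt0) // ler_wpM2l ?exprn_ge0 //.
by rewrite ler_wpM2r ?invr_ge0 ?subr_ge0 ?(ltW M_gt1) // ler_weXn2l // ltW.
Qed.

Lemma pade_form_le (lambda : 'I_m.+1 -> F) (H : F) l mu : (1 <= l)%N -> (mu <= m)%N ->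
  (forall i, `|lambda i| <= H) ->
  `|pade_form alpha lambda (pade alpha l mu)| <=
  H * m.+1%:R * (2 ^+ (l + m).-1 * (M ^+ m.+1 / (M - 1)) * (3 * M) ^+ (m * l)).
Proof.
move=> l1 mum lH; set K := 2 ^+ _ * _ * _.
rewrite /pade_form (le_trans (ler_normB _ _)) //.
have -> : H * m.+1%:R * K = H * K + \sum_(i < m) H * K.
  by rewrite sumr_const card_ord -[_ *+ m]mulr_natr -natr1; ring.
rewrite lerD //; first by rewrite normrM ler_pM ?pade_m1_le.
rewrite (le_trans (ler_norm_sum _ _ _)) //; apply: ler_sum => i _.
by rewrite normrM ler_pM ?pade_integral_le.
Qed.
End Size.

Section Denominators.
Variables (m : nat) (alpha : 'I_m -> rat) (Q : int).
Hypotheses (Q_neq0 : Q != 0) (Qalpha : forall i, Q%:~R * alpha i \is a Num.int).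

(** The quotient has degree below [m (l + 1)], so integrating it divides by integers up to
    [m (l + 1)] only. Of the powers of [Q], [ml - s] clear the coefficient of index [s] of [w^l] and
    [s + m] remain for the powers of [alpha_i]. *)
Definition pade_denom l : int := (lcm_upto (m * l.+1))%:R * Q ^+ (m * l.+1).

Let c : rat := Q%:~R.
Let c0 : c != 0. Proof. by rewrite intr_eq0. Qed.
Let denomE l : (pade_denom l)%:~R = (lcm_upto (m * l.+1))%:R * c ^+ (m * l.+1).
Proof. by rewrite rmorphM /= rmorphXn /= rmorph_nat. Qed.

Let denom_split l s : (s <= m * l)%N ->
  (pade_denom l)%:~R * c ^- (m * l - s) = (lcm_upto (m * l.+1))%:R * c ^+ (s + m).
Proof.
move=> sml; rewrite denomE -mulrA; congr (_ * _).
rewrite (_ : (m * l.+1 = (s + m) + (m * l - s))%N); last by rewrite mulnS; lia.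
by rewrite exprD mulfK // expf_neq0.
Qed.

Lemma pade_m1_int l mu : (mu <= m)%N ->
  (pade_denom l)%:~R * (pade alpha l mu).[-1] \is a Num.int.
Proof.
move=> mum; rewrite -[_.[-1]]/(horner_eval (-1) _).
apply: (pade_functional_in c0 Qalpha) => s sml.
rewrite denom_split // /= /horner_eval hornerXn.
by rewrite !rpredM ?rpred_nat ?rpredX ?rpredN ?rpred1 // intr_int.
Qed.

Lemma pade_integral_int l mu i : (mu <= m)%N ->
  (pade_denom l)%:~R * poly_integral (alpha i) (quotient_at_m1 (pade alpha l mu))
    \is a Num.int.
Proof.
move=> mum; rewrite -[poly_integral _ _]/((poly_integral (alpha i) \o @quotient_at_m1 rat) _).
apply: (pade_functional_in c0 Qalpha) => s sml.
rewrite denom_split //= quotient_at_m1_Xn linear_sum mulr_sumr.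
rewrite rpred_sum // => k _; rewrite linearZ /= poly_integral_Xn.
set n := ((s + mu).-1 - k)%N.
have nle : (n.+1 <= m * l.+1)%N.
  by have := ltn_ord k; rewrite /n mulnS; lia.
have nsm : (n.+1 <= s + m)%N by have := ltn_ord k; rewrite /n; lia.
have /dvdnP[d dE] : (n.+1 %| lcm_upto (m * l.+1))%N by rewrite dvdn_lcm_upto.
have -> : (lcm_upto (m * l.+1))%:R * c ^+ (s + m)
   * ((-1) ^+ k * (alpha i ^+ n.+1 / n.+1%:R)) =
   d%:R * c ^+ (s + m - n.+1) * (-1) ^+ k * (c * alpha i) ^+ n.+1.
  rewrite dE natrM -{1}(subnK nsm) exprD exprMn.
  move: (c ^+ _) (c ^+ _) ((-1) ^+ _) (alpha i ^+ _) => *.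
  by field; rewrite addrC natr1 pnatr_eq0.
by rewrite !rpredM ?rpred_nat ?rpredX ?rpredN ?rpred1 // intr_int.
Qed.

Lemma pade_form_int (lambda : 'I_m.+1 -> int) l mu : (mu <= m)%N ->
  (pade_denom l)%:~R * pade_form alpha (fun i => (lambda i)%:~R) (pade alpha l mu)
    \is a Num.int.
Proof.
move=> mum; rewrite /pade_form mulrBr mulrCA mulr_sumr rpredB //.
  by rewrite rpredM ?intr_int ?pade_m1_int.
by rewrite rpred_sum // => i _; rewrite mulrCA rpredM ?intr_int ?pade_integral_int.
Qed.
End Denominators.

(** * p-adic estimates *)

Section PadicEstimates.
Variables (p : nat) (p_pr : prime p).
Local Notation abs := (padic_abs p).

Lemma padic_absX x k : abs (x ^+ k) = abs x ^+ k.
Proof.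
elim: k => [|k IH]; first by rewrite !expr0 padic_abs1.
by rewrite !exprS padic_absM // IH.
Qed.

Lemma padic_abs_int (z : int) : z != 0 -> abs z%:~R = (p ^ logn p `|z|)%:R^-1.
Proof.
move=> z0; rewrite /padic_abs intr_eq0 (negbTE z0) /padic_val numq_int denq_int.
by rewrite logn1 subr0 natrX -exprnN.
Qed.

Lemma padic_abs_int_le1 (z : int) : abs z%:~R <= 1.
Proof.
have [->|z0] := eqVneq z 0; first by rewrite padic_abs0.
by rewrite padic_abs_int // invf_le1 ?ler1n ?ltr0n expn_gt0 prime_gt0.
Qed.

(** The largest power of [p] dividing a nonzero integer is at most its absolute value. *)
Lemma padic_abs_int_ge (z : int) : z != 0 -> `|z%:~R|^-1 <= abs z%:~R.
Proof.
move=> z0; rewrite padic_abs_int // lef_pV2 ?posrE ?normr_gt0 ?intr_eq0 //; last first.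
  by rewrite ltr0n expn_gt0 prime_gt0.
by rewrite -intr_norm -abszE ler_nat dvdn_leq ?absz_gt0 ?pfactor_dvdnn.
Qed.

Lemma padic_abs_inv_nat n : abs n.+1%:R^-1 <= n.+1%:R.
Proof.
have n0 : abs n.+1%:R != 0 by rewrite padic_abs_eq0 ?pnatr_eq0.
have := @padic_abs_int_ge n.+1 isT; rewrite normr_nat.
rewrite -[_%:~R]/(n.+1%:R) => h.
have -> : abs n.+1%:R^-1 = (abs n.+1%:R)^-1.
  by apply: (mulfI n0); rewrite -padic_absM // !mulfV ?pnatr_eq0 // padic_abs1.
rewrite invf_ple ?posrE ?ltr0n //.
by rewrite lt_neqAle eq_sym n0 padic_abs_ge0.
Qed.

Lemma padic_abs_sum_le (I : Type) (r : seq I) (P : pred I) (F : I -> rat) b :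
  0 <= b -> (forall i, P i -> abs (F i) <= b) -> abs (\sum_(i <- r | P i) F i) <= b.
Proof.
move=> b0 Fb; elim/big_ind: _ => [|x y xb yb|//]; first by rewrite padic_abs0.
by rewrite (le_trans (padic_absD p_pr x y)) // ge_max xb.
Qed.

(** Nonzero absolute values are powers of [p], so below 1 they are at most [1 / p]. *)
Lemma padic_abs_lt1 x : abs x < 1 -> abs x <= 2^-1.
Proof.
move=> x1; rewrite /padic_abs in x1 *; case: ifP x1 => // _.
rewrite -[X in _ < X](expr0z p%:R) ltr_eXz2l ?ltr1n ?prime_gt1 // => v.
apply: (@le_trans _ _ (p%:R ^ (-1))).
  by rewrite ler_eXz2l ?ltr1n ?prime_gt1 //; lia.
by rewrite exprN1 lef_pV2 ?posrE ?ltr0n ?prime_gt0 // ler_nat prime_gt1.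
Qed.

Lemma padic_null_sum (I : Type) (r : seq I) (u : I -> nat -> rat) :
  (forall i, padic_null p (u i)) -> padic_null p (fun n => \sum_(i <- r) u i n).
Proof.
move=> u0; elim: r => [|i r IH] e e0.
  by exists 0%N => n _; rewrite big_nil padic_abs0.
have [N hN] := u0 i e e0; have [N' hN'] := IH e e0.
exists (maxn N N') => n; rewrite geq_max big_cons => /andP[/hN ? /hN' ?].
exact: padic_absD_lt.
Qed.

Lemma padic_nullZ c (u : nat -> rat) :
  padic_null p u -> padic_null p (fun n => c * u n).
Proof. exact: (padic_nullM p_pr (padic_cauchy_cst p c)). Qed.

(* The proof of primality is a phantom argument, for the subring structure. *)
Definition padic_integers of prime p : {pred rat} := [pred x | abs x <= 1].

Fact padic_integers_subring : subring_closed (padic_integers p_pr).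
Proof.
split=> [|x y|x y]; rewrite !inE ?padic_abs1 // => x1 y1.
- by rewrite (le_trans (padic_absD p_pr _ _)) // ge_max x1 padic_absN.
- by rewrite padic_absM // mulr_ile1 ?padic_abs_ge0.
Qed.
HB.instance Definition _ :=
  GRing.isSubringClosed.Build rat (padic_integers p_pr) padic_integers_subring.

(** The ratio of consecutive terms is [(k + 1) b / k], at most 1 when [b <= 1/2]. *)
Lemma natr_exp_le (b : rat) n n' : 0 <= b -> b <= 2^-1 -> (0 < n)%N -> (n <= n')%N ->
  n'%:R * b ^+ n' <= n%:R * b ^+ n.
Proof.
move=> b0 b2 n0; elim: n' => [|k IH]; first by rewrite leqn0 => /eqP ->.
rewrite leq_eqVlt => /orP[/eqP -> //|]; rewrite ltnS => nk.
apply: le_trans (IH nk); rewrite exprS mulrA ler_wpM2r ?exprn_ge0 //.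
have k1 : (1 : rat) <= k%:R by rewrite ler1n (leq_trans n0).
rewrite (le_trans (ler_wpM2l _ b2)) // -natr1; lra.
Qed.

Definition log1p_sum (x : rat) n := \sum_(k < n) (-1) ^+ k / k.+1%:R * x ^+ k.+1.

Lemma log1p_sum_poly x P n :
  P.[-1] * log1p_sum x n + poly_integral x (quotient_at_m1 P) =
  \sum_(k < n) (-1) ^+ k * poly_integral x (P * 'X^k)
  + (-1) ^+ n * poly_integral x (quotient_at_m1 P * 'X^n).
Proof.
set T := quotient_at_m1 P; pose G : {poly rat} := \sum_(k < n) (-1) ^+ k *: 'X^k.
have -> : log1p_sum x n = poly_integral x G.
  rewrite linear_sum; apply: eq_bigr => k _.
  by rewrite linearZ /= poly_integral_Xn mulrAC mulrA.
have -> : \sum_(k < n) (-1) ^+ k * poly_integral x (P * 'X^k) = poly_integral x (P * G).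
  rewrite mulr_sumr linear_sum; apply: eq_bigr => k _.
  by rewrite -scalerAr linearZ.
rewrite -!linearZ -!linearD /=; congr poly_integral.
have GE : ('X + 1) * G = 1 - (-1) ^+ n *: 'X^n.
  rewrite -exprZn scaleN1r -opprB subrX1 -mulNr opprB opprK addrC; congr (_ * _).
  by apply: eq_bigr => k _; rewrite -scaleN1r exprZn.
have TE : P = T * ('X + 1) + (P.[-1])%:P by rewrite quotient_at_m1K subrK.
rewrite {2}TE mulrDl -mulrA GE mulrBr mulr1 -scalerAr mul_polyC.
by rewrite [RHS]addrAC subrK addrC.
Qed.

Variables (m : nat) (alpha : 'I_m -> rat) (i0 : 'I_m).
Hypotheses (alpha_neq0 : alpha i0 != 0) (alpha_lt1 : abs (alpha i0) < 1).
Hypothesis alpha_max : forall i, abs (alpha i) <= abs (alpha i0).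
Let a := abs (alpha i0).

Let a_gt0 : 0 < a.
Proof. by rewrite lt_neqAle eq_sym padic_abs_eq0 // alpha_neq0 padic_abs_ge0. Qed.

(** Dividing the roots by [alpha i0], the largest of them p-adically, makes them p-adic integers. *)
Lemma padic_abs_coef_node_poly l s : (s <= m * l)%N ->
  abs (node_poly alpha ^+ l)`_s <= a ^+ (m * l - s).
Proof.
move=> sml; have c0 : (alpha i0)^-1 != 0 by rewrite invr_eq0.
have ca i : (alpha i0)^-1 * alpha i \in padic_integers p_pr.
  by rewrite inE -(ler_pM2l a_gt0) mulr1 -padic_absM // mulVKf.
have := coef_node_poly_in c0 ca sml; rewrite inE padic_absM //.
rewrite -(ler_pM2l (exprn_gt0 (m * l - s) a_gt0)) mulr1.
by rewrite /a -padic_absX mulrA -padic_absM // exprVn mulfV ?expf_neq0 // padic_abs1 mul1r.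
Qed.

Lemma padic_abs_poly_integral_Xn i n :
  abs (poly_integral (alpha i) 'X^n) <= n.+1%:R * a ^+ n.+1.
Proof.
rewrite poly_integral_Xn padic_absM // padic_absX mulrC.
apply: ler_pM; rewrite ?exprn_ge0 ?padic_abs_ge0 ?padic_abs_inv_nat //.
by rewrite lerXn2r ?nnegrE ?padic_abs_ge0.
Qed.

(** Terms with [k < l] vanish. Otherwise index [s] contributes [a^(ml - s)] from the coefficient and
    [a^(mu + s + k + 1)] from the integral: the exponent no longer depends on [s] and is at least
    [(m + 1) l + 1], and [n a^n] decreases in [n]. *)
Lemma padic_abs_pade_integral l mu i k : (0 < l)%N ->
  abs (poly_integral (alpha i) (pade alpha l mu * 'X^k)) <=
  (m.+1 * l).+1%:R * a ^+ (m.+1 * l).+1.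
Proof.
move=> l0; have b0 : 0 <= (m.+1 * l).+1%:R * a ^+ (m.+1 * l).+1.
  by rewrite mulr_ge0 ?exprn_ge0 ?(ltW a_gt0).
rewrite poly_integral_legendre ?dvdp_node_poly //.
have [kl|lk] := ltnP k l; first by rewrite bin_small // mulr0 mul0r padic_abs0.
have C1 : abs ((-1) ^+ l * 'C(k, l)%:R) <= 1.
  rewrite padic_absM // padic_absX padic_absN padic_abs1 expr1n mul1r.
  exact: (padic_abs_int_le1 'C(k, l)).
rewrite padic_absM // (le_trans (ler_wpM2r (padic_abs_ge0 p_pr _) C1)) // mul1r.
set W := node_poly alpha ^+ l.
have -> : W = \sum_(s < (m * l).+1) W`_s *: 'X^s.
  by rewrite -[LHS]coefK poly_def size_node_poly_exp.
rewrite mulr_sumr mulr_suml linear_sum; apply: padic_abs_sum_le => // s _.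
have sml : (s <= m * l)%N by rewrite -ltnS.
rewrite -scalerAr -scalerAl -!exprD linearZ /= padic_absM //.
apply: (@le_trans _ _ ((mu + s + k).+1%:R * a ^+ (mu + m * l + k).+1)).
  have := ler_pM (padic_abs_ge0 p_pr _) (padic_abs_ge0 p_pr _)
    (padic_abs_coef_node_poly sml) (padic_abs_poly_integral_Xn i (mu + s + k)).
  move/le_trans; apply; rewrite mulrCA -exprD.
  by rewrite (_ : (m * l - s + (mu + s + k).+1 = (mu + m * l + k).+1)%N) //; lia.
apply: (@le_trans _ _ ((mu + m * l + k).+1%:R * a ^+ (mu + m * l + k).+1)).
  by rewrite ler_wpM2r ?exprn_ge0 ?(ltW a_gt0) // ler_nat; lia.
apply: natr_exp_le => //; first exact: ltW.
  exact: padic_abs_lt1.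
by rewrite mulSn; lia.
Qed.

(** Up to sign, the integral of a monomial is a term of the logarithm series, which tends to 0. *)
Lemma padic_null_poly_integral i P :
  padic_null p (fun n => (-1) ^+ n * poly_integral (alpha i) (P * 'X^n)).
Proof.
have -> : (fun n => (-1) ^+ n * poly_integral (alpha i) (P * 'X^n)) =
    (fun n => \sum_(s < size P) P`_s * ((-1) ^+ n * poly_integral (alpha i) 'X^(s + n))).
  apply: funext => n; rewrite -{1}[P]coefK poly_def mulr_suml linear_sum mulr_sumr.
  apply: eq_bigr => s _; rewrite -scalerAl -exprD linearZ /= mulrCA //.
apply: padic_null_sum => s; apply: padic_nullZ => e e0.
have [N hN] := padic_log_term_null p_pr (le_lt_trans (alpha_max i) alpha_lt1) e0.
exists N => n Nn; have := hN (s + n)%N (leq_trans Nn (leq_addl _ _)).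
rewrite poly_integral_Xn !padic_absM // !padic_absX padic_absN padic_abs1 !expr1n.
by rewrite !mul1r mulrC.
Qed.

Definition padic_log_form_sum (lambda : 'I_m.+1 -> int) n : rat :=
  (lambda ord0)%:~R + \sum_(i < m) (lambda (lift ord0 i))%:~R * log1p_sum (alpha i) n.

End PadicEstimates.

(** * Lower bound for the truncated linear forms *)

Section PadicLowerBound.
Variables (p : nat) (p_pr : prime p) (m : nat).
Variables (lambda : 'I_m.+1 -> int) (alpha : 'I_m -> rat) (Q : int) (M H a : rat).
Hypotheses (m_ge1 : (1 <= m)%N) (lambda_neq0 : exists i, lambda i != 0).
Hypotheses (alpha_inj : injective alpha) (alpha_neq0 : forall i, alpha i != 0).
Hypotheses (Q_gt0 : 0 < Q) (Qalpha : forall i, Q%:~R * alpha i \is a Num.int).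
Hypotheses (M_gt1 : 1 < M) (alphaM : forall i, `|alpha i| <= M).
Hypothesis lambdaH : forall i, `|(lambda i)%:~R| <= H.
Hypotheses (a_attained : exists i, padic_abs p (alpha i) = a) (a_lt1 : a < 1).
Hypothesis alpha_le_a : forall i, padic_abs p (alpha i) <= a.

(** With [D = pade_denom m Q l], the nonzero integer [z = D * pade_form] has [|z| <= B], so
    [|z|_p >= 1/B]. It also equals [D P(-1)] times the truncated form minus [D (rem + eps)], where
    [D] and [D P(-1)] are integers and the remainder is below [1/B]; hence the truncated form is
    not. *)
Lemma padic_log_form_sum_ge l (B : rat) : (1 <= l)%N ->
  (pade_denom m Q l)%:~R * (H * m.+1%:R *
    (2 ^+ (l + m).-1 * (M ^+ m.+1 / (M - 1)) * (3 * M) ^+ (m * l))) <= B ->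
  (m.+1 * l).+1%:R * a ^+ (m.+1 * l).+1 * B < 1 ->
  exists N, forall n, (N <= n)%N ->
    B^-1 <= padic_abs p (padic_log_form_sum alpha lambda n).
Proof.
move=> l1 DB rem1.
have [i0 ai0] := a_attained.
have alpha_max i : padic_abs p (alpha i) <= padic_abs p (alpha i0) by rewrite ai0.
have alpha_lt1 : padic_abs p (alpha i0) < 1 by rewrite ai0.
have lambda_rat : exists i, (lambda i)%:~R != 0 :> rat.
  by have [i li] := lambda_neq0; exists i; rewrite intr_eq0.
have [mu N0] := pade_form_neq0 alpha_inj alpha_neq0 l lambda_rat.
have mum : (mu <= m)%N by rewrite -ltnS.
have Q0 : Q != 0 by rewrite gt_eqF.
set P := pade alpha l mu in N0.
have /intrP[z zE] := pade_form_int Q0 Qalpha lambda l mum.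
rewrite -/P in zE.
have D0 : (0 : rat) < (pade_denom m Q l)%:~R.
  by rewrite ltr0z mulr_gt0 ?exprn_gt0 // ltr0n lcm_upto_gt0.
have z0 : z != 0.
  by rewrite -(intr_eq0 rat) -zE mulf_neq0 // gt_eqF.
have zB : `|z%:~R| <= B.
  rewrite -zE normrM (gtr0_norm D0); apply: le_trans DB.
  by rewrite ler_wpM2l ?(ltW D0) // pade_form_le.
have B0 : 0 < B by apply: lt_le_trans zB; rewrite normr_gt0 intr_eq0.
have zp : B^-1 <= padic_abs p z%:~R.
  apply: le_trans (padic_abs_int_ge p_pr z0).
  by rewrite lef_pV2 ?posrE // normr_gt0 intr_eq0.
pose eps n := \sum_(i < m) (lambda (lift ord0 i))%:~R *
  ((-1) ^+ n * poly_integral (alpha i) (quotient_at_m1 P * 'X^n)).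
pose rem n := \sum_(i < m) (lambda (lift ord0 i))%:~R *
  \sum_(k < n) (-1) ^+ k * poly_integral (alpha i) (P * 'X^k).
have formE n : P.[-1] * padic_log_form_sum alpha lambda n =
    pade_form alpha (fun i => (lambda i)%:~R) P + (rem n + eps n).
  rewrite /padic_log_form_sum mulrDr mulrC /pade_form -addrA; congr (_ + _).
  rewrite -big_split /= -sumrN mulr_sumr -big_split /=; apply: eq_bigr => i _.
  by rewrite -mulrDr -log1p_sum_poly mulrCA; ring.
have eps0 : padic_null p eps.
  apply: padic_null_sum => // i; apply: padic_nullZ => //.
  by apply: (@padic_null_poly_integral _ p_pr _ _ i0).
have remB n : padic_abs p (rem n) < B^-1.
  apply: (@le_lt_trans _ _ ((m.+1 * l).+1%:R * a ^+ (m.+1 * l).+1)); last first.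
    by rewrite -[ltRHS]mul1r ltr_pdivlMr.
  have b0 : 0 <= (m.+1 * l).+1%:R * a ^+ (m.+1 * l).+1.
    by rewrite mulr_ge0 ?exprn_ge0 // -ai0 padic_abs_ge0.
  apply: padic_abs_sum_le => // i _; rewrite padic_absM //.
  rewrite (le_trans (ler_wpM2r (padic_abs_ge0 p_pr _) (padic_abs_int_le1 p_pr _))) //.
  rewrite mul1r; apply: padic_abs_sum_le => // k _.
  rewrite padic_absM // padic_absX // padic_absN padic_abs1 expr1n mul1r -ai0.
  exact: padic_abs_pade_integral.
have Binv0 : 0 < B^-1 by rewrite invr_gt0.
have [N hN] := eps0 _ Binv0; exists N => n Nn.
rewrite leNgt; apply/negP => small.
suff : padic_abs p z%:~R < B^-1 by rewrite ltNge zp.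
have D1 x : padic_abs p x < B^-1 -> padic_abs p ((pade_denom m Q l)%:~R * x) < B^-1.
  apply: le_lt_trans; rewrite padic_absM //.
  by rewrite -[leRHS]mul1r ler_wpM2r ?padic_abs_ge0 ?padic_abs_int_le1.
have -> : z%:~R = (pade_denom m Q l)%:~R * P.[-1] * padic_log_form_sum alpha lambda n
    - (pade_denom m Q l)%:~R * (rem n + eps n).
  by rewrite -mulrA formE -zE; ring.
apply: padic_absB_lt => //; last by apply: D1; apply: padic_absD_lt => //; exact: hN.
apply: le_lt_trans small; rewrite padic_absM //.
have /intrP[w ->] := pade_m1_int Q0 Qalpha l mum.
by rewrite -[leRHS]mul1r ler_wpM2r ?padic_abs_ge0 ?padic_abs_int_le1.
Qed.

End PadicLowerBound.

(** * The p-adic norm and the passage to the limit *)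

Section PadicNormTheory.
Variables (R : realType) (p : nat) (p_pr : prime p).
Implicit Types x y : padic p_pr.
Local Notation norm := (@padic_norm R p p_pr).

Lemma padic_norm_ge0 x : 0 <= norm x.
Proof.
have h := @padic_norm_of_seq R p p_pr (padic_repr x).
rewrite -(padic_reprK x); apply: (cvgr_to_ge h).
by apply: nearW => n; rewrite ler0q padic_abs_ge0.
Qed.

Lemma padic_normM x y : norm (x * y) = norm x * norm y.
Proof.
set u := padic_repr x; set v := padic_repr y.
have huv := cvgM (@padic_norm_of_seq R p p_pr u) (@padic_norm_of_seq R p p_pr v).
rewrite -(padic_reprK x) -(padic_reprK y) -rmorphM /= -/u -/v.
have := @padic_norm_of_seq R p p_pr (u * v).
rewrite (_ : (fun n => _) = (fun n => ratr (padic_abs p (u n)) * ratr (padic_abs p (v n)))).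
  by move=> h; apply: (cvg_unique (@Rhausdorff R) h (huv _)).
by apply: funext => n; rewrite -rmorphM -padic_absM.
Qed.

Lemma padic_normD x y : norm (x + y) <= norm x + norm y.
Proof.
rewrite -(padic_reprK x) -(padic_reprK y) -rmorphD /=.
have h := cvgD (@padic_norm_of_seq R p p_pr (padic_repr x)) (@padic_norm_of_seq R p p_pr (padic_repr y)).
apply: (ler_cvg_to (@padic_norm_of_seq R p p_pr _) (h _)); apply: nearW => n /=.
rewrite fctE -rmorphD ler_rat (le_trans (padic_absD p_pr _ _)) //.
by rewrite ge_max lerDl lerDr !padic_abs_ge0.
Qed.

Lemma padic_norm_sum (I : Type) (r : seq I) (F : I -> padic p_pr) :
  norm (\sum_(i <- r) F i) <= \sum_(i <- r) norm (F i).
Proof.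
elim: r => [|i r IH]; last first.
  by rewrite !big_cons (le_trans (padic_normD _ _)) // lerD2l.
by rewrite !big_nil -(rmorph0 (padic_of_rat p_pr)) /= -ratr_padic padic_norm_ratr padic_abs0 rmorph0.
Qed.

Lemma padic_of_rat_log1p_sum (x : rat) n : padic_of_rat p_pr (log1p_sum x n) =
  \sum_(k < n) (-1) ^+ k / k.+1%:R * (ratr x) ^+ k.+1.
Proof.
rewrite rmorph_sum; apply: eq_bigr => k _.
by rewrite ratr_padic !(rmorphM, rmorphXn, fmorphV, rmorphN, rmorph1, rmorph_nat).
Qed.

(** By the triangle inequality the truncated form differs from the form by at most the sum of the
    errors of the logarithms, the integer coefficients having norm at most 1; these errors tend to
    0. *)
Lemma padic_log_form_ge m (lambda : 'I_m.+1 -> int) (alpha : 'I_m -> rat) (b : rat) :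
  (forall i, padic_abs p (alpha i) < 1) ->
  (exists N, forall n, (N <= n)%N -> b <= padic_abs p (padic_log_form_sum alpha lambda n)) ->
  ratr b <= norm (padic_log_form R p_pr lambda alpha).
Proof.
move=> alpha1 [N hN]; set L := padic_log_form _ _ _ _.
pose d n : R := \sum_(i < m)
  norm (\sum_(k < n) (-1) ^+ k / k.+1%:R * (ratr (alpha i)) ^+ k.+1
        - padic_log R (1 + ratr (alpha i))).
have d0 : ((fun n => norm L + d n) @ \oo --> norm L).
  rewrite -[X in _ --> X]addr0; apply: cvgD; first exact: cvg_cst.
  rewrite (_ : 0 = \sum_(i < m) (0 : R)); last by rewrite big1.
  by apply: cvg_big => [x|i _]; [exact: add_continuous|]; exact: padic_log_cvg.
apply: (cvgr_to_ge d0); exists N => // n /= Nn.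
apply: (@le_trans _ _ (norm (ratr (padic_log_form_sum alpha lambda n)))).
  by rewrite padic_norm_ratr ler_rat hN.
rewrite -[ratr _](subrK L); apply: le_trans (padic_normD _ _) _.
rewrite [leRHS]addrC lerD2r /L /padic_log_form /padic_log_form_sum ratr_padic rmorphD /= rmorph_int.
rewrite opprD addrACA subrr add0r rmorph_sum -sumrB (le_trans (padic_norm_sum _ _)) //.
apply: ler_sum => i _; rewrite rmorphM /= rmorph_int -mulrBr padic_normM.
rewrite -(ratr_int _ (lambda _)) padic_norm_ratr -[leRHS]mul1r; apply: ler_pM => //.
- by rewrite ler0q padic_abs_ge0.
- exact: padic_norm_ge0.
- by rewrite -(rmorph1 (@ratr R)) ler_rat padic_abs_int_le1.
by rewrite padic_of_rat_log1p_sum.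
Qed.

End PadicNormTheory.

(** * The choice of the order *)

Section ChoiceOfOrder.
Variables (R : realType) (m : nat) (M Q a H : R).
Hypotheses (m_ge1 : (1 <= m)%N) (M_gt1 : 1 < M) (Q_ge1 : 1 <= Q).
Hypotheses (a_gt0 : 0 < a) (a_lt1 : a < 1) (H_gt1 : 1 < H).
Hypothesis f_gt1 : 1 < bound_f m M Q a.
Hypothesis T_ge1 : - (1 / expR 1) <= - (1 / (expR (bound_R1 m M Q a) * H)).

Let E : R := expR (rs_const R * m%:R).
(** Chosen so that [f = 1 / (base a^(m+1))] and that the bound of order [l] is [scale * base^l]. *)
Let base : R := 2 * 3 ^+ m * E * Q ^+ m * M ^+ m.
Let scale : R := H * m.+1%:R * 2 ^+ m.-1 * E * Q ^+ m * (M ^+ m.+1 / (M - 1)).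
Let L : R := ln (bound_f m M Q a).
Let T : R := ln H + bound_R1 m M Q a.
Let S : R := T + ln T + 1.

Let L_gt0 : 0 < L. Proof. exact: ln_gt0. Qed.
Let M_gt0 : 0 < M. Proof. exact: lt_trans M_gt1. Qed.
Let M1_gt0 : 0 < M - 1. Proof. by rewrite subr_gt0. Qed.
Let Q_gt0 : 0 < Q. Proof. exact: lt_le_trans Q_ge1. Qed.
Let H_gt0 : 0 < H. Proof. exact: lt_trans H_gt1. Qed.
Let E_gt0 : 0 < E. Proof. exact: expR_gt0. Qed.

Let base_gt0 : 0 < base.
Proof. by rewrite !mulr_gt0 ?exprn_gt0. Qed.

Let scale_gt0 : 0 < scale.
Proof. by rewrite !mulr_gt0 ?invr_gt0 ?exprn_gt0 ?ltr0n. Qed.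

Let base_gt1 : 1 < base.
Proof.
have h1 : 1 <= 3 ^+ m :> R by rewrite exprn_ege1 // ler1n.
have h2 : 1 <= E by rewrite -expR0 ler_expR mulr_ge0 ?rs_const_ge0.
have h3 : 1 <= Q ^+ m by rewrite exprn_ege1.
have h4 : 1 <= M ^+ m by rewrite exprn_ege1 // ltW.
have {}h1 : 2 <= 2 * 3 ^+ m :> R by rewrite ler_peMr.
have {}h1 : 2 <= 2 * 3 ^+ m * E by rewrite (le_trans h1) // ler_peMr // mulr_ge0 ?exprn_ge0.
have {}h1 : 2 <= 2 * 3 ^+ m * E * Q ^+ m.
  by rewrite (le_trans h1) // ler_peMr // (le_trans _ h1).
have {}h1 : 2 <= base by rewrite (le_trans h1) // ler_peMr // (le_trans _ h1).
by rewrite (lt_le_trans _ h1) // ltr1n.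
Qed.

Let bound_fE : bound_f m M Q a = (base * a ^+ m.+1)^-1.
Proof.
by rewrite /bound_f expRN -/E /base !invfM; ring.
Qed.

Let ln_fE : L = - ln base - m.+1%:R * ln a.
Proof.
rewrite /L bound_fE lnV ?posrE ?mulr_gt0 ?exprn_gt0 // lnM ?posrE ?exprn_gt0 //.
by rewrite lnXn // opprD mulr_natl.
Qed.

(** The role of [R_1]: [e^T] is the constant in front of [(l L) f^-l] in the estimate of the
    remainder times the bound. *)
Let expRT : expR T = scale * m.+2%:R * a / L.
Proof.
have h := bound_R1E H m_ge1 M_gt1 Q_gt0 a_gt0 f_gt1.
have e0 : expR T != 0 by rewrite gt_eqF ?expR_gt0.
have TE : expR T = expR (bound_R1 m M Q a) * H.
  by rewrite /T expRD lnK // mulrC.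
apply: invr_inj; rewrite TE -[LHS]mul1r -[LHS]opprK h -/L -mulNr opprK.
rewrite !invfM invrK /scale -/E.
rewrite natr1 (_ : m%:R + 2 = m.+2%:R :> R); last by rewrite -[m.+2]addn2 natrD.
by rewrite invrK; ring.
Qed.

(** The last hypothesis of the theorem says that [e^T >= e]. *)
Let T1 : 1 <= T.
Proof.
move: T_ge1; rewrite lerN2 !div1r lef_pV2 ?posrE ?mulr_gt0 ?expR_gt0 //.
by rewrite -{1}(lnK H_gt0) -expRD ler_expR addrC.
Qed.

(** From [ln f = - ln base - (m + 1) ln a], the exponent [(m + 1) ln a / ln f + 1] is
    [- ln base / ln f]. The bound of the theorem is thus the inverse of [scale * base^x] at
    [x = S / L + 1]. *)
Lemma bound_rhsE : bound_c1 m M Q a * H `^ (- bound_omega1 m M Q a H) =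
  (scale * expR ((S / L + 1) * ln base))^-1.
Proof.
have kE : (m%:R + 1) * ln a / L + 1 = - (ln base / L).
  have := ln_fE; rewrite -natr1 => e.
  have -> : (m%:R + 1) * ln a = - L - ln base by rewrite e; ring.
  by field; rewrite gt_eqF.
have lnH0 : ln H != 0 by rewrite gt_eqF ?ln_gt0.
rewrite /powR gt_eqF //.
have -> : - bound_omega1 m M Q a H * ln H =
    - (ln base / L * (ln H + ln T)) - ln H.
  rewrite /bound_omega1 -/L -/T -opprD kE opprK.
  by move: (ln H) (ln T) (ln base / L) lnH0 => x y z *; field.
rewrite /bound_c1 -/L kE [(S / L + 1) * _]mulrDl mul1r mulNr !expRD !expRN (lnK H_gt0) (lnK base_gt0).
have -> : expR (2 * rs_const R * m%:R) = E ^+ 2.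
  by rewrite -mulrA mulrC expRM_natr.
have -> : expR (S / L * ln base) = expR (ln base / L * (bound_R1 m M Q a + 1)) * expR (ln base / L * (ln H + ln T)).
  rewrite -expRD; congr expR; rewrite /S /T; ring.
have := expR_gt0 (ln base / L * (bound_R1 m M Q a + 1)).
have := expR_gt0 (ln base / L * (ln H + ln T)).
move: (expR (ln base / L * _)) (expR (ln base / L * _)) => y x.
move=> /lt0r_neq0 x0 /lt0r_neq0 y0; rewrite /base /scale.
have -> : 6 ^+ m = 2 * 2 ^+ m.-1 * 3 ^+ m :> R.
  by rewrite -exprS prednK // -exprMn -natrM.
rewrite [M ^+ (2 * m).+1]exprS !mul2n -!addnn !exprD [M ^+ m.+1]exprS natr1.
have h1 : M - 1 != 0 by rewrite gt_eqF.
have h2 z n : 0 < z -> z ^+ n != 0 :> R by move=> z0; rewrite gt_eqF ?exprn_gt0.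
move: (h2 2 m.-1 (ltr0n _ _)) (h2 3 m (ltr0n _ _)) (h2 _ m Q_gt0) (h2 _ m M_gt0).
have E0 : E != 0 by rewrite gt_eqF.
have m0 : m.+1%:R != 0 :> R by rewrite pnatr_eq0.
have H0 : H != 0 by rewrite gt_eqF.
have M0 : M != 0 by rewrite gt_eqF.
move: h1 E0 m0 H0 M0; move: (E) (m.+1%:R) (2 ^+ m.-1) (3 ^+ m) (Q ^+ m) (M ^+ m).
move: (M) (H) => M' H' *.
field.
by do ?[apply/andP; split].
Qed.

(** The bound on the integer, with lcm(1..m(l+1)) replaced by its exponential estimate. *)
Definition pade_bound l : R :=
  expR (rs_const R * (m * l.+1)%:R) * Q ^+ (m * l.+1) * (H * m.+1%:R *
     (2 ^+ (l + m).-1 * (M ^+ m.+1 / (M - 1)) * (3 * M) ^+ (m * l))).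

(** With [u = l L], the remainder times the bound is at most [e^T u e^(-u)], which is below 1 once
    [u >= S = T + ln T + 1]. The least such [l] satisfies [l < S / L + 1], which gives the second
    inequality. *)
Lemma exists_pade_order : exists l, [/\ (1 <= l)%N,
  (m.+1 * l).+1%:R * a ^+ (m.+1 * l).+1 *
    pade_bound l < 1
  & bound_c1 m M Q a * H `^ (- bound_omega1 m M Q a H) <
    (pade_bound l)^-1].
Proof.
have lnT0 : 0 <= ln T by rewrite ln_ge0.
have S1 : 1 <= S by rewrite /S; move: T1 lnT0; lra.
have ex : exists l, S <= l%:R * L.
  exists (Num.truncn (S / L)).+1; rewrite -ler_pdivrMr //.
  by rewrite ltW // truncnS_gt.
have [l Sl lmin] := ex_minnP ex.
have l1 : (1 <= l)%N.
  by case: l Sl {lmin} => // ; rewrite mul0r; move: S1; lra.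
have lS : l%:R < S / L + 1.
  rewrite -ltrBlDr ltr_pdivlMr // ltNge; apply/negP.
  rewrite (_ : l%:R - 1 = l.-1%:R); last by rewrite -{1}(prednK l1) -natr1 addrK.
  by move/lmin; rewrite -{1}(prednK l1) ltnn.
have bE : pade_bound l = scale * base ^+ l.
  rewrite /pade_bound.
  have -> : expR (rs_const R * (m * l.+1)%:R) = E ^+ l.+1.
    by rewrite natrM mulrA expRM_natr.
  rewrite (_ : (l + m).-1 = (l + m.-1)%N); last by rewrite -{1}(prednK m_ge1) addnS.
  rewrite /scale /base mulnS [Q ^+ (m + _)]exprD [2 ^+ (l + _)]exprD [E ^+ l.+1]exprS.
  rewrite [(3 * M) ^+ _]exprMn ![_ ^+ (m * l)]exprM !exprMn.
  by move: (M ^+ m.+1 / _) (E ^+ l) => *; ring.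
exists l; rewrite bE; split => //.
  have -> : a ^+ (m.+1 * l).+1 = a * (a ^+ m.+1) ^+ l by rewrite exprS exprM.
  have ml : (m.+1 * l).+1%:R <= m.+2%:R * l%:R :> R.
    by rewrite -natrM ler_nat [(m.+2 * l)%N]mulSn -add1n leq_add2r.
  have nn : 0 <= a * (a ^+ m.+1) ^+ l * (scale * base ^+ l).
    exact: (ltW (mulr_gt0 (mulr_gt0 a_gt0 (exprn_gt0 _ (exprn_gt0 _ a_gt0)))
      (mulr_gt0 scale_gt0 (exprn_gt0 _ base_gt0)))).
  apply: (@le_lt_trans _ _ (expR T * (l%:R * L) * (bound_f m M Q a ^- l))).
    rewrite expRT bound_fE exprVn invrK [(base * _) ^+ l]exprMn.
    rewrite [leRHS](_ : _ = m.+2%:R * l%:R * (a * (a ^+ m.+1) ^+ l * (scale * base ^+ l))).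
      by rewrite -[leLHS]mulrA; exact: ler_wpM2r nn _ _ ml.
    have := lt0r_neq0 L_gt0.
    move: L scale (base ^+ l) ((a ^+ m.+1) ^+ l) => L0 s x y L0_neq0; field.
    exact: L0_neq0.
  have u0 : 0 < l%:R * L by move: S1 Sl; lra.
  have -> : bound_f m M Q a ^- l = expR (- (l%:R * L)).
    by rewrite expRN mulrC expRM_natr lnK // posrE (lt_trans _ f_gt1).
  rewrite -{1}(lnK (u0 : l%:R * L \is Num.pos)) -!expRD -[ltRHS]expR0 ltr_expR.
  move: (l%:R * L) u0 Sl => u u0 Su.
  have ln_le (x : R) : 0 < x -> ln x <= x - 1.
    by move=> x0; have := @le_ln1Dx R (x - 1); rewrite [1 + _]addrC subrK; apply; lra.
  have T0 : 0 < T by move: T1; lra.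
  have S0 : 0 < S by move: S1; lra.
  have e2 : 2 < expR 1 :> R by exact: expR_gt1Dx.
  (* Indeed [S <= 2 T < e T], because [ln T <= T - 1]. *)
  have lnS : ln S < 1 + ln T.
    rewrite -[1](expRK (1 : R)) -lnM ?posrE ?expR_gt0 // ltr_ln ?posrE ?mulr_gt0 ?expR_gt0 //.
    apply: (@le_lt_trans _ _ (2 * T)); last by rewrite ltr_pM2r.
    by have := ln_le T T0; rewrite /S; lra.
  (* The tangent of [ln] at [S] has slope [1 / S <= 1]. *)
  have lnu : ln u - ln S <= u - S.
    rewrite -ln_div ?posrE //; apply: (le_trans (ln_le _ (divr_gt0 u0 S0))).
    rewrite -(divff (lt0r_neq0 S0)) -mulrBl ler_pdivrMr // ler_peMr // subr_ge0 //.
  by move: lnS lnu; rewrite /S; lra.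
have p1 : scale * expR ((S / L + 1) * ln base) \is Num.pos.
  exact: mulr_gt0 scale_gt0 (expR_gt0 _).
have p2 : scale * base ^+ l \is Num.pos by exact: mulr_gt0 scale_gt0 (exprn_gt0 _ base_gt0).
rewrite bound_rhsE (ltf_pV2 p1 p2) (ltr_pM2l scale_gt0).
rewrite -{1}(lnK (base_gt0 : base \is Num.pos)) -expRM_natr ltr_expR mulrC.
by rewrite (ltr_pM2r (ln_gt0 base_gt1)).
Qed.

End ChoiceOfOrder.

(** * Conclusion over the reals *)

Lemma ratr_bigmax (R : realType) (I : finType) (F : I -> rat) :
  ratr (\big[Num.max/0]_i F i) = \big[Num.max/0]_i ratr (F i) :> R.
Proof.
apply: (big_morph ratr) => [x y|]; last exact: rmorph0.
by rewrite !maxEle ler_rat; case: ifP.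
Qed.

Theorem theorem2p1 (R : realType) (p : nat) (p_pr : prime p) (m : nat)
    (lambda : 'I_m.+1 -> int) (alpha : 'I_m -> rat) (Q : int)
    (M : R := max_abs R alpha)
    (a : R := max_padic_abs R p alpha)
    (H : R := height R lambda) :
  (1 <= m)%N ->
  (exists i, lambda i != 0) ->
  injective alpha ->
  (forall i, alpha i != 0) ->
  0 < Q ->
  (forall i, Q%:~R * alpha i \is a Num.int) ->
  1 < M ->
  a < 1 ->
  1 < H ->
  1 < bound_f m M Q%:~R a ->
  - (1 / (expR (bound_R1 m M Q%:~R a) * H)) >= - (1 / expR 1) ->
  padic_norm R (padic_log_form R p_pr lambda alpha) >
    bound_c1 m M Q%:~R a * H `^ (- bound_omega1 m M Q%:~R a H).
Proof.
move=> m_ge1 lambda_neq0 alpha_inj alpha_neq0 Q_gt0 Qalpha M_gt1 a_lt1 H_gt1 f_gt1 e_le.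
(* The arithmetic argument takes place in [rat], so the maxima are formed there and then embedded in
   [R]. *)
pose M' : rat := \big[Num.max/0]_(i < m) `|alpha i|.
pose a' : rat := \big[Num.max/0]_(i < m) padic_abs p (alpha i).
pose H' : rat := \big[Num.max/0]_(i < m.+1) `|(lambda i)%:~R|.
have ME : M = ratr M'.
  by rewrite ratr_bigmax; apply: eq_bigr => i _; rewrite ratr_norm.
have aE : a = ratr a' by rewrite ratr_bigmax.
have HE : H = ratr H'.
  by rewrite ratr_bigmax; apply: eq_bigr => i _; rewrite ratr_norm ratr_int.
have alphaM i : `|alpha i| <= M' by exact: le_bigmax.
have alpha_le i : padic_abs p (alpha i) <= a' by exact: le_bigmax.
have lambdaH i : `|(lambda i)%:~R| <= H' by exact: le_bigmax.
have attained : exists i, padic_abs p (alpha i) = a'.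
  exists [arg max_(i > Ordinal m_ge1) padic_abs p (alpha i)]%O.
  by rewrite /a' (bigmax_eq_arg _ (Ordinal m_ge1)) // => i _; exact: padic_abs_ge0.
have a_gt0 : 0 < a.
  have [i ai] := attained; rewrite aE ltr0q -ai lt_neqAle eq_sym.
  by rewrite padic_abs_eq0 ?alpha_neq0 ?padic_abs_ge0.
have M'_gt1 : 1 < M' by rewrite -(ltr_rat R) -ME rmorph1.
have a'_lt1 : a' < 1 by rewrite -(ltr_rat R) -aE rmorph1.
have Q_ge1 : 1 <= Q%:~R :> R by rewrite ler1z -gtz0_ge1.
have [l [l1 rem lt]] := exists_pade_order m_ge1 M_gt1 Q_ge1 a_gt0 H_gt1 f_gt1 e_le.
pose B : rat := (pade_denom m Q l)%:~R * (H' * m.+1%:R *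
  (2 ^+ (l + m).-1 * (M' ^+ m.+1 / (M' - 1)) * (3 * M') ^+ (m * l))).
have M0 : 0 < M' by exact: lt_trans M'_gt1.
have H0 : 0 < H' by rewrite -(ltr_rat R) -HE rmorph0 (lt_trans _ H_gt1).
have B'0 : 0 < H' * m.+1%:R * (2 ^+ (l + m).-1 * (M' ^+ m.+1 / (M' - 1)) * (3 * M') ^+ (m * l)).
  by rewrite !mulr_gt0 ?invr_gt0 ?exprn_gt0 ?mulr_gt0 ?subr_gt0 ?ltr0n.
have B0 : 0 < B.
  by rewrite mulr_gt0 // ltr0z mulr_gt0 ?exprn_gt0 // ltr0n lcm_upto_gt0.
(* The estimate of lcm(1..m(l+1)) enters here. *)
have BB : ratr B <= pade_bound m M Q%:~R H l :> R.
  rewrite /B rmorphM /= ratr_int; set K := (H' * _ * _).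
  have KE : ratr K = H * m.+1%:R * (2 ^+ (l + m).-1 * (M ^+ m.+1 / (M - 1)) * (3 * M) ^+ (m * l)).
    by rewrite ME HE /K !(rmorphM, rmorphXn, fmorphV, rmorphB, rmorph1, rmorph_nat).
  rewrite /pade_bound -KE ler_wpM2r ?ler0q ?(ltW B'0) // /pade_denom intrM.
  rewrite rmorphXn /= ler_wpM2r ?exprn_ge0 ?(le_trans _ Q_ge1) //.
  by rewrite [X in X <= _]rmorph_nat lcm_upto_le_expR.
apply: (lt_le_trans lt).
apply: (@le_trans _ _ (ratr B^-1)).
  by rewrite fmorphV lef_pV2 ?posrE ?ltr0q // (lt_le_trans _ BB) ?ltr0q.
apply: padic_log_form_ge.
  by move=> i; exact: le_lt_trans (alpha_le i) a'_lt1.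
apply: (padic_log_form_sum_ge p_pr m_ge1 lambda_neq0 alpha_inj alpha_neq0 Q_gt0 Qalpha
  M'_gt1 alphaM lambdaH attained a'_lt1 alpha_le l1 (lexx _)).
rewrite -(ltr_rat R) rmorph1; apply: le_lt_trans rem.
rewrite rmorphM; apply: ler_pM => //.
- by rewrite ler0q mulr_ge0 ?exprn_ge0 // -(ler_rat R) rmorph0 -aE ltW.
- by rewrite ler0q ltW.
by rewrite rmorphM rmorph_nat rmorphXn aE.
Qed.
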